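(* Let $K$ be a compact subset of the unit circle $\mathbb{T}$ of arclength measure $0$. Then: (a) the set $\mathcal{U}_K$ is a dense $G_\delta$ subset of $(\mathcal{B},\tau)$; (b) there exists an infinite Blaschke product that belongs to $\mathcal{U}_K$; (c) the set $\mathcal{U}_K\cap\mathcal{S}$ is a dense $G_\delta$ subset of $(\mathcal{S},\tau)$; (d) there exists a singular inner function that belongs to $\mathcal{U}_K$.
   Context: $\mathbb{D}$ is the open unit disc in $\mathbb{C}$ and $\mathbb{T}=\partial\mathbb{D}$. $\mathcal{B}$ is the set of holomorphic functions $f$ on $\mathbb{D}$ with $\sup_{z\in\mathbb{D}}|f(z)|\le1$, and $\mathcal{S}$ is the set of zero-free elements of $\mathcal{B}$. $\tau$ is the topology of locally uniform convergence on $\mathbb{D}$ (uniform convergence on all compact subsets of $\mathbb{D}$), on $\mathcal{B}$ and, as subspace topology, on $\mathcal{S}$. For a compact set $K\subseteq\mathbb{T}$, $C(K)$ is the space of continuous complex-valued functions on $K$, $\|\varphi\|_K=\sup_{z\in K}|\varphi(z)|$, and $BC(K)=\{\varphi\in C(K):\|\varphi\|_K\le1\}$. For $f\in\mathcal{B}$ and $r\in(0,1)$, $f_r$ is the dilate $f_r(z)=f(rz)$. Definition of $\mathcal{U}_K$: for $K\subseteq\mathbb{T}$ compact, a function $f\in\mathcal{B}$ belongs to $\mathcal{U}_K$ if for any $\varphi\in BC(K)$ there exists a sequence $(r_n)_n$ in $(0,1)$ converging to $1$ such that $\|f_{r_n}-\varphi\|_K\to0$. An infinite Blaschke product is a Blaschke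 product on $\mathbb{D}$ (in the usual sense, possibly with a unimodular constant factor) with infinitely many zeros. A singular inner function is a function $S\in\mathcal{S}$ of the form $S(z)=\exp\left(-\int_{\mathbb{T}}\frac{w+z}{w-z}\,d\mu(w)\right)$, $z\in\mathbb{D}$, for some finite positive Borel measure $\mu$ on $\mathbb{T}$ singular with respect to arclength measure. *)

(* Defs.v *)
From HB Require Import structures.
From mathcomp Require Import all_boot all_order all_algebra.
From mathcomp Require Import all_classical all_reals all_analysis borel_hierarchy.
From mathcomp.real_closed Require Import complex.

Set Implicit Arguments.
Unset Strict Implicit.
Unset Printing Implicit Defensive.

Import Order.TTheory GRing.Theory Num.Theory.
Import numFieldNormedType.Exports.

Local Open Scope classical_set_scope.
Local Open Scope ring_scope.
Local Open Scope complex_scope.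

(* Usual topology and norm on R[i], seen as a normed module over itself:
   [derivable f z 1], for [f : R[i] -> R[i]], is complex differentiability. *)
HB.instance Definition _ (R : rcfType) := GRing.ComAlgebra.copy R[i] R[i]^o.
HB.instance Definition _ (R : rcfType) := Vector.copy R[i] R[i]^o.
HB.instance Definition _ (R : rcfType) := NormedModule.copy R[i] R[i]^o.

(* In R[i] the norm [`|z|] is an element of R[i]; [normc z : R] is its real
   value. *)
Notation cmod := ComplexField.Normc.normc.

Definition disc (R : realType) : set R[i] := [set z | cmod z < 1].
Definition circle (R : realType) : set R[i] := [set z | cmod z = 1].

(* Functions on the disc are represented by their extension by 0 to R[i]
   (condition [f z = 0] off the disc), so that each one has exactly one
   representative. *)
Definition calB (R : realType) : set (R[i] -> R[i]) :=
  [set f | (forall z, disc z -> derivable f z 1) /\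
           (forall z, disc z -> cmod (f z) <= 1) /\
           (forall z, ~ disc z -> f z = 0)].
Arguments calB : clear implicits.

Definition calS (R : realType) : set (R[i] -> R[i]) :=
  [set f | calB R f /\ forall z, disc z -> f z != 0].
Arguments calS : clear implicits.

(* The topology tau: uniform convergence on the compact subsets of the disc. *)
Definition disc_compacts (R : realType) : set (set R[i]) :=
  [set A | compact A /\ A `<=` @disc R].
Arguments disc_compacts : clear implicits.

Definition locunif (R : realType) : topologicalType :=
  {family disc_compacts R, R[i] -> R[i]}.

(* [set_type] carries the topology induced by the ambient one. *)
Definition Bspace (R : realType) : topologicalType :=
  set_type (calB R : set (locunif R)).
Definition Sspace (R : realType) : topologicalType :=
  set_type (calS R : set (locunif R)).

Definition Bval (R : realType) (f : Bspace R) : R[i] -> R[i] := set_val f.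
Definition Sval (R : realType) (f : Sspace R) : R[i] -> R[i] := set_val f.

(* Meaningful when f is bounded on K, e.g. continuous on a compact K; the
   value is 0 when K is empty. *)
Definition norm_on (R : realType) (K : set R[i]) (f : R[i] -> R[i]) : R :=
  sup [set cmod (f z) | z in K].

(* Only the values of the functions on K matter. *)
Definition BC (R : realType) (K : set R[i]) : set (R[i] -> R[i]) :=
  [set phi | {within K, continuous phi} /\ norm_on K phi <= 1].

Definition dilate (R : realType) (r : R) (f : R[i] -> R[i]) : R[i] -> R[i] :=
  fun z => f (r%:C * z).

Definition calU (R : realType) (K : set R[i]) : set (R[i] -> R[i]) :=
  [set f | calB R f /\
     forall phi : R[i] -> R[i], BC K phi ->
       exists r : nat -> R,
         [/\ forall n, 0 < r n < 1,
             r @ \oo --> (1 : R) &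
             (fun n => norm_on K (dilate (r n) f \- phi)) @ \oo --> (0 : R)]].

Definition cis (R : realType) (t : R) : R[i] := cos t +i* sin t.

Definition cexp (R : realType) (z : R[i]) : R[i] :=
  (expR (complex.Re z))%:C * cis (complex.Im z).

Definition arclength (R : realType) (A : set R[i]) : \bar R :=
  lebesgue_measure (`[0, 2 * pi[ `&` (@cis R @^-1` A)).

Definition borelC (R : realType) := g_sigma_algebraType (@open R[i]).

Definition Cintegral (R : realType)
    (mu : {finite_measure set (borelC R) -> \bar R})
    (D : set R[i]) (g : R[i] -> R[i]) : R[i] :=
  Rintegral mu D (fun w => complex.Re (g w)) +i*
  Rintegral mu D (fun w => complex.Im (g w)).

(* A finite Borel measure on the circle is represented by a finite Borel
   measure on R[i] giving no mass to the complement of the circle. *)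
Definition on_circle (R : realType)
    (mu : {finite_measure set (borelC R) -> \bar R}) : Prop :=
  mu (~` @circle R) = 0%E.

Definition singular_to_arclength (R : realType)
    (mu : {finite_measure set (borelC R) -> \bar R}) : Prop :=
  exists N : set (borelC R),
    [/\ measurable N, N `<=` @circle R, arclength N = 0%E &
        mu (@circle R `\` N) = 0%E].

Definition singular_inner (R : realType) (f : R[i] -> R[i]) : Prop :=
  calS R f /\
  exists mu : {finite_measure set (borelC R) -> \bar R},
    [/\ on_circle mu, singular_to_arclength mu &
        forall z, disc z ->
          f z = cexp (- Cintegral mu (@circle R)
                          (fun w => (w + z) / (w - z)))].

Definition blaschke_factor (R : realType) (a z : R[i]) : R[i] :=
  (cmod a)%:C / a * ((a - z) / (1 - conjc a * z)).

(* The nonzero zeros, repeated according to multiplicity, form the sequence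
   [a]; [m] is the multiplicity of the zero at the origin. *)
Definition infinite_blaschke (R : realType) (f : R[i] -> R[i]) : Prop :=
  exists (c : R[i]) (m : nat) (a : nat -> R[i]),
    [/\ cmod c = 1,
        forall n, 0 < cmod (a n) < 1,
        cvgn (series (fun n => 1 - cmod (a n))) &
        forall z, disc z ->
          (fun n => c * z ^+ m * \prod_(k < n) blaschke_factor (a k) z)
            @ \oo --> f z].

(* Main.v *)
(* As K is null, it is covered by finitely many arcs of small total length.
   Sums of Herglotz kernels with poles just outside the disc then have positive
   real part, large on K and small on |z| <= r.  They produce peak polynomials,
   and from these polynomials H that are small on |z| <= r, have prescribed
   values on K up to a small error, and elsewhere in the disc are close to a
   multiple t a, 0 <= t <= 1, of one of the prescribed values a.  So g + H, or
   g exp(-H) when g is zero-free, gets close to a given target on K without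
   leaving the unit ball.  Iterating over a dense sequence of targets, each
   repeated infinitely often, along radii increasing to 1, yields elements of
   U_K close to any given function; U_K is G-delta because each target and each
   precision impose an open condition.

   For (b) and (d) the corrections have to be inner.  Discretizing the Herglotz
   integral of H at roots of unity, moved slightly off K, approximates exp(-H)
   by a finite product of factors exp(-m (w + z) / (w - z)).  These are
   unimodular on K, so the product already built can be divided out of the next
   target.  The resulting infinite product is the singular inner function of an
   atomic measure, and replacing each factor by a power of a Blaschke factor
   with zero (1 - d) w yields the Blaschke product. *)

Require Import Defs.
From HB Require Import structures.
From mathcomp Require Import all_boot all_order all_algebra.
From mathcomp Require Import all_classical all_reals all_analysis borel_hierarchy.
From mathcomp.real_closed Require Import complex.
From mathcomp Require Import measurable_realfun zify ring lra.

Import Order.TTheory GRing.Theory Num.Theory.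
Import numFieldNormedType.Exports.

Local Open Scope classical_set_scope.
Local Open Scope ring_scope.
Local Open Scope complex_scope.

Set Implicit Arguments.
Unset Strict Implicit.
Unset Printing Implicit Defensive.

(** * The complex modulus and compactness *)

(** Holomorphy is handled through uniform approximation by polynomials; Cauchy's estimates come from
    averages over roots of unity, and poles are kept outside the closed disc, so that the kernels
    are themselves limits of polynomials on it. The obstacle in a correction is the zone near K
    where H is neither small nor close to the prescribed value: a quotient F / (T + F) with Re F >=
    0 may be far from the segment [0, 1] there. Averaging over dyadic scales T brings the values
    close to this segment, and a value a is admissible once the whole path t -> [op g (t a)] stays
    in the ball. Every stage keeps a bound strictly below 1 on the closed disc, which is the room
    used by the next one. For inner factors, the discretized masses are positive because the
    correction starts from a constant slightly below 1. Summability of the masses, or of the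
    Blaschke sum, is read off at the origin: the partial products stay within 1/2 of 1 there, which
    bounds the sum of the logarithms. *)

(* [cmod z] has type [R] only up to an unfolding of the coercion from
   [realType] to [rcfType]; [modc z : R] is more robust to unification. *)
Definition modc (R : realType) (z : R[i]) : R := cmod z.

Arguments ComplexField.Normc.normc : simpl never.
Arguments modc : simpl never.

Section Modulus.
Variable R : realType.
Implicit Types (z w : R[i]) (x y e : R).

Lemma normr_cmod z : `|z| = (modc z)%:C.
Proof. by []. Qed.

Lemma cmod0 : modc (0 : R[i]) = 0. Proof. exact: ComplexField.Normc.normc0. Qed.
Lemma cmod1 : modc (1 : R[i]) = 1. Proof. exact: ComplexField.Normc.normc1. Qed.

Lemma cmod_ge0 z : 0 <= modc z.
Proof. by rewrite -ler0c -normr_cmod. Qed.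

Lemma cmodM z w : modc (z * w) = modc z * modc w.
Proof. exact: ComplexField.Normc.normcM. Qed.

Lemma cmodN z : modc (- z) = modc z.
Proof. exact: normcN. Qed.

Lemma cmodV z : modc z^-1 = (modc z)^-1.
Proof. exact: ComplexField.Normc.normcV. Qed.

Lemma cmodf z w : modc (z / w) = modc z / modc w.
Proof. by rewrite cmodM cmodV. Qed.

Lemma cmodX z n : modc (z ^+ n) = modc z ^+ n.
Proof. by elim: n => [|n IH]; rewrite ?expr0 ?cmod1 // !exprS cmodM IH. Qed.

Lemma cmodD z w : modc (z + w) <= modc z + modc w.
Proof. exact: le_normcD. Qed.

Lemma cmodBC z w : modc (z - w) = modc (w - z).
Proof. by rewrite -cmodN opprB. Qed.

Lemma cmodB z w : modc (z - w) <= modc z + modc w.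
Proof. by rewrite -(cmodN w); exact: cmodD. Qed.

Lemma cmod_dist w z v : modc (z - v) <= modc (z - w) + modc (w - v).
Proof. by have := cmodD (z - w) (w - v); rewrite addrA subrK. Qed.

Lemma cmod_subl z w : modc z - modc w <= modc (z - w).
Proof. by rewrite lerBlDr; have := cmodD (z - w) w; rewrite subrK. Qed.

Lemma cmod_eq0 z : (modc z == 0) = (z == 0).
Proof.
by apply/eqP/eqP => [/ComplexField.Normc.eq0_normc //|->]; rewrite cmod0.
Qed.

Lemma cmod_gt0 z : (0 < modc z) = (z != 0).
Proof. by rewrite lt_neqAle cmod_ge0 andbT eq_sym cmod_eq0. Qed.

Lemma cmod_real x : modc x%:C = `|x|.
Proof. by rewrite /modc /ComplexField.Normc.normc /= expr0n addr0 sqrtr_sqr. Qed.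

Lemma cmod_nat n : modc (n%:R : R[i]) = n%:R.
Proof. by rewrite -(rmorph_nat (real_complex R)) cmod_real ger0_norm. Qed.

Lemma sqr_cmod z : modc z ^+ 2 = complex.Re z ^+ 2 + complex.Im z ^+ 2.
Proof. by case: z => a b; rewrite /modc /ComplexField.Normc.normc sqr_sqrtr // addr_ge0 // sqr_ge0. Qed.

Lemma Re_le_cmod z : `|complex.Re z| <= modc z.
Proof.
rewrite -(@ler_pXn2r _ 2) ?nnegrE ?cmod_ge0 // sqr_cmod real_normK ?num_real //.
by rewrite lerDl sqr_ge0.
Qed.

Lemma Im_le_cmod z : `|complex.Im z| <= modc z.
Proof.
rewrite -(@ler_pXn2r _ 2) ?nnegrE ?cmod_ge0 // sqr_cmod real_normK ?num_real //.
by rewrite lerDr sqr_ge0.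
Qed.

Lemma cmod_leReIm z : modc z <= `|complex.Re z| + `|complex.Im z|.
Proof.
rewrite -(@ler_pXn2r _ 2) ?nnegrE ?cmod_ge0 ?addr_ge0 // sqr_cmod sqrrD.
rewrite !real_normK ?num_real // lerD2r lerDl mulrn_wge0 // mulr_ge0 //.
Qed.

Lemma cmodJ z : modc (conjc z) = modc z.
Proof. by case: z => a b; rewrite /modc /ComplexField.Normc.normc /= sqrrN. Qed.

Lemma mulcJ z : z * conjc z = (modc z ^+ 2)%:C.
Proof.
case: z => a b; rewrite sqr_cmod /=; apply/eqP; rewrite eq_complex /=.
by apply/andP; split; apply/eqP; ring.
Qed.

Lemma ReD z w : complex.Re (z + w) = complex.Re z + complex.Re w.
Proof. by case: z; case: w. Qed.
Lemma ImD z w : complex.Im (z + w) = complex.Im z + complex.Im w.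
Proof. by case: z; case: w. Qed.
Lemma ReN z : complex.Re (- z) = - complex.Re z.
Proof. by case: z. Qed.
Lemma ReB z w : complex.Re (z - w) = complex.Re z - complex.Re w.
Proof. by case: z; case: w. Qed.
Lemma ImB z w : complex.Im (z - w) = complex.Im z - complex.Im w.
Proof. by case: z; case: w. Qed.
Lemma ReZ x z : complex.Re (x%:C * z) = x * complex.Re z.
Proof. by case: z => a b /=; rewrite mul0r subr0. Qed.
Lemma ImZ x z : complex.Im (x%:C * z) = x * complex.Im z.
Proof. by case: z => a b /=; rewrite mul0r addr0. Qed.

Lemma ReV z : complex.Re z^-1 = complex.Re z / modc z ^+ 2.
Proof. by rewrite sqr_cmod; case: z => a b. Qed.
Lemma ImV z : complex.Im z^-1 = - complex.Im z / modc z ^+ 2.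
Proof. by rewrite sqr_cmod; case: z => a b /=; rewrite mulNr. Qed.

Lemma real_complexD x y : (x + y)%:C = x%:C + y%:C.
Proof. exact: rmorphD. Qed.
Lemma real_complexB x y : (x - y)%:C = x%:C - y%:C.
Proof. exact: rmorphB. Qed.
Lemma real_complexM x y : (x * y)%:C = x%:C * y%:C.
Proof. exact: rmorphM. Qed.
Lemma real_complexV x : (x^-1)%:C = x%:C^-1.
Proof. exact: fmorphV. Qed.

Lemma cmod_sum (I : Type) (r : seq I) (P : pred I) (F : I -> R[i]) :
  modc (\sum_(i <- r | P i) F i) <= \sum_(i <- r | P i) modc (F i).
Proof.
elim/big_rec2 : _ => [|i y1 y2 _ H]; first by rewrite cmod0.
by apply: le_trans (cmodD _ _) _; rewrite lerD2l.
Qed.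

Lemma Re_sum (I : Type) (r : seq I) (P : pred I) (F : I -> R[i]) :
  complex.Re (\sum_(i <- r | P i) F i) = \sum_(i <- r | P i) complex.Re (F i).
Proof. by elim/big_rec2 : _ => [//|i y1 y2 _ <-]; rewrite ReD. Qed.

Lemma Im_sum (I : Type) (r : seq I) (P : pred I) (F : I -> R[i]) :
  complex.Im (\sum_(i <- r | P i) F i) = \sum_(i <- r | P i) complex.Im (F i).
Proof. by elim/big_rec2 : _ => [//|i y1 y2 _ <-]; rewrite ImD. Qed.

Lemma nbhs_cmodP z (A : set R[i]) :
  nbhs z A <-> exists2 e, 0 < e & forall w, modc (w - z) < e -> A w.
Proof.
split=> [/nbhs_ballP [e /= e0 H]|[e e0 H]].
- exists (complex.Re e); first by move: e0; rewrite ltcE => /andP[].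
  move=> w we; apply: H; rewrite -ball_normE /ball_ /= distrC normr_cmod ltcE /=.
  by move: e0; rewrite ltcE /= => /andP[/eqP <- _]; rewrite eqxx.
- apply/nbhs_ballP; exists e%:C; first by rewrite /= ltcE /= eqxx.
  move=> w; rewrite -ball_normE /ball_ /= distrC normr_cmod ltcR => we.
  exact: H.
Qed.

(** Continuity and uniform continuity relative to K with real epsilon and delta, since the norm of
    [R[i]] takes complex values and cannot be fed to linear arithmetic. *)
Definition econt (K : set R[i]) (f : R[i] -> R[i]) := forall z, K z ->
  forall e, 0 < e -> exists2 d, 0 < d &
    forall w, K w -> modc (w - z) < d -> modc (f w - f z) < e.

Definition eucont (K : set R[i]) (f : R[i] -> R[i]) := forall e, 0 < e ->
  exists2 d, 0 < d &
    forall z w, K z -> K w -> modc (w - z) < d -> modc (f w - f z) < e.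

Lemma within_continuous_econt (K : set R[i]) (f : R[i] -> R[i]) :
  {within K, continuous f} -> econt K f.
Proof.
move=> /subspace_continuousP H z Kz e e0.
have := H z Kz [set v | modc (v - f z) < e].
have N : nbhs (f z) [set v | modc (v - f z) < e].
  by apply/nbhs_cmodP; exists e.
move=> /(_ N); rewrite /= nbhs_simpl /within /=.
move=> /nbhs_cmodP [d d0 Hd]; exists d => // w Kw wd.
exact: Hd.
Qed.

Lemma compact_fin_cover (K : set R[i]) (r : R[i] -> R) :
  compact K -> (forall z, K z -> 0 < r z) ->
  exists s : seq R[i], (forall w, w \in s -> K w) /\
    forall z, K z -> exists2 w, w \in s & modc (z - w) < r w.
Proof.
rewrite compact_cover => cK r0.
have := cK _ K (fun w => [set z | modc (z - w) < r w]).
case.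
- move=> w Kw; rewrite openE => z /= zw; apply/nbhs_cmodP.
  exists (r w - modc (z - w)); first by rewrite subr_gt0.
  move=> v vz /=; apply: le_lt_trans (cmod_dist z _ _) _.
  by rewrite -ltrBrDr.
- by move=> z Kz; exists z => //=; rewrite subrr cmod0 r0.
- move=> D DK cov; exists (finmap.enum_fset D); split.
    by move=> w /DK; rewrite inE.
  by move=> z /cov [w /= wD zw]; exists w.
Qed.

Lemma seq_min_gt0 (T : eqType) (s : seq T) (d : T -> R) :
  (forall w : T, w \in s -> 0 < d w) ->
  exists2 m, 0 < m & forall w : T, w \in s -> m <= d w.
Proof.
elim: s => [|a s IH] ds; first by exists 1.
have [|m m0 ms] := IH; first by move=> w ws; apply: ds; rewrite inE ws orbT.
exists (Num.min (d a) m); first by rewrite lt_min m0 ds // mem_head.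
move=> w; rewrite inE ge_min => /predU1P[->|/ms ->]; first by rewrite lexx.
by rewrite orbT.
Qed.

Lemma seq_max (T : eqType) (s : seq T) (d : T -> R) :
  exists2 m, 0 < m & forall w : T, w \in s -> d w <= m.
Proof.
elim: s => [|a s [m m0 ms]]; first by exists 1.
exists (Num.max (d a) m); first by rewrite lt_max m0 orbT.
move=> w; rewrite inE le_max => /predU1P[->|/ms ->]; first by rewrite lexx.
by rewrite orbT.
Qed.

Lemma compact_eucont (K : set R[i]) f : compact K -> econt K f -> eucont K f.
Proof.
move=> cK cf e e0.
have ch z : exists d, K z -> 0 < d /\
    forall w, K w -> modc (w - z) < d -> modc (f w - f z) < e / 2.
  have [Kz|?] := pselect (K z); last by exists 1.
  have [|d d0 H] := cf z Kz (e / 2); first by lra.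
  by exists d.
pose d z := projT1 (cid (ch z)).
have dP z : K z -> 0 < d z /\
    forall w, K w -> modc (w - z) < d z -> modc (f w - f z) < e / 2.
  exact: (projT2 (cid (ch z))).
(* Half of the radius is spent on reaching a centre from z, the other half on going from z to w. *)
have [|s [sK sc]] := @compact_fin_cover K (fun z => d z / 2) cK.
  by move=> z /dP[]; lra.
have [|m m0 ms] := @seq_min_gt0 _ s (fun w => d w / 2).
  by move=> w /sK /dP[]; lra.
exists m => // z w Kz Kw zw.
have [v vs zv] := sc z Kz; have Kv := sK _ vs; have [dv H] := dP v Kv.
have h1 : modc (f z - f v) < e / 2 by apply: H => //; lra.
have h2 : modc (f w - f v) < e / 2.
  apply: H => //; apply: le_lt_trans (cmod_dist z _ _) _.
  by have := ms v vs; lra.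
apply: le_lt_trans (cmod_dist (f v) _ _) _.
by rewrite (cmodBC (f v)); lra.
Qed.

Lemma compact_bounded_cmod (K : set R[i]) f : compact K -> econt K f ->
  exists2 M, 0 < M & forall z, K z -> modc (f z) <= M.
Proof.
move=> cK cf; have uf := compact_eucont cK cf.
have [d d0 H] := uf 1 ltac:(lra).
have [|s [sK sc]] := @compact_fin_cover K (fun z => d) cK.
  by [].
have [M M0 Ms] := @seq_max _ s (fun w => modc (f w)).
exists (M + 1) => [|z Kz]; first by lra.
have [v vs zv] := sc z Kz; have := H v z (sK _ vs) Kz zv.
by have := cmod_subl (f z) (f v); have := Ms v vs; lra.
Qed.

Definition cdisc : set R[i] := [set z | modc z <= 1].

Lemma real_complex_continuousRI (A : R * R -> R[i]) : (forall p, A p = p.1 +i* p.2) ->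
  continuous A.
Proof.
move=> AE [x y] B /nbhs_cmodP [e e0 H].
apply/nbhs_ballP; exists (e / 2) => /=; first lra.
move=> [x' y'] [/= h1 h2]; apply: H; rewrite !AE /=.
apply: le_lt_trans (cmod_leReIm _) _ => /=.
by move: h1 h2; rewrite /ball /= (distrC x) (distrC y); lra.
Qed.

Lemma cdisc_compact : compact cdisc.
Proof.
pose A (p : R * R) := p.1 +i* p.2.
have cA : compact (A @` (`[-1, 1] `*` `[-1, 1])).
  apply: continuous_compact; last by apply: compact_setX; exact: segment_compact.
  by apply: continuous_subspaceT; apply: real_complex_continuousRI.
apply: subclosed_compact cA _.
- rewrite -[cdisc]setCK; apply: open_closedC; rewrite openE => z /= zw.
  have {}zw : 1 < modc z by rewrite ltNge; apply/negP.
  apply/nbhs_cmodP; exists (modc z - 1); first by lra.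
  move=> w wz; rewrite /cdisc /=; apply/negP; rewrite -ltNge.
  by have := cmod_subl z w; rewrite cmodBC; lra.
- move=> z; rewrite /cdisc /= => z1; exists (complex.Re z, complex.Im z); last by case: z z1.
  have := Re_le_cmod z; have := Im_le_cmod z; rewrite !ler_norml.
  rewrite /= !in_itv /= => /andP[? ?] /andP[? ?]. by split; apply/andP; split; lra.
Qed.

Lemma cvg_cmodP (u : nat -> R[i]) l : u @ \oo --> l <->
  forall e, 0 < e -> exists N, forall n, (N <= n)%N -> modc (u n - l) < e.
Proof.
split=> [H e e0|H].
  have /H : nbhs l [set v | modc (v - l) < e] by apply/nbhs_cmodP; exists e.
  by move=> [N _ HN]; exists N => n Nn; apply: HN.
move=> A /nbhs_cmodP[e e0 HA]; have [N HN] := H e e0.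
by exists N => // n /= Nn; apply: HA; apply: HN.
Qed.

Lemma cvg_realP (u : nat -> R) l : u @ \oo --> l <->
  forall e, 0 < e -> exists N, forall n, (N <= n)%N -> `|u n - l| < e.
Proof.
split=> [/cvgrPdistC_lt H e /H [N _ HN]|H].
  by exists N => n Nn; exact: HN.
by apply/cvgrPdistC_lt => e /H [N HN]; exists N.
Qed.

Lemma cauchy_cmod (u : nat -> R[i]) :
  (forall e, 0 < e -> exists N, forall n, (N <= n)%N -> modc (u n - u N) < e) ->
  exists l : R[i], u @ \oo --> l.
Proof.
move=> H.
have C (p : R[i] -> R) : (forall z w, `|p z - p w| <= modc (z - w)) ->
    exists l : R, (p \o u) @ \oo --> l.
  move=> pl; suff : cvg ((p \o u) @ \oo) by move=> c; exists (lim ((p \o u) @ \oo)).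
  apply/cauchy_cvgP; apply: cauchy_exP => e e0.
  have [N HN] := H e e0; exists (p (u N)), N => // n /= Nn.
  by rewrite /ball /= distrC; apply: le_lt_trans (pl _ _) _; apply: HN.
have [|x hx] := C (@complex.Re R); first by move=> z w; rewrite -ReB Re_le_cmod.
have [|y hy] := C (@complex.Im R); first by move=> z w; rewrite -ImB Im_le_cmod.
exists (x +i* y); apply/cvg_cmodP => e e0.
move/cvg_realP : hx => /(_ (e / 2)) [|N1 h1]; first lra.
move/cvg_realP : hy => /(_ (e / 2)) [|N2 h2]; first lra.
exists (maxn N1 N2) => n; rewrite geq_max => /andP[/h1 + /h2] /=.
have := cmod_leReIm (u n - (x +i* y)); rewrite ReB ImB /=; lra.
Qed.

Lemma norm_on_ge (K : set R[i]) (f : R[i] -> R[i]) M z :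
  (forall z, K z -> modc (f z) <= M) -> K z -> modc (f z) <= norm_on K f.
Proof.
move=> fM Kz; apply: ub_le_sup => /=; last by exists z.
by exists M => _ /= [w /fM ? <-].
Qed.

Lemma norm_on_le (K : set R[i]) (f : R[i] -> R[i]) M : 0 <= M ->
  (forall z, K z -> modc (f z) <= M) -> norm_on K f <= M.
Proof.
move=> M0 fM; have [->|/set0P[z Kz]] := eqVneq K set0.
  by rewrite /norm_on image_set0 sup0.
apply: ge_sup; first by exists (modc (f z)), z.
by move=> _ /= [w /fM ? <-].
Qed.

Lemma norm_on_ge0 (K : set R[i]) (f : R[i] -> R[i]) : 0 <= norm_on K f.
Proof.
have [->|/set0P[z Kz]] := eqVneq K set0; first by rewrite /norm_on image_set0 sup0.
(* For an unbounded image [sup] takes its default value 0, so nonnegativity holds for every f. *)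
have [H|H] := pselect (has_sup [set modc (f z) | z in K]); last by rewrite /norm_on sup_out.
by apply: le_trans (cmod_ge0 (f z)) _; apply: ub_le_sup; [case: H|exists z].
Qed.

End Modulus.
#[export] Hint Extern 0 (is_true (@Order.le _ _ _ (modc _))) => solve [apply: cmod_ge0] : core.

(** * The exponential *)

Section Exponential.
Variable R : realType.
Implicit Types (z w : R[i]) (x y e : R).

(** The derivative is bounded only where |t| <= max(|x|, |y|), so that C may depend on x: with y = 0
    and C = |x|, a linear bound on the derivative becomes a quadratic bound on f. *)
Lemma MVT_le (f df : R -> R) (C x y : R) :
  (forall t : R, is_derive t 1 f (df t)) ->
  (forall t, `|t| <= Num.max `|x| `|y| -> `|df t| <= C) ->
  `|f x - f y| <= C * `|x - y|.
Proof.
move=> fd; wlog xy : x y / y <= x => [H|] Hd.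
  have [/H/(_ Hd)//|yx] := leP y x.
  by rewrite distrC (distrC x); apply: H (ltW yx) _; rewrite maxC.
have [|c cxy ->] := @MVT_segment R f df y x xy (fun t _ => fd t).
  apply: continuous_subspaceT => t.
  by apply: differentiable_continuous; apply/derivable1_diffP; apply: ex_derive.
rewrite normrM ler_wpM2r //; apply: Hd; move: cxy; rewrite in_itv /= le_max.
by move=> /andP[? ?]; rewrite !ler_norml; have [?|?] := leP 0 c;
  [rewrite (ger0_norm (_ : 0 <= x)) ?orTb; last lra|rewrite (ler0_norm (_ : y <= 0)); last lra];
  apply/orP; [left|right]; apply/andP; split; lra.
Qed.

Lemma cos1_bound x : `|cos x - 1| <= x ^+ 2.
Proof.
have s1 (t : R) : `|sin t| <= `|t|.
  have := @MVT_le sin cos 1 t 0 (@is_derive_sin R) (fun t _ => @cos_max R t).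
  by rewrite sin0 !subr0 mul1r.
have := @MVT_le cos (fun t => - sin t) `|x| x 0 (@is_derive_cos R).
rewrite cos0 subr0 -normrM -expr2 ger0_norm ?sqr_ge0 //; apply => t.
by rewrite normr0 normrN (max_idPl (normr_ge0 _)) => ?; apply: le_trans (s1 t) _.
Qed.

Lemma sin1_bound x : `|x| <= 1 -> `|sin x - x| <= x ^+ 2.
Proof.
move=> x1; have D (t : R) : is_derive t 1 (fun t => sin t - t) (cos t - 1) by apply: (@is_deriveB _ _ _ sin id).
have := @MVT_le (fun t => sin t - t) (fun t => cos t - 1) `|x| x 0 D.
rewrite sin0 !subr0 -normrM -expr2 ger0_norm ?sqr_ge0 //; apply => t.
rewrite normr0 (max_idPl (normr_ge0 _)) => tx.
apply: le_trans (cos1_bound _) _; rewrite -real_normK ?num_real // expr2.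
by have := normr_ge0 t; nra.
Qed.

(** From 1 + x <= exp x and 1 - x <= exp (- x), exp x lies between 1 + x and 1 / (1 - x). *)
Lemma expR1_bound x : `|x| <= 2^-1 -> `|expR x - 1 - x| <= 2 * x ^+ 2.
Proof.
rewrite ler_norml => /andP[x1 x2].
have h1 := expR_ge1Dx x; have h2 := expR_ge1Dx (- x).
have h3 := expRxMexpNx_1 x.
rewrite ger0_norm; last by lra.
have h4 : expR x * (1 - x) <= 1 by have := ler_wpM2l (expR_ge0 x) h2; rewrite h3.
nra.
Qed.

Lemma cis_cmod x : modc (cis x) = 1.
Proof.
apply/eqP; rewrite -(@eqrXn2 _ 2) ?cmod_ge0 // expr1n sqr_cmod /=.
by rewrite cos2Dsin2.
Qed.

Lemma cisD x y : cis (x + y) = cis x * cis y.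
Proof.
rewrite /cis cosD sinD; apply/eqP; rewrite eq_complex /=.
by apply/andP; split; apply/eqP; ring.
Qed.

Lemma cis0 : cis (0 : R) = 1.
Proof. by rewrite /cis cos0 sin0. Qed.

(** A chord is at most its arc: |cis t - 1|^2 = 2 (1 - cos t) = 4 sin(t / 2)^2 <= t^2. *)
Lemma cis_lip x y : modc (cis x - cis y) <= `|x - y|.
Proof.
have -> : cis x - cis y = cis y * (cis (x - y) - 1).
  by rewrite mulrBr -cisD mulr1 addrCA subrr addr0.
rewrite cmodM cis_cmod mul1r; set t := x - y.
rewrite -(@ler_pXn2r _ 2) ?nnegrE // sqr_cmod /cis /= subr0.
have -> : (cos t - 1) ^+ 2 + sin t ^+ 2 = 2 * (1 - cos t).
  by rewrite sin2cos2; ring.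
rewrite real_normK ?num_real //.
have -> : t = (t / 2) *+ 2 by rewrite mulr2n; lra.
rewrite cos_mulr2n cos2sin2.
have := @MVT_le sin cos 1 (t / 2) 0 (@is_derive_sin R) (fun t _ => @cos_max R t).
rewrite sin0 !subr0 mul1r => H.
have : sin (t / 2) ^+ 2 <= (t / 2) ^+ 2.
  rewrite -[sin _ ^+ 2]real_normK ?num_real // -[(_ / 2) ^+ 2]real_normK ?num_real //.
  by rewrite ler_pXn2r ?nnegrE.
by rewrite !mulr2n; nra.
Qed.

Lemma circle_cis z : modc z = 1 -> exists2 t, 0 <= t < 2 * pi & z = cis t.
Proof.
move=> z1; have := sqr_cmod z; rewrite z1 expr1n => zE.
have Re1 : -1 <= complex.Re z <= 1.
  by rewrite -ler_norml -z1 Re_le_cmod.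
have c := acosK Re1; have s := sin_acos Re1.
have s2 : 1 - complex.Re z ^+ 2 = complex.Im z ^+ 2 by lra.
have a0 := acos_ge0 Re1; have ap := acos_lepi Re1; have p0 := pi_gt0 R.
move: s; rewrite s2 sqrtr_sqr => s.
have [i0|i0] := leP 0 (complex.Im z).
  exists (acos (complex.Re z)); first by apply/andP; split; lra.
  by rewrite /cis c s ger0_norm //; case: (z).
exists (2 * pi - acos (complex.Re z)).
  suff : acos (complex.Re z) != 0 by rewrite neq_lt => /orP[|] ?; apply/andP; split; lra.
  apply/eqP => H; move: s; rewrite H sin0 => /esym/eqP.
  by rewrite normr_eq0 => /eqP; lra.
rewrite /cis cosB sinB mulrDl mul1r -mulr2n cos2pi sin2pi.
rewrite !mul0r !mul1r addr0 sub0r c s ltr0_norm // opprK.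
by case: (z).
Qed.

Lemma cexpD z w : cexp (z + w) = cexp z * cexp w.
Proof.
by rewrite /cexp ReD ImD expRD cisD real_complexM -!mulrA; congr (_ * _);
   rewrite mulrCA.
Qed.

Lemma cexp0 : cexp (0 : R[i]) = 1.
Proof. by rewrite /cexp /= expR0 cis0 mulr1. Qed.

Lemma cmod_cexp z : modc (cexp z) = expR (complex.Re z).
Proof. by rewrite /cexp cmodM cis_cmod mulr1 cmod_real ger0_norm ?expR_ge0. Qed.

Lemma cexp_neq0 z : cexp z != 0.
Proof. by rewrite -cmod_gt0 cmod_cexp expR_gt0. Qed.

Lemma cexp_real x : cexp x%:C = (expR x)%:C.
Proof. by rewrite /cexp /= cis0 mulr1. Qed.

Lemma cexp_sum (I : Type) (r : seq I) (P : pred I) (F : I -> R[i]) :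
  cexp (\sum_(i <- r | P i) F i) = \prod_(i <- r | P i) cexp (F i).
Proof. exact: (big_morph _ cexpD cexp0). Qed.

(** The bounded imaginary part makes the size of the logarithm depend on |z| only; this gives the
    uniform constant of the multiplicative correction. *)
Lemma cexp_log z : z != 0 -> exists a,
  [/\ cexp a = z, complex.Re a = ln (modc z) & `|complex.Im a| <= 2 * pi].
Proof.
move=> z0; have m0 : 0 < modc z by rewrite cmod_gt0.
have [|t t2 tE] := @circle_cis (z / (modc z)%:C).
  rewrite cmodf cmod_real ger0_norm //. by rewrite divff // gt_eqF.
exists (ln (modc z) +i* t); split => //=.
  rewrite /cexp /= lnK ?posrE // -tE mulrCA. rewrite divff ?mulr1 //.
  by rewrite -cmod_eq0 cmod_real normr_eq0 gt_eqF.
by case/andP: t2 => ? ?; rewrite ger0_norm // ltW.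
Qed.

Lemma cexp_second_order z : modc z <= 2^-1 ->
  modc (cexp z - 1 - z) <= 6 * modc z ^+ 2.
Proof.
move=> z1; have := Re_le_cmod z; have := Im_le_cmod z.
case: z z1 => x y; set m := modc _ => m1 /= ym xm.
(* The three terms are at most 2, 3 and 1 times |z|^2, hence the constant 6. *)
have -> : cexp (x +i* y) - 1 - (x +i* y) =
   (expR x - 1 - x)%:C * cis y + (1 + x)%:C * (cis y - 1 - (0 +i* y)) + (0 +i* (x * y)).
  rewrite /cexp /cis /=; apply/eqP; rewrite eq_complex /=.
  by apply/andP; split; apply/eqP; ring.
have x2 : `|x| <= 2^-1 by lra.
have m0 : 0 <= m by apply: cmod_ge0.
have xx : x ^+ 2 <= m ^+ 2.
  by rewrite -real_normK ?num_real // ler_pXn2r ?nnegrE.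
have yy : y ^+ 2 <= m ^+ 2.
  by rewrite -real_normK ?num_real // ler_pXn2r ?nnegrE.
have h1 := expR1_bound x2.
have h2 : modc (cis y - 1 - (0 +i* y)) <= 2 * y ^+ 2.
  apply: le_trans (cmod_leReIm _) _; rewrite !ReB !ImB /= !subr0.
  have := cos1_bound y; have := @sin1_bound y; lra.
apply: le_trans (cmodD _ _) _.
apply: le_trans (lerD (cmodD _ _) (lexx _)) _.
rewrite !cmodM !cmod_real cis_cmod mulr1.
have h3 : modc (0 +i* (x * y)) <= m ^+ 2.
  apply: le_trans (cmod_leReIm _) _ => /=.
  by rewrite normr0 add0r normrM expr2 ler_pM.
have h4 : `|1 + x| <= 3 / 2.
  by apply: le_trans (ler_normD _ _) _; rewrite normr1; lra.
have h5 : `|1 + x| * modc (cis y - 1 - (0 +i* y)) <= 3 / 2 * (2 * y ^+ 2).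
  exact: ler_pM.
lra.
Qed.

Lemma cexp_near0 z : modc z <= 2^-1 -> modc (cexp z - 1) <= 4 * modc z.
Proof.
move=> z1; have := cexp_second_order z1; have := cmodD (cexp z - 1 - z) z.
rewrite subrK; have := cmod_ge0 z; nra.
Qed.

Lemma cexp_lip (M : R) z w : complex.Re w <= M -> modc (z - w) <= 2^-1 ->
  modc (cexp z - cexp w) <= 4 * expR M * modc (z - w).
Proof.
move=> wM zw; have -> : cexp z - cexp w = cexp w * (cexp (z - w) - 1).
  by rewrite mulrBr -cexpD mulr1 addrCA subrr addr0.
rewrite cmodM cmod_cexp mulrAC mulrC; apply: ler_pM => //.
- exact: cexp_near0.
- by rewrite ler_expR.
Qed.

End Exponential.

(** * Null sets on the circle *)

Section NullCover.
Variable R : realType.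
Implicit Types (z w : R[i]) (x y e : R).

(** Lebesgue measure is an infimum over countable covers by half-open intervals. Such a cover of
    total length below e / 2 is taken, and the n-th interval is widened by e / 2^(n+2) into an open
    one; the widenings add up to at most e / 2. *)
Lemma null_interval_cover (A : set R) e : lebesgue_measure A = 0%E -> 0 < e ->
  exists c r : nat -> R, [/\ forall n, 0 < r n,
    forall x, A x -> exists n, `|x - c n| < r n &
    forall N, \sum_(0 <= n < N) r n <= e].
Proof.
move=> A0 e0.
have /ereal_inf_lt[l [/= M [mM cM] <- ze]] : (lebesgue_measure A < (e / 2)%:E)%E.
  by rewrite A0 lte_fin; lra.
pose mu0 := @wlength R idfun.
pose e2 (n : nat) := e / 2 / 2 ^+ n.+1.
have e2pos n : 0 < e2 n by rewrite divr_gt0 ?exprn_gt0 //; lra.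
have mu0_ge0 n : (0 <= mu0 (M n))%E by exact: measure_ge0.
have ch n : exists p : R * R, [/\ 0 < p.2, forall x, M n x -> `|x - p.1| < p.2 &
   (p.2%:E <= mu0 (M n) + (e2 n)%:E)%E].
  have /ocitvP[->|[[a b] /= ab ->]] : ocitv (M n) by exact: mM.
    exists (0, e2 n); split => //=.
    have -> : mu0 set0 = 0%E by exact: measure0.
    by rewrite add0e.
  exists ((a + b) / 2, (b - a) / 2 + e2 n); have := e2pos n; split => /=.
  - by lra.
  - by move=> x; rewrite in_itv /= => /andP[? ?]; rewrite ltr_norml; apply/andP; split; lra.
  - by rewrite /mu0 wlength_itv /= lte_fin ab -EFinB -EFinD lee_fin; lra.
have {}/choice [p pP] := ch.
exists (fun n => (p n).1), (fun n => (p n).2); split.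
- by move=> n; case: (pP n).
- by move=> x /cM [n _ Mx]; exists n; case: (pP n) => _ + _; apply.
- move=> N; rewrite -lee_fin -sumEFin.
  apply: (@le_trans _ _ (\sum_(0 <= n < N) (mu0 (M n) + (e2 n)%:E))%E).
    by apply: lee_sum => n _; case: (pP n).
  rewrite big_split /= sumEFin.
  have E : \sum_(0 <= n < N) e2 n <= e / 2.
    suff -> : \sum_(0 <= n < N) e2 n = e / 2 * (1 - 2^-1 ^+ N).
      by have : 0 <= 2^-1 ^+ N :> R by []; nra.
    elim: N => [|N IH]; first by rewrite big_geq // expr0 subrr mulr0.
    by rewrite big_nat_recr //= IH /e2 -exprVn exprS; lra.
  rewrite [e in leRHS]splitr EFinD leeD ?lee_fin //.
  by apply: le_trans (ltW ze); apply: nneseries_lim_ge.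
Qed.

(** The only form in which nullity is used below. The balls are balls of the plane with arbitrary
    centres, so that the property passes to subsets at once. *)
Definition ncover (K : set R[i]) := forall e, 0 < e ->
  exists s : seq (R[i] * R), [/\ forall p, p \in s -> 0 < p.2,
    forall z, K z -> exists2 p, p \in s & modc (z - p.1) < p.2 &
    \sum_(p <- s) p.2 <= e].

Lemma ncover_sub (K L : set R[i]) : L `<=` K -> ncover K -> ncover L.
Proof.
by move=> LK nK e /nK [s [s0 sK se]]; exists s; split => // z /LK; exact: sK.
Qed.

(** As [cis] is 1-Lipschitz, an interval of parameters is sent into a ball of the same radius, and
    compactness leaves finitely many of these balls. *)
Lemma null_ncover (K : set R[i]) : compact K -> K `<=` @circle R ->
  arclength K = 0%E -> ncover K.
Proof.
move=> cK KT K0 e e0; have [c [r [r0 cov sr]]] := null_interval_cover K0 e0.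
move: cK; rewrite compact_cover.
move=> /(_ _ setT (fun n => [set z | modc (z - cis (c n)) < r n])) [].
- move=> n _; rewrite openE => z /= zw; apply/nbhs_cmodP.
  exists (r n - modc (z - cis (c n))); first by rewrite subr_gt0.
  move=> v vz /=; apply: le_lt_trans (cmod_dist z _ _) _.
  by rewrite -ltrBrDr.
- move=> z Kz; have [t t2 zt] := circle_cis (KT _ Kz).
  have [|n cn] := cov t; first by split; rewrite /= ?in_itv -?zt.
  exists n => //=; rewrite zt; exact: le_lt_trans (cis_lip _ _) cn.
- move=> D _ covD; pose N := (\max_(n <- finmap.enum_fset D) n).+1.
  exists [seq (cis (c n), r n) | n <- index_iota 0 N]; split.
  + by move=> p /mapP[n _ ->] /=.
  + move=> z /covD [n nD zn]; exists (cis (c n), r n); last exact: zn.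
    apply: (map_f (fun n => (cis (c n), r n))); rewrite mem_index_iota /= /N ltnS.
    exact: (@leq_bigmax_seq _ _ xpredT id).
  + by rewrite big_map; exact: sr.
Qed.

(** A ball that meets K lies in the ball of twice the radius around one of its points of K, and the
    other balls are dropped. Centres on K have modulus 1, which locates the poles built from
    them. *)
Lemma ncover_center (K : set R[i]) e : ncover K -> 0 < e ->
  exists s : seq (R[i] * R), [/\ forall p, p \in s -> K p.1 /\ 0 < p.2,
    forall z, K z -> exists2 p, p \in s & modc (z - p.1) < p.2 &
    \sum_(p <- s) p.2 <= e].
Proof.
move=> nK e0; have [|s [s0 sK se]] := nK (e / 2); first by lra.
have ch (p : R[i] * R) : exists q : R[i], (exists2 z, K z & modc (z - p.1) < p.2) ->
    K q /\ modc (q - p.1) < p.2.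
  by have [[z Kz zp]|h] := pselect (exists2 z, K z & modc (z - p.1) < p.2);
     [exists z|exists 0].
have {}/choice [q qP] := ch.
pose P p := `[< exists2 z, K z & modc (z - p.1) < p.2 >].
exists [seq (q p, 2 * p.2) | p <- s & P p]; split.
- move=> p0 /mapP[p]; rewrite mem_filter => /andP[/asboolP/qP[Kq _] ps] -> /=.
  by split => //; have := s0 p ps; lra.
- move=> z Kz; have [p ps zp] := sK z Kz.
  have Pp : exists2 z, K z & modc (z - p.1) < p.2 by exists z.
  exists (q p, 2 * p.2) => /=.
    by apply: (map_f (fun p => (q p, 2 * p.2))); rewrite mem_filter ps andbT; apply/asboolP.
  have [_ h] := qP p Pp; apply: le_lt_trans (cmod_dist p.1 _ _) _.
  by rewrite (cmodBC p.1); lra.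
- rewrite big_map big_filter -mulr_sumr.
  suff : \sum_(i <- s | P i) i.2 <= \sum_(p <- s) p.2 by lra.
  rewrite [leRHS](bigID P) /= lerDl big_seq_cond.
  by apply: sumr_ge0 => p /andP[/s0/ltW].
Qed.

Let balls (s : seq (R * R)) : set R :=
  [set t : R | exists2 p, p \in s & `|t - p.1| < p.2].

Lemma measure_balls (s : seq (R * R)) :
  (forall p, p \in s -> 0 <= p.2) ->
  measurable (balls s) /\
  (lebesgue_measure (balls s)
     <= (2 * \sum_(p <- s) p.2)%:E)%E.
Proof.
elim: s => [|p s IH] s0.
  have -> : balls [::] = set0.
    by apply/seteqP; split => [t [p]|t].
  by rewrite measure0 big_nil mulr0; split.
have [|ms IHs] := IH; first by move=> q qs; apply: s0; rewrite inE qs orbT.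
have -> : balls (p :: s) =
    ball p.1 p.2 `|` balls s.
  apply/seteqP; split => t /=.
    move=> [q]; rewrite inE => /predU1P[->|qs] h; last by right; exists q.
    by left; rewrite /ball /= distrC.
  move=> [|[q qs h]]; last by exists q => //; rewrite inE qs orbT.
  by rewrite /ball /= distrC => h; exists p => //; rewrite mem_head.
have mb : measurable (ball p.1 p.2) by rewrite ball_itv; exact: measurable_itv.
split; first exact: measurableU.
apply: (@le_trans _ _ (lebesgue_measure (ball p.1 p.2) + lebesgue_measure (balls s))%E).
  exact: measureU2.
rewrite big_cons mulrDr EFinD leeD // lebesgue_measure_ball ?s0 ?mem_head //.
by rewrite lee_fin mulr2n; lra.
Qed.

(** Otherwise the balls would cover an interval longer than their total measure. *)
Lemma balls_gap (s : seq (R * R)) (b : R) :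
  (forall p, p \in s -> 0 <= p.2) -> 2 * \sum_(p <- s) p.2 < b ->
  exists2 t, 0 < t < b & forall p, p \in s -> p.2 <= `|t - p.1|.
Proof.
move=> s0 sb; have [ms le_s] := measure_balls s0.
have b0 : 0 < b.
  by apply: le_lt_trans sb; rewrite mulr_ge0 // big_seq; apply: sumr_ge0 => p /s0.
apply: contrapT => H.
pose I : set R := `]0, b[%classic.
have : (lebesgue_measure I <= (2 * \sum_(p <- s) p.2)%:E)%E.
  apply: le_trans le_s; apply: le_measure; rewrite ?inE //; first exact: measurable_itv.
  move=> t; rewrite /I /= in_itv /= => tb; apply: contrapT => Ht; apply: H.
  exists t => // p ps; rewrite leNgt; apply/negP => tp; apply: Ht; by exists p.
rewrite /I lebesgue_measure_itv /= lte_fin b0 -EFinB lee_fin; lra.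
Qed.

(** Since w -> |w - z| is 1-Lipschitz, the distances from z to K are covered by intervals of total
    length below e. A missed radius t gives a circle around z that K avoids with a margin, hence a
    disc that cuts K into two relatively clopen parts. Radii are doubled so that missing the doubled
    intervals leaves a margin. *)
Lemma ncover_gap (K : set R[i]) z e : ncover K -> 0 < e ->
  exists2 t, 0 < t < e & exists2 d, 0 < d &
    forall w, K w -> d <= `|modc (w - z) - t|.
Proof.
move=> nK e0; have [|s [s0 sK se]] := nK (e / 8); first by lra.
pose s' := [seq (modc (p.1 - z), 2 * p.2) | p <- s].
have [||t te Ht] := @balls_gap s' e.
- by move=> p0 /mapP[p ps ->] /=; have := s0 p ps; lra.
- by rewrite big_map /= -mulr_sumr; lra.
exists t => //; have [m m0 ms] := seq_min_gt0 s0.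
exists m => // w Kw; have [p ps wp] := sK w Kw.
have /Ht /= h : (modc (p.1 - z), 2 * p.2) \in s' by apply: (map_f (fun p => (modc (p.1 - z), 2 * p.2))).
have h1 := ms p ps.
have h2 : `|modc (w - z) - modc (p.1 - z)| <= modc (w - p.1).
  have e1 : (w - z) - (p.1 - z) = w - p.1 by rewrite opprB addrA subrK.
  have := cmod_subl (w - z) (p.1 - z); have := cmod_subl (p.1 - z) (w - z).
  by rewrite (cmodBC (p.1 - z)) e1 ler_norml => ? ?; apply/andP; split; lra.
have := ler_distD (modc (w - z)) t (modc (p.1 - z)).
by rewrite (distrC t (modc (w - z))); lra.
Qed.

End NullCover.

(** * Polynomial approximation *)

Lemma exp_small (R : realType) (q e : R) : 0 <= q < 1 -> 0 < e ->
  exists n : nat, q ^+ n <= e.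
Proof.
move=> /andP[q0 q1] e0; have := @cvg_expr R q; rewrite ger0_norm // => /(_ q1).
move=> /cvgrPdistC_le /(_ e e0) [n _ /(_ n (leqnn n))].
by rewrite subr0 ger0_norm ?exprn_ge0 // => ?; exists n.
Qed.

Section PolyApprox.
Variable R : realType.
Implicit Types (z w : R[i]) (x y e r : R) (f g : R[i] -> R[i]).

(** Uniform limits of polynomials on a closed disc: the working substitute for holomorphy. The class
    is stable under sums, products, limits and inverses of functions with real part bounded below,
    and its members are differentiable inside the disc. *)
Definition papprox r f := forall e, 0 < e ->
  exists p : {poly R[i]}, forall z, modc z <= r -> modc (f z - p.[z]) <= e.

Lemma horner_bound (p : {poly R[i]}) r :
  exists2 M, 0 < M & forall z, modc z <= r -> modc p.[z] <= M.
Proof.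
exists (1 + \sum_(i < size p) modc p`_i * `|r| ^+ i).
  by rewrite ltr_pwDl // sumr_ge0 // => i _; rewrite mulr_ge0 // exprn_ge0.
move=> z zr; rewrite horner_coef; apply: le_trans (cmod_sum _ _ _) _.
apply: ler_wpDl => //; apply: ler_sum => i _; rewrite cmodM cmodX ler_wpM2l //.
by rewrite lerXn2r ?nnegrE // (le_trans zr) // ler_norm.
Qed.

Lemma papprox_poly r (p : {poly R[i]}) : papprox r (fun z => p.[z]).
Proof. by move=> e e0; exists p => z _; rewrite subrr cmod0 ltW. Qed.

Lemma papprox_ext r f g : (forall z, modc z <= r -> f z = g z) ->
  papprox r f -> papprox r g.
Proof.
by move=> fg af e /af [p pP]; exists p => z zr; rewrite -fg // pP.
Qed.

Lemma papproxW r r' f : r' <= r -> papprox r f -> papprox r' f.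
Proof.
by move=> rr af e /af [p pP]; exists p => z zr; apply: pP; exact: le_trans rr.
Qed.

Lemma papprox_cst r c : papprox r (fun=> c).
Proof.
by apply: papprox_ext (papprox_poly r c%:P) => z _; rewrite hornerC.
Qed.

Lemma papprox_id r : papprox r id.
Proof.
by apply: papprox_ext (papprox_poly r 'X) => z _; rewrite hornerX.
Qed.

Lemma papprox_bounded r f : papprox r f ->
  exists2 M, 0 < M & forall z, modc z <= r -> modc (f z) <= M.
Proof.
move=> af; have [p pP] := af 1 ltr01; have [M M0 MP] := horner_bound p r.
exists (M + 1) => [|z zr]; first lra.
by have := cmod_subl (f z) p.[z]; have := pP z zr; have := MP z zr; lra.
Qed.

Lemma papprox_lim r f :
  (forall e, 0 < e -> exists2 g, papprox r g &
     forall z, modc z <= r -> modc (f z - g z) <= e) -> papprox r f.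
Proof.
move=> H e e0; have [|g ag fg] := H (e / 2); first lra.
have [|p pP] := ag (e / 2); first lra.
exists p => z zr; apply: le_trans (cmod_dist (g z) _ _) _.
by have := fg z zr; have := pP z zr; lra.
Qed.

Lemma papproxD r f g : papprox r f -> papprox r g ->
  papprox r (fun z => f z + g z).
Proof.
move=> af ag e e0; have [|p pP] := af (e / 2); first lra.
have [|q qP] := ag (e / 2); first lra.
exists (p + q) => z zr; rewrite hornerD opprD addrACA.
by apply: le_trans (cmodD _ _) _; have := pP z zr; have := qP z zr; lra.
Qed.

Lemma papproxM r f g : papprox r f -> papprox r g ->
  papprox r (fun z => f z * g z).
Proof.
move=> af ag; have [M M0 MP] := papprox_bounded af.
apply: papprox_lim => e e0.
have [|q qP] := ag (e / (2 * M)); first by rewrite divr_gt0 //; lra.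
have [N N0 NP] := horner_bound q r.
have [|p pP] := af (e / (2 * N)); first by rewrite divr_gt0 //; lra.
exists (fun z => (p * q).[z]); first exact: papprox_poly.
move=> z zr; rewrite hornerM.
have -> : f z * g z - p.[z] * q.[z] =
  f z * (g z - q.[z]) + (f z - p.[z]) * q.[z] by ring.
apply: le_trans (cmodD _ _) _; rewrite !cmodM.
have h1 : modc (f z) * modc (g z - q.[z]) <= M * (e / (2 * M)).
  by apply: ler_pM => //; [exact: MP|exact: qP].
have h2 : modc (f z - p.[z]) * modc q.[z] <= e / (2 * N) * N.
  by apply: ler_pM => //; [exact: pP|exact: NP].
have E1 : M * (e / (2 * M)) = e / 2 by field; rewrite gt_eqF.
have E2 : e / (2 * N) * N = e / 2 by field; rewrite gt_eqF.
lra.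
Qed.

Lemma papproxZ r c f : papprox r f -> papprox r (fun z => c * f z).
Proof. by move=> af; apply: papproxM af; exact: papprox_cst. Qed.

Lemma papproxN r f : papprox r f -> papprox r (fun z => - f z).
Proof.
by move=> /(papproxZ (-1)); apply: papprox_ext => z _; rewrite mulN1r.
Qed.

Lemma papprox_sum r (I : Type) (s : seq I) (F : I -> R[i] -> R[i]) :
  (forall i, papprox r (F i)) -> papprox r (fun z => \sum_(i <- s) F i z).
Proof.
move=> aF; elim: s => [|i s IH].
  by apply: papprox_ext (papprox_cst r 0) => z _; rewrite big_nil.
by apply: papprox_ext (papproxD (aF i) IH) => z _; rewrite big_cons.
Qed.

Lemma papproxX r f n : papprox r f -> papprox r (fun z => f z ^+ n).
Proof.
move=> af; elim: n => [|n IH]; first exact: papprox_cst.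
by apply: papprox_ext (papproxM af IH) => z _; rewrite exprS.
Qed.

(* Neumann series around a large constant c: since f is bounded with real part
   at least 1, |1 - f / c|^2 <= 1 - 1 / c. *)
Lemma papproxV1 r f : papprox r f -> (forall z, modc z <= r -> 1 <= complex.Re (f z)) ->
  papprox r (fun z => (f z)^-1).
Proof.
move=> af f1; have [B B0 BP] := papprox_bounded af.
pose c := B ^+ 2 + 1; have c1 : 1 < c by rewrite /c; have := exprn_gt0 2 B0; lra.
pose u z := 1 - (c^-1)%:C * f z.
have c0 : c%:C != 0 by rewrite -cmod_gt0 cmod_real ger0_norm; lra.
have au : papprox r u.
  by apply: papproxD; [exact: papprox_cst|apply/papproxN/papproxZ].
have u2 z : modc z <= r -> modc (u z) ^+ 2 <= 1 - c^-1.
  move=> zr; rewrite sqr_cmod /u ReB ImB ReZ ImZ /=.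
  have := sqr_cmod (f z); have := f1 z zr; have h := BP z zr.
  have hB : modc (f z) ^+ 2 <= B ^+ 2 by rewrite lerXn2r ?nnegrE // ltW.
  set a := complex.Re _; set b := complex.Im _ => a1 E.
  have cV : c^-1 * c = 1 by rewrite mulVf //; lra.
  have cV0 : 0 < c^-1 by rewrite invr_gt0; lra.
  have : (1 - c^-1 * a) ^+ 2 + (0 - c^-1 * b) ^+ 2 =
     1 - 2 * c^-1 * a + c^-1 * (c^-1 * (a ^+ 2 + b ^+ 2)) by ring.
  move=> ->; rewrite -E.
  have : c^-1 * (modc (f z) ^+ 2) <= 1.
    by rewrite -cV ler_wpM2l ?ltW // /c; lra.
  move=> h2; have h3 : c^-1 * (c^-1 * modc (f z) ^+ 2) <= c^-1 * 1 by rewrite ler_wpM2l // ltW.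
  have h4 : c^-1 * 1 <= c^-1 * a by rewrite ler_wpM2l // ltW.
  lra.
apply: papprox_lim => e e0.
have [|n ne] := @exp_small R (1 - c^-1) e _ e0.
  have : 0 < c^-1 < 1 by rewrite invr_gt0 invf_lt1; lra.
  by move=> /andP[? ?]; apply/andP; split; lra.
(* The available bound is on |u|^2, hence 2 n terms; the remainder of the geometric sum is u^(2n) /
   f. *)
exists (fun z => (c^-1)%:C * \sum_(i <- index_iota 0 (2 * n)) u z ^+ i).
  by apply/papproxZ/papprox_sum => i; exact: papproxX.
move=> z zr; have f0 : f z != 0.
  by rewrite -cmod_gt0; have := f1 z zr; have := Re_le_cmod (f z); rewrite ler_norml; lra.
have -> : (f z)^-1 - (c^-1)%:C * \sum_(i <- index_iota 0 (2 * n)) u z ^+ i =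
   u z ^+ (2 * n) / f z.
  have := subrX1 (u z) (2 * n); rewrite -(big_mkord xpredT) => S.
  have U1 : u z - 1 = - ((c^-1)%:C * f z) by rewrite /u addrAC subrr sub0r.
  have {}S : u z ^+ (2 * n) =
     1 - (c^-1)%:C * f z * \sum_(i <- index_iota 0 (2 * n)) u z ^+ i.
    by move/eqP: S; rewrite subr_eq U1 => /eqP ->; ring.
  by rewrite S mulrBl mul1r mulrAC mulfK.
rewrite cmodf cmodX exprM.
have f1' : 1 <= modc (f z) by have := f1 z zr; have := Re_le_cmod (f z); rewrite ler_norml; lra.
rewrite ler_pdivrMr; last by lra.
apply: (@le_trans _ _ (e * 1)); last by rewrite ler_wpM2l // ltW.
rewrite mulr1; apply: le_trans ne; rewrite lerXn2r ?nnegrE ?u2 // ?exprn_ge0 //.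
by apply: le_trans (u2 z zr); exact: exprn_ge0.
Qed.

Lemma papproxV r f k : papprox r f -> 0 < k ->
  (forall z, modc z <= r -> k <= complex.Re (f z)) ->
  papprox r (fun z => (f z)^-1).
Proof.
move=> af k0 fk; have kV : 0 < k^-1 by rewrite invr_gt0.
have /papproxV1 H : papprox r (fun z => (k^-1)%:C * f z) by exact: papproxZ.
have {}H : papprox r (fun z => ((k^-1)%:C * f z)^-1).
  by apply: H => z zr; rewrite ReZ mulrC ler_pdivlMr // mul1r fk.
apply: papprox_ext (papproxZ (k^-1)%:C H) => z zr.
by rewrite invfM mulrA divff ?mul1r // -cmod_gt0 cmod_real gtr0_norm.
Qed.

Definition herglotz (w z : R[i]) : R[i] := (w + z) / (w - z).

Lemma Re_herglotz w z : complex.Re (herglotz w z) =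
  (modc w ^+ 2 - modc z ^+ 2) / modc (w - z) ^+ 2.
Proof.
have N0 : (w + z) * conjc (w - z) / (modc (w - z) ^+ 2)%:C = herglotz w z.
  (* For w = z both sides are 0, as inverses of 0 are 0. *)
  rewrite /herglotz; have [->|wz] := eqVneq (w - z) 0.
    by rewrite cmod0 expr0n /= rmorph0 !invr0 !mulr0.
  by rewrite -mulcJ -mulf_div divff ?mulr1 // conjc_eq0.
rewrite -N0 mulrC -real_complexV ReZ mulrC; congr (_ * _).
rewrite !sqr_cmod; case: w {N0} => a b; case: z => c d /=; ring.
Qed.

(** After division by w the denominator 1 - z / w has real part at least 1 - r / |w|, so it can be
    inverted among limits of polynomials. *)
Lemma papprox_herglotz w r : 0 <= r < modc w -> papprox r (herglotz w).
Proof.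
move=> /andP[r0 rw].
have w0 : w != 0 by rewrite -cmod_gt0; lra.
have H : papprox r (fun z => 1 - w^-1 * z).
  by apply: papproxD; [exact: papprox_cst|apply/papproxN/papproxZ/papprox_id].
have af : papprox r (fun z => (1 - w^-1 * z)^-1).
  apply: (@papproxV _ _ (1 - r / modc w) H).
  by rewrite subr_gt0 ltr_pdivrMr ?mul1r //; lra.
  move=> z zr; rewrite ReB /=.
  have := Re_le_cmod (w^-1 * z); rewrite cmodM cmodV ler_norml => /andP[_ h].
  have : (modc w)^-1 * modc z <= r / modc w.
    by rewrite mulrC ler_wpM2r // invr_ge0.
  lra.
have : papprox r (fun z => (1 + w^-1 * z) * (1 - w^-1 * z)^-1).
  apply: papproxM af; apply: papproxD; first exact: papprox_cst.
  exact/papproxZ/papprox_id.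
apply: papprox_ext => z zr; rewrite /herglotz.
have wz : w - z != 0.
  rewrite subr_eq0; apply/eqP => E; move: zr; rewrite -E; lra.
by field; rewrite ?w0 ?wz //=.
Qed.

End PolyApprox.

(** * Peak polynomials on null subsets of the circle *)

Section Peak.
Variable R : realType.
Implicit Types (z w f : R[i]) (x y e r d : R).

(** With x = |f|, |T + f|^2 >= T^2 + x^2 because Re f >= 0, so the imaginary part of g is at most T
    x / (T^2 + x^2). It is bounded by a difference of values of T / (T + x) at 2 T and T, so that
    the bounds for T = 2^k telescope. *)
Lemma scale_term f (T : R) (g := T%:C / (T%:C + f)) : 0 <= complex.Re f -> 0 < T ->
  [/\ 0 <= complex.Re g <= 1,
      `|complex.Im g| <= 7 / 2 * (2 * T / (2 * T + modc f) - T / (T + modc f)),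
      modc (1 - g) <= modc f / T &
      forall M, 0 < M -> M <= complex.Re f -> modc g <= T / M].
Proof.
move=> f0 T0; set x := modc f; have x0 : 0 <= x by exact: cmod_ge0.
have xE := sqr_cmod f; rewrite -/x in xE.
have m2 := sqr_cmod (T%:C + f); rewrite ReD ImD /= add0r in m2.
set a := complex.Re f in f0 xE m2 *; set b := complex.Im f in xE m2 *.
set m := modc _ in m2.
have m0 : 0 <= m by exact: cmod_ge0.
have m2_ge : T ^+ 2 + x ^+ 2 <= m ^+ 2 by nra.
have T2 : 0 < T ^+ 2 by rewrite exprn_gt0.
have mT : T <= m.
  have x2 := sqr_ge0 x; rewrite -(@ler_pXn2r R 2) ?nnegrE ?(ltW T0) //; lra.
have m_gt0 : 0 < m by lra.
have E : complex.Re g = T * (T + a) / m ^+ 2.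
  by rewrite /g ReZ ReV ReD /= mulrA.
have E' : complex.Im g = - (T * b / m ^+ 2).
  by rewrite /g ImZ ImV ImD /= add0r mulrA mulrN mulNr.
have bx : `|b| <= x by exact: Im_le_cmod.
split.
- rewrite E; apply/andP; split; first by rewrite divr_ge0 ?exprn_ge0 ?mulr_ge0 //; lra.
  by rewrite ler_pdivrMr ?exprn_gt0 // mul1r; nra.
- rewrite E' normrN normrM normfV (ger0_norm (exprn_ge0 _ m0)).
  have -> : 7 / 2 * (2 * T / (2 * T + x) - T / (T + x)) =
     7 / 2 * (T * x) / ((2 * T + x) * (T + x)).
    by field; apply/andP; split; rewrite gt_eqF //; lra.
  rewrite ler_pdivrMr ?exprn_gt0 // mulrAC ler_pdivlMr ?mulr_gt0 //; try lra.
  rewrite normrM gtr0_norm //.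
  have h1 : T * `|b| <= T * x by rewrite ler_wpM2l // ltW.
  (* The product is 2 T^2 + 3 T x + x^2, and 3 T x <= 3/2 (T^2 + x^2): this is the origin of 7/2. *)
  have h2 : (2 * T + x) * (T + x) <= 7 / 2 * m ^+ 2.
    by have := sqr_ge0 (T - x); have := sqr_ge0 x; lra.
  apply: (@le_trans _ _ (T * x * (7 / 2 * m ^+ 2))).
    by apply: ler_pM => //; rewrite mulr_ge0 //; lra.
  lra.
- have -> : 1 - g = f / (T%:C + f).
    rewrite /g; field; rewrite -cmod_gt0; exact: m_gt0.
  by rewrite cmodf ler_pM // ?invr_ge0 // lef_pV2 ?posrE.
- move=> M M0 Ma; rewrite /g cmodf cmod_real gtr0_norm // (ler_wpM2l (ltW T0)) //.
  rewrite lef_pV2 ?posrE // -(@ler_pXn2r R 2) ?nnegrE ?(ltW M0) //.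
  by have := sqr_ge0 b; rewrite m2; nra.
Qed.

(* Poisson kernels with poles w (1 + d) slightly outside the disc. *)
Lemma large_real_part (K : set R[i]) d M e : ncover K -> K `<=` @circle R ->
  0 < d -> 0 < M -> 0 < e -> exists F : R[i] -> R[i],
  [/\ papprox 1 F, forall z, modc z <= 1 -> 0 <= complex.Re (F z),
      forall z, K z -> M <= complex.Re (F z) &
      forall z, modc z <= 1 -> (forall w, K w -> d <= modc (z - w)) ->
        modc (F z) <= e].
Proof.
move=> nK KT d0 M0 e0.
(* A pole lies within eta <= d / 2 of K, hence at distance at least d / 2 from points d-far from K.
   There a kernel is at most 3 / (d / 2), so the whole sum is at most 12 M eta / d <= e. *)
pose eta := Num.min (Num.min 1 (d / 2)) (d * e / (12 * M)).
have eta0 : 0 < eta.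
  by rewrite !lt_min ltr01 !divr_gt0 ?mulr_gt0.
have eta1 : eta <= 1 by rewrite !ge_min lexx.
have etad : eta <= d / 2 by rewrite !ge_min lexx orbT.
have etae : eta * (12 * M) <= d * e.
  by rewrite -ler_pdivlMr ?mulr_gt0 // !ge_min lexx orbT.
have [s [s0 sK se]] := ncover_center nK eta0.
have sle p : p \in s -> p.2 <= eta.
  move=> ps; apply: le_trans se; rewrite (big_rem p) //= lerDl big_seq.
  by apply: sumr_ge0 => q /mem_rem/s0[_ /ltW].
pose P (p : R[i] * R) := (1 + p.2)%:C * p.1.
(* On the part of K inside the ball p, with radius q = [p.2], the Poisson kernel has numerator at
   least 2 q and denominator at most (2 q)^2; the weight 2 M q raises it to at least M. *)
pose F z := \sum_(p <- s) (2 * M * p.2)%:C * herglotz (P p) z.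
have p1 p : p \in s -> modc p.1 = 1 by move=> /s0[/KT].
have Pmod p : p \in s -> modc (P p) = 1 + p.2.
  move=> ps; rewrite /P cmodM cmod_real (p1 p ps) mulr1 gtr0_norm //.
  by have [_] := s0 p ps; lra.
have Pdist p : p \in s -> modc (P p - p.1) = p.2.
  move=> ps; have -> : P p - p.1 = (p.2)%:C * p.1.
    by rewrite /P real_complexD mulrDl mul1r addrAC subrr add0r.
  by rewrite cmodM cmod_real (p1 p ps) mulr1 gtr0_norm //; have [_] := s0 p ps.
have Re_term p z : p \in s -> modc z <= 1 ->
    0 <= complex.Re ((2 * M * p.2)%:C * herglotz (P p) z).
  move=> ps z1; have [_ p0] := s0 p ps; rewrite ReZ Re_herglotz Pmod //.
  apply: mulr_ge0; first by rewrite !mulr_ge0 // ltW.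
  apply: divr_ge0; last by rewrite exprn_ge0.
  have : modc z ^+ 2 <= 1 by rewrite expr_le1.
  nra.
exists F; split.
(* [papprox_sum] ranges over all indices, so the terms are made 0 outside [s], where the pole need
   not be off the disc. *)
- have -> : F = fun z => \sum_(p <- s) (if p \in s then (2 * M * p.2)%:C * herglotz (P p) z else 0).
    by apply/funext => z; rewrite /F !big_seq; apply: eq_bigr => p ->.
  apply: papprox_sum => p; have [ps|ps] := boolP (p \in s); last exact: papprox_cst.
  apply/papproxZ/papprox_herglotz; rewrite Pmod // ler01 /= ltrDl.
  by have [] := s0 p ps.
- move=> z z1; rewrite /F Re_sum big_seq; apply: sumr_ge0 => p ps; exact: Re_term.
- move=> z Kz; have z1 := KT z Kz; have [p ps zp] := sK z Kz.
  rewrite /F Re_sum (big_rem p) //=; apply: ler_wpDr.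
    by rewrite big_seq; apply: sumr_ge0 => q /mem_rem qs; apply: Re_term => //; rewrite /modc z1.
  have [_ p0] := s0 p ps.
  have hd : modc (P p - z) <= 2 * p.2.
    apply: le_trans (cmod_dist p.1 _ _) _; rewrite Pdist // (cmodBC p.1); lra.
  have hd0 : 0 < modc (P p - z).
    have := cmod_subl (P p) z; rewrite Pmod // {1}/modc z1; lra.
  rewrite ReZ Re_herglotz Pmod // {1}/modc z1 mulrA ler_pdivlMr ?exprn_gt0 //.
  have : modc (P p - z) ^+ 2 <= (2 * p.2) ^+ 2.
    by rewrite lerXn2r ?nnegrE // ltW // mulr_gt0.
  move=> h; apply: (@le_trans _ _ (M * (2 * p.2) ^+ 2)).
    by rewrite ler_wpM2l // ltW.
  by have := exprn_gt0 3 p0; have := exprn_gt0 2 p0; nra.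
- move=> z z1 zK; rewrite /F; apply: le_trans (cmod_sum _ _ _) _.
  apply: (@le_trans _ _ (\sum_(p <- s) (12 * M / d) * p.2)); last first.
    rewrite -mulr_sumr mulrAC ler_pdivrMr //.
    apply: le_trans (_ : 12 * M * eta <= _); last by lra.
    by rewrite ler_wpM2l // mulr_ge0 // ltW.
  rewrite big_seq [leRHS]big_seq; apply: ler_sum => p ps.
  have [Kp p0] := s0 p ps; have ple := sle p ps.
  rewrite cmodM cmod_real gtr0_norm ?mulr_gt0 // /herglotz cmodf.
  have h1 : modc (P p + z) <= 3.
    by apply: le_trans (cmodD _ _) _; rewrite Pmod //; lra.
  have h2 : d / 2 <= modc (P p - z).
    have := zK _ Kp; have := cmod_dist (P p) z p.1.
    by rewrite Pdist // (cmodBC z (P p)); lra.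
  have h3 : modc (P p + z) / modc (P p - z) <= 3 * (d / 2)^-1.
    by apply: ler_pM => //; rewrite ?invr_ge0 // lef_pV2 ?posrE //; lra.
  apply: (@le_trans _ _ (2 * M * p.2 * (3 * (d / 2)^-1))).
    by rewrite ler_wpM2l // !mulr_ge0 // ltW.
  suff -> : 2 * M * p.2 * (3 * (d / 2)^-1) = 12 * M / d * p.2 by [].
  by field; rewrite gt_eqF.
Qed.

(** With Re F >= 0, the function 1 - T / (T + F) is near 0 where F is small and near 1 where Re F is
    large, but in between its imaginary part is uncontrolled. In the average over the N scales T =
    2^k the imaginary parts add up to at most 7/2 before division by N. On K, Re F is so large that
    even the scale 2^N is negligible. *)
Lemma peak_poly (K : set R[i]) d e : ncover K -> K `<=` @circle R ->
  0 < d -> 0 < e -> exists p : {poly R[i]},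
  [/\ forall z, modc z <= 1 -> exists2 t : R, 0 <= t <= 1 & modc (p.[z] - t%:C) <= e,
      forall z, K z -> modc (p.[z] - 1) <= e &
      forall z, modc z <= 1 -> (forall w, K w -> d <= modc (z - w)) ->
        modc p.[z] <= e].
Proof.
move=> nK KT d0 e0.
pose N := (Num.truncn (7 / e)).+1.
have NE : 7 / 2 <= e / 2 * N%:R.
  have /ltW := truncnS_gt (7 / e); rewrite -/N ler_pdivrMr //; lra.
have N0 : 0 < N%:R :> R by rewrite ltr0n.
have [||F [aF F0 FK Fd]] := @large_real_part K d (2 ^+ N / (e / 2)) (e / 2) nK KT d0.
- by rewrite divr_gt0 ?exprn_gt0 //; lra.
- by lra.
pose g k z := (2 ^+ k)%:C / ((2 ^+ k)%:C + F z).
have T0 k : 0 < 2 ^+ k :> R by rewrite exprn_gt0.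
have T1 k : 1 <= 2 ^+ k :> R by rewrite exprn_ege1 //; lra.
pose h z := (N%:R^-1)%:C * \sum_(k <- index_iota 0 N) (1 - g k z).
have ah : papprox 1 h.
  apply/papproxZ/papprox_sum => k; apply: papproxD; first exact: papprox_cst.
  apply/papproxN/papproxZ/(@papproxV _ _ _ (2 ^+ k)) => //.
    by apply: papproxD => //; exact: papprox_cst.
  by move=> z z1; rewrite ReD /= lerDl F0.
have avg z c (E : forall k, (k < N)%N -> modc (1 - g k z - c) <= e / 2) :
    modc (h z - c) <= e / 2.
  have -> : h z - c = (N%:R^-1)%:C * \sum_(k <- index_iota 0 N) (1 - g k z - c).
    rewrite sumrB mulrBr; congr (_ - _).
    rewrite big_const_nat subn0 iter_addr_0 -[c *+ N]mulr_natl mulrA.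
    by rewrite -(rmorph_nat (real_complex R)) -rmorphM mulVf ?gt_eqF // rmorph1 mul1r.
  rewrite cmodM cmod_real ger0_norm ?invr_ge0 // mulrC ler_pdivrMr //.
  apply: le_trans (cmod_sum _ _ _) _.
  apply: (@le_trans _ _ (\sum_(k <- index_iota 0 N) e / 2)).
    rewrite big_nat [leRHS]big_nat; apply: ler_sum => k kN; exact: E.
  by rewrite big_const_nat subn0 iter_addr_0 mulr_natr.
have [|p pP] := ah (e / 2); first lra.
have tri z c : modc z <= 1 -> modc (h z - c) <= e / 2 -> modc (p.[z] - c) <= e.
  move=> z1 hz; apply: le_trans (cmod_dist (h z) _ _) _.
  by rewrite (cmodBC _ (h z)); have := pP z z1; lra.
exists p; split.
- move=> z z1; exists (complex.Re (h z)).
    rewrite /h ReZ Re_sum mulrC ler_pdivlMr // ler_pdivrMr // mul0r mul1r.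
    apply/andP; split.
      by apply: sumr_ge0 => k _; have [/andP[_ ?] _ _ _] := scale_term (F0 z z1) (T0 k); rewrite ReB /= subr_ge0.
    apply: (@le_trans _ _ (\sum_(k <- index_iota 0 N) 1)); last first.
      by rewrite big_const_nat subn0 iter_addr_0.
    apply: ler_sum => k _.
    by have [/andP[? _] _ _ _] := scale_term (F0 z z1) (T0 k); rewrite ReB /= gerBl.
  apply: tri => //.
  have -> : h z - (complex.Re (h z))%:C = 0 +i* complex.Im (h z).
    by case: (h z) => a b; apply/eqP; rewrite eq_complex /= subrr subr0 !eqxx.
  apply: le_trans (cmod_leReIm _) _; rewrite /= normr0 add0r.
  rewrite /h ImZ Im_sum normrM ger0_norm ?invr_ge0 // mulrC ler_pdivrMr //.
  apply: le_trans NE; apply: le_trans (ler_norm_sum _ _ _) _.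
  set x := modc (F z); have x0 : 0 <= x by exact: cmod_ge0.
  pose G k := 2 ^+ k / (2 ^+ k + x).
  apply: (@le_trans _ _ (\sum_(0 <= k < N) 7 / 2 * (G k.+1 - G k))).
    apply: ler_sum => k _; rewrite ImB /= sub0r normrN.
    by have [_ + _ _] := scale_term (F0 z z1) (T0 k); rewrite /G !exprS.
  rewrite -mulr_sumr telescope_sumr //.
  have : G N <= 1 by rewrite /G ler_pdivrMr ?mul1r ?lerDl //; have := T0 N; lra.
  have : 0 <= G 0%N by rewrite /G divr_ge0 //; have := T0 0%N; lra.
  by lra.
- move=> z Kz; have z1 : modc z <= 1 by rewrite /modc (KT z Kz).
  apply: tri => //; apply: avg => k kN.
  rewrite addrAC subrr sub0r cmodN.
  have [_ _ _ /(_ (2 ^+ N / (e / 2)))] := scale_term (F0 z z1) (T0 k).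
  move=> H; apply: le_trans (H _ (FK z Kz)) _; first by rewrite divr_gt0 ?T0 //; lra.
  rewrite invf_div mulrCA mulrC ler_piMl; [by []|lra|].
  by rewrite ler_pdivrMr ?T0 // mul1r ler_weXn2l ?(ltnW kN) //; lra.
- move=> z z1 zK; rewrite -[p.[z]]subr0; apply: tri => //; apply: avg => k kN.
  rewrite subr0; have [_ _ + _] := scale_term (F0 z z1) (T0 k).
  move=> H; apply: le_trans H _; apply: le_trans (Fd z z1 zK).
  by rewrite ler_pdivrMr ?T0 // ler_peMr.
Qed.

End Peak.

(** * Interpolation of values prescribed on small clopen pieces of K *)

Section StepInterpolation.
Variable R : realType.
Implicit Types (z w v : R[i]) (x y e r d : R).

(** Each point gets a radius whose circle K avoids with a margin, so membership in the corresponding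
    ball is constant on nearby points of K. The selector [sel] is the first ball of a finite cover
    that contains the point; d is the least margin. *)
Lemma clopen_partition (K : set R[i]) e : compact K -> ncover K -> 0 < e ->
  exists (s : seq R[i]) (sel : R[i] -> R[i]),
    [/\ uniq s, forall w, w \in s -> K w,
        forall z, K z -> sel z \in s /\ modc (z - sel z) < e &
        exists2 d, 0 < d & forall z w, K z -> K w -> modc (z - w) < d ->
          sel z = sel w].
Proof.
move=> cK nK e0.
have ch v : exists p : R * R, [/\ 0 < p.1 < e, 0 < p.2 &
    forall w, K w -> p.2 <= `|modc (w - v) - p.1|].
  by have [t te [d d0 H]] := ncover_gap v nK e0; exists (t, d).
have {}/choice [p pP] := ch.
have [|s0 [s0K s0c]] := @compact_fin_cover R K (fun z => (p z).1) cK.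
  by move=> z _; have [/andP[]] := pP z.
pose s := undup s0; pose hit z w := modc (z - w) < (p w).1.
pose sel z := nth 0 s (find (hit z) s).
have hs z : K z -> has (hit z) s.
  by move=> /s0c [w ws zw]; apply/hasP; exists w => //; rewrite mem_undup.
exists s, sel; split; first exact: undup_uniq.
- by move=> w; rewrite mem_undup; exact: s0K.
- move=> z Kz; split; first by apply: mem_nth; rewrite -has_find hs.
  have := nth_find 0 (hs z Kz); rewrite -/(sel z) /hit => h.
  by apply: lt_trans h _; have [/andP[]] := pP (sel z).
have [|d d0 dP] := @seq_min_gt0 R _ s (fun w => (p w).2).
  by move=> w _; case: (pP w).
exists d => // z w Kz Kw zw; rewrite /sel.
suff H (x y : R[i]) : K x -> K y -> modc (x - y) < d -> forall v, v \in s -> hit x v -> hit y v.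
  congr nth; apply: eq_in_find => v vs; apply/idP/idP; first exact: H.
  by apply: H => //; rewrite cmodBC.
move=> Kx Ky xy v vs; rewrite /hit => xv.
have [_ _ /(_ x Kx)] := pP v; rewrite distrC ger0_norm ?subr_ge0 ?(ltW xv) // => h.
by apply: le_lt_trans (cmod_dist x _ _) _; rewrite (cmodBC y); have := dP v vs; lra.
Qed.

(** A combination of peak polynomials, one for each piece, weighted by the values a. Distinct pieces
    are d0 apart, so near one piece all the other peaks are small. The points [s] depend only on K
    and e: the caller chooses a, and the precision e', after them. *)
Lemma step_poly (K : set R[i]) e r : compact K -> ncover K -> K `<=` @circle R ->
  0 < e -> r < 1 -> exists2 s : seq R[i], (forall w, w \in s -> K w) &
  forall (a : R[i] -> R[i]) e', 0 < e' -> exists H : {poly R[i]},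
  [/\ forall z, modc z <= r -> modc H.[z] <= e',
      forall z, K z -> exists w, [/\ w \in s, modc (z - w) <= e &
        modc (H.[z] - a w) <= e'] &
      forall z, modc z <= 1 -> modc H.[z] <= e' \/
        exists w t, [/\ w \in s, 0 <= t <= 1, modc (z - w) <= e &
          modc (H.[z] - t%:C * a w) <= e']].
Proof.
move=> cK nK KT e0 r1.
have [|s [sel [us sK selP [d0 d0_gt0 selC]]]] := @clopen_partition K (e / 2) cK nK.
  by lra.
exists s => // a e' e'0.
(* Respectively: no point is d-close to two pieces, the disc |z| <= r is d-far from K, and a point
   d-close to a piece is e-close to the point of [s] that represents it. *)
pose d := Num.min (d0 / 2) (Num.min (1 - r) (e / 2)).
have d_gt0 : 0 < d by rewrite !lt_min !divr_gt0 // subr_gt0 r1.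
have dd0 : d <= d0 / 2 by rewrite !ge_min lexx.
have dr : d <= 1 - r by rewrite !ge_min lexx orbT.
have de : d <= e / 2 by rewrite !ge_min lexx !orbT.
pose A := \sum_(w <- s) modc (a w).
have A0 : 0 <= A by apply: sumr_ge0.
pose e1 := e' / (A + 1).
have e10 : 0 < e1 by rewrite divr_gt0 //; lra.
have Ae1 : A * e1 <= e'.
  by rewrite /e1 mulrA ler_pdivrMr; [nra|lra].
pose Kw w := [set z | K z /\ sel z = w].
have KwK w : Kw w `<=` K by move=> z [].
have ch w := @peak_poly R (Kw w) d e1 (ncover_sub (KwK w) nK)
   (subset_trans (KwK w) KT) d_gt0 e10.
have {}/choice [p pP] := ch.
pose H := \sum_(w <- s) (a w) *: p w.
have far w z : (forall v, Kw w v -> d <= modc (z - v)) -> modc z <= 1 ->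
    modc (a w * (p w).[z]) <= modc (a w) * e1.
  move=> zf z1; rewrite cmodM ler_wpM2l //.
  by have [_ _] := pP w; apply.
have HE z : H.[z] = \sum_(w <- s) a w * (p w).[z].
  by rewrite /H horner_sum; apply: eq_bigr => w _; rewrite hornerZ.
have none z : modc z <= 1 ->
    (forall w v, Kw w v -> d <= modc (z - v)) -> modc H.[z] <= e'.
  move=> z1 zf; rewrite HE; apply: le_trans (cmod_sum _ _ _) _.
  apply: le_trans Ae1; rewrite /A mulr_suml; apply: ler_sum => w _.
  by apply: far => // v; exact: zf.
have one z w v c : modc z <= 1 -> w \in s -> Kw w v -> modc (z - v) < d ->
    modc ((p w).[z] - c) <= e1 -> modc (H.[z] - c * a w) <= e'.
  move=> z1 ws [Kv sv] zv pc; apply: le_trans Ae1; rewrite /A mulr_suml HE.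
  rewrite [X in modc X](_ : _ = a w * ((p w).[z] - c) +
    \sum_(w' <- rem w s) a w' * (p w').[z]); last first.
    by rewrite (big_rem w) //=; ring.
  rewrite [leRHS](big_rem w) //=; apply: le_trans (cmodD _ _) _; apply: lerD.
    by rewrite cmodM ler_wpM2l.
  apply: le_trans (cmod_sum _ _ _) _; rewrite big_seq [leRHS]big_seq.
  apply: ler_sum => w'; rewrite mem_rem_uniq // inE => /andP[w'w _].
  apply: far => // v' [Kv' sv']; rewrite leNgt; apply/negP => zv'.
  move/eqP: w'w; apply; rewrite -sv -sv'; apply: selC => //.
  apply: le_lt_trans (cmod_dist z _ _) _; rewrite (cmodBC v'); lra.
exists H; split.
- move=> z zr; apply: none; first by lra.
  move=> w v [Kv _]; have := cmod_subl v z; have : modc v = 1 := KT v Kv.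
  by rewrite cmodBC; lra.
- move=> z Kz; have [ss zs] := selP z Kz.
  have z1 : modc z <= 1 by rewrite /modc (KT z Kz).
  exists (sel z); split => //; first by lra.
  rewrite -[a (sel z)]mul1r; apply: (one z (sel z) z 1) => //.
    by rewrite subrr cmod0.
  by have [_ + _] := pP (sel z); apply.
- move=> z z1.
  have [[w [v Kv zv]]|nw] := pselect (exists w, exists2 v, Kw w v & modc (z - v) < d).
    right; have [Kv' sv] := Kv; have [ss vs] := selP v Kv'; rewrite sv in ss vs.
    have [/(_ z z1)[t t01 pt] _ _] := pP w; exists w, t; split => //.
      by apply: le_trans (cmod_dist v _ _) _; lra.
    exact: (one z w v).
  left; apply: none => // w v Kv; rewrite leNgt; apply/negP => zv.
  by apply: nw; exists w, v.
Qed.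

End StepInterpolation.

(** * Corrections *)

(* [op g h] is the effect of the correction h on the value g: g + h in the ball,
   g * exp (- h) among zero-free functions.  [low] bounds g away from the values
   that admit no correction. *)
Record correction (R : realType) (op : R[i] -> R[i] -> R[i]) (low : R[i] -> R) := {
  correction0 : forall g, op g 0 = g ;
  correctionD : forall g h h', op (op g h) h' = op g (h + h') ;
  correction_unif : forall M e : R, 0 < e -> exists2 d : R, 0 < d &
    forall g g' h h', modc g <= 1 -> modc g' <= 1 -> modc h <= M -> modc h' <= M ->
      modc (g - g') <= d -> modc (h - h') <= d -> modc (op g h - op g' h') <= e ;
  correction_solve : forall k : R, 0 < k -> exists M : R, forall g c (m : R),
    k <= low g -> modc g <= m -> k <= modc c <= m -> m <= 1 ->
    exists a, [/\ modc a <= M, op g a = c &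
      forall t : R, 0 <= t <= 1 -> modc (op g (t%:C * a)) <= m] ;
  correction_low : forall k M : R, 0 < k -> exists2 k' : R, 0 < k' &
    forall g h, k <= low g -> modc h <= M -> k' <= low (op g h) }.

Section Stage.
Variable R : realType.
Implicit Types (z w v : R[i]) (x y e r d : R).

Lemma correction_add : correction (fun g h : R[i] => g + h) (fun=> 1 : R).
Proof.
split.
- by move=> g; rewrite addr0.
- by move=> g h h'; rewrite addrA.
- move=> M e e0; exists (e / 2); first lra.
  move=> g g' h h' _ _ _ _ gg hh; rewrite opprD addrACA.
  by apply: le_trans (cmodD _ _) _; lra.
(* The correction c - g has modulus at most 2, and its path is the segment from g to c, inside the
   disc of radius m by convexity. *)
- move=> k k0; exists 2 => g c m _ gm /andP[_ cm] m1; exists (c - g); split.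
  + by apply: le_trans (cmodB _ _) _; lra.
  + by rewrite addrC subrK.
  + move=> t /andP[t0 t1].
    have -> : g + t%:C * (c - g) = (1 - t)%:C * g + t%:C * c.
      by rewrite real_complexB; ring.
    apply: le_trans (cmodD _ _) _; rewrite !cmodM !cmod_real !ger0_norm //; last by lra.
    have : (1 - t) * modc g <= (1 - t) * m by rewrite ler_wpM2l //; lra.
    have : t * modc c <= t * m by rewrite ler_wpM2l.
    lra.
- by move=> k M k0; exists k.
Qed.

Lemma correction_mul : correction (fun g h : R[i] => g * cexp (- h)) (@modc R).
Proof.
split.
- by move=> g; rewrite oppr0 cexp0 mulr1.
- by move=> g h h'; rewrite -mulrA -cexpD -opprD.
(* 4 exp M from the Lipschitz bound on the exponential, and exp M from the change of g. *)
- move=> M e e0; pose C := 5 * expR M.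
  have C0 : 0 < C by rewrite mulr_gt0 // expR_gt0.
  exists (Num.min 2^-1 (e / C)); first by rewrite lt_min invr_gt0 ltr0n divr_gt0.
  move=> g g' h h' g1 g'1 hM h'M; rewrite !le_min => /andP[_ gg] /andP[h2 hh].
  have -> : g * cexp (- h) - g' * cexp (- h') =
     g * (cexp (- h) - cexp (- h')) + (g - g') * cexp (- h') by ring.
  have Rh : complex.Re (- h') <= M.
    by rewrite ReN; have := Re_le_cmod h'; rewrite ler_norml; lra.
  have hh' : - h - - h' = h' - h by rewrite opprK addrC.
  have L := @cexp_lip R M (- h) (- h') Rh.
  rewrite hh' cmodBC in L; have {}L := L h2.
  apply: le_trans (cmodD _ _) _; rewrite (cmodM g) (cmodM (g - g')) cmod_cexp.
  have l1 : modc g * modc (cexp (- h) - cexp (- h')) <= 1 * (4 * expR M * (e / C)).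
    apply: ler_pM => //; apply: le_trans L _.
    by rewrite ler_wpM2l // mulr_ge0 // expR_ge0.
  have l2 : modc (g - g') * expR (complex.Re (- h')) <= e / C * expR M.
    by apply: ler_pM => //; rewrite ?expR_ge0 ?ler_expR.
  have : e / C * (5 * expR M) = e by rewrite -/C divfK // gt_eqF.
  lra.
(* The correction is minus a logarithm b of c / g; both moduli lie in [k, 1], which bounds Re b by
   |ln k|. Along the path the modulus is |g| exp (t Re b), between |g| and |c|. *)
- move=> k k0; exists (`|ln k| + 2 * pi) => g c m kg gm /andP[kc cm] m1.
  have g0 : g != 0 by rewrite -cmod_gt0; lra.
  have [|b [bE bR bI]] := @cexp_log R (c / g).
    by rewrite mulf_neq0 ?invr_eq0 // -cmod_gt0; lra.
  have gb : g * cexp b = c by rewrite bE mulrCA divff ?mulr1.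
  exists (- b); split.
  + rewrite cmodN; apply: le_trans (cmod_leReIm _) _; apply: lerD => //.
    rewrite bR cmodf ln_div ?posrE; try lra.
    have l1 : ln k <= ln (modc c) by rewrite ler_ln ?posrE; lra.
    have l2 : ln k <= ln (modc g) by rewrite ler_ln ?posrE; lra.
    have l3 : ln (modc c) <= 0 by rewrite -ln1 ler_ln ?posrE; lra.
    have l4 : ln (modc g) <= 0 by rewrite -ln1 ler_ln ?posrE; lra.
    by rewrite (@ler0_norm _ (ln k)) ?ler_norml; [apply/andP; split|]; lra.
  + by rewrite opprK.
  + move=> t /andP[t0 t1]; rewrite mulrN opprK cmodM cmod_cexp ReZ.
    have cE : modc c = modc g * expR (complex.Re b) by rewrite -gb cmodM cmod_cexp.
    have [b0|b0] := leP (complex.Re b) 0.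
      apply: le_trans gm; rewrite ler_piMr //.
      by rewrite expR_le1 mulr_ge0_le0.
    apply: le_trans cm; rewrite cE ler_wpM2l // ler_expR.
    by rewrite ler_piMl // ltW.
- move=> k M k0; exists (k * expR (- M)); first by rewrite mulr_gt0 ?expR_gt0.
  move=> g h kg hM; rewrite cmodM cmod_cexp; apply: ler_pM => //.
  + exact: ltW.
  + by rewrite ler_expR ReN lerN2; have := Re_le_cmod h; rewrite ler_norml; lra.
Qed.

(** The equation op (g w) a = c is solved only at the finitely many points w of [step_poly]. Uniform
    continuity of g and phi transfers the result to the pieces around them and, through the third
    property of [step_poly], bounds the corrected function everywhere else in the disc. *)
Lemma stage (op : R[i] -> R[i] -> R[i]) low (K : set R[i]) (g phi : R[i] -> R[i])
    (m k e r : R) : correction op low ->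
  compact K -> ncover K -> K `<=` @circle R ->
  eucont (@cdisc R) g -> m < 1 -> 0 < k ->
  (forall z, modc z <= 1 -> modc (g z) <= m) ->
  (forall z, modc z <= 1 -> k <= low (g z)) ->
  eucont K phi -> (forall z, K z -> modc (phi z) <= 1) -> 0 < e -> r < 1 ->
  exists H : {poly R[i]},
  [/\ forall z, modc z <= r -> modc H.[z] <= e,
      exists2 m', m' < 1 & forall z, modc z <= 1 -> modc (op (g z) H.[z]) <= m' &
      forall z, K z -> modc (op (g z) H.[z] - phi z) <= e].
Proof.
move=> [op0 _ opU opS _] cK nK KT ug m1 k0 gm gk uphi phi1 e0 r1.
have Kmod z : K z -> modc z = 1 by move=> /KT.
have Kc z : K z -> modc z <= 1 by move=> /Kmod ->.
(* Targets are scaled by M1 < 1, at a cost of e / 4; M1 also dominates |g|. *)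
pose M1 := Num.max (Num.max m 2^-1) (1 - e / 4).
have M1_lt1 : M1 < 1 by rewrite !gt_max m1 /=; apply/andP; split; lra.
have mM1 : m <= M1 by rewrite !le_max lexx.
have hM1 : 2^-1 <= M1 by rewrite !le_max lexx orbT.
have eM1 : 1 - e / 4 <= M1 by rewrite !le_max lexx orbT.
pose k1 := Num.min (Num.min k (e / 8)) 2^-1.
have k10 : 0 < k1 by rewrite !lt_min k0 invr_gt0 ltr0n divr_gt0.
have k1k : k1 <= k by rewrite !ge_min lexx.
have k1e : k1 <= e / 8 by rewrite !ge_min lexx orbT.
have k1M : k1 <= M1 by apply: le_trans hM1; rewrite !ge_min lexx orbT.
clearbody M1 k1.
(* A target near 0 is out of reach for a multiplicative correction, so it is replaced by the
   constant k1; this costs at most 2 k1 <= e / 4. *)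
pose c w := if k1 <= modc (M1%:C * phi w) then M1%:C * phi w else k1%:C.
have cP w : K w -> k1 <= modc (c w) <= M1 /\ modc (c w - phi w) <= e / 2.
  move=> Kw; rewrite /c; have p1 := phi1 w Kw.
  have E : modc (M1%:C * phi w) = M1 * modc (phi w).
    by rewrite cmodM cmod_real ger0_norm //; lra.
  have D : modc (M1%:C * phi w - phi w) <= e / 4.
    have -> : M1%:C * phi w - phi w = (M1 - 1)%:C * phi w.
      by rewrite real_complexB; ring.
    rewrite cmodM cmod_real ltr0_norm ?subr_lt0 //.
    apply: le_trans (_ : - (M1 - 1) * 1 <= _); last by lra.
    by rewrite ler_wpM2l //; lra.
  case: ifPn => [kp|]; [split; last lra|rewrite -ltNge => kp; split].
  - by rewrite kp E; nra.
  - by rewrite cmod_real gtr0_norm // lexx.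
  - apply: le_trans (cmod_dist (M1%:C * phi w) _ _) _.
    apply: le_trans (lerD (cmodB _ _) D) _; rewrite cmod_real gtr0_norm //; lra.
have [M MP] := opS k1 k10.
(* The corrected function is bounded by M1 + e1, still below 1. *)
pose e1 := Num.min ((1 - M1) / 2) (e / 4).
have e10 : 0 < e1 by rewrite lt_min !divr_gt0 // subr_gt0.
have e1M : e1 <= (1 - M1) / 2 by rewrite ge_min lexx.
have e1e : e1 <= e / 4 by rewrite ge_min lexx orbT.
clearbody e1.
have [d d0 dP] := opU (`|M| + 1) e1 e10.
have [x1 x10 x1P] := ug d d0.
have [|x2 x20 x2P] := uphi (e / 4); first lra.
pose x := Num.min x1 x2 / 2.
have x0 : 0 < x by rewrite divr_gt0 // lt_min x10.
have xx1 : x < x1.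
  rewrite /x ltr_pdivrMr // mulr_natr mulr2n.
  by apply: le_lt_trans (_ : x1 < _); [rewrite ge_min lexx|lra].
have xx2 : x < x2.
  rewrite /x ltr_pdivrMr // mulr_natr mulr2n.
  by apply: le_lt_trans (_ : x2 < _); [rewrite ge_min lexx orbT|lra].
clearbody x.
have [s sK sP] := @step_poly R K x r cK nK KT x0 r1.
have ch w : exists a, K w -> [/\ modc a <= M, op (g w) a = c w &
    forall t : R, 0 <= t <= 1 -> modc (op (g w) (t%:C * a)) <= M1].
  have [Kw|nKw] := pselect (K w); last by exists 0.
  have [cw _] := cP w Kw.
  have [||a aP] := MP (g w) (c w) M1 _ _ cw (ltW M1_lt1).
  - exact: le_trans k1k (gk w (Kc w Kw)).
  - exact: le_trans (gm w (Kc w Kw)) mM1.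
  - by exists a.
have {}/choice [a aP] := ch.
pose e' := Num.min (Num.min d 1) e.
have e'0 : 0 < e' by rewrite !lt_min d0 ltr01.
have e'd : e' <= d by rewrite !ge_min lexx.
have e'1 : e' <= 1 by rewrite !ge_min lexx orbT.
have e'e : e' <= e by rewrite !ge_min lexx orbT.
clearbody e'.
have [H [H1 H2 H3]] := sP a e' e'0.
have g1 z : modc z <= 1 -> modc (g z) <= 1 by move=> /gm; lra.
have close z w t : modc z <= 1 -> w \in s -> modc (z - w) <= x -> 0 <= t <= 1 ->
    modc (H.[z] - t%:C * a w) <= e' ->
    modc (op (g z) H.[z] - op (g w) (t%:C * a w)) <= e1.
  move=> z1 ws zw /andP[t0 t1] Hz; have Kw := sK w ws; have [aM _ _] := aP w Kw.
  have taM : modc (t%:C * a w) <= `|M|.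
    rewrite cmodM cmod_real ger0_norm //; have := ler_norm M.
    have := cmod_ge0 (a w); nra.
  apply: dP; first exact: g1.
  - exact: g1 (Kc w Kw).
  - by have := cmod_subl H.[z] (t%:C * a w); lra.
  - exact: le_trans taM (ler_wpDr ler01 (lexx _)).
  - apply: ltW; apply: x1P; rewrite /cdisc /=; [exact: Kc|exact: z1|lra].
  - exact: le_trans Hz e'd.
exists H; split.
- by move=> z zr; apply: le_trans e'e; exact: H1.
- exists (M1 + e1) => [|z z1]; first lra.
  (* Either H is small and the value stays close to g z, or it is close to a point of the path
     issued from g w, of modulus at most M1. *)
  case: (H3 z z1) => [Hz|[w [t [ws t01 zw Hz]]]].
    have : modc (op (g z) H.[z] - op (g z) 0) <= e1.
      have e'M : e' <= `|M| + 1 by have := normr_ge0 M; lra.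
      apply: dP; rewrite ?subrr ?subr0 ?cmod0; first exact: g1.
      - exact: g1.
      - exact: le_trans e'M.
      - exact: le_trans (cmod_ge0 _) (le_trans Hz e'M).
      - exact: ltW.
      - exact: le_trans e'd.
    rewrite op0 => h; have := cmod_subl (op (g z) H.[z]) (g z); have := gm z z1; lra.
  have := close z w t z1 ws zw t01 Hz; have [_ _ /(_ t t01)] := aP w (sK w ws).
  have := cmod_subl (op (g z) H.[z]) (op (g w) (t%:C * a w)); lra.
- move=> z Kz; have [w [ws zw Hz]] := H2 z Kz; have Kw := sK w ws.
  have := @close z w 1 (Kc z Kz) ws zw; rewrite mul1r ler01 lexx.
  move=> /(_ isT Hz); have [_ -> _] := aP w Kw => h1.
  have [_ h2] := cP w Kw.
  have h3 : modc (phi w - phi z) < e / 4.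
    by apply: x2P => //; rewrite cmodBC; lra.
  apply: le_trans (cmod_dist (c w) _ _) _.
  have := cmod_dist (phi w) (c w) (phi z); lra.
Qed.

End Stage.

(** * Holomorphic functions *)

Section RootsOfUnity.
Variable R : realType.
Implicit Types (z w v : R[i]) (x y e r d : R).

Lemma cis_natM x n : cis (n%:R * x) = cis x ^+ n.
Proof.
elim: n => [|n IH]; first by rewrite mul0r cis0 expr0.
by rewrite -natr1 mulrDl mul1r cisD IH exprSr.
Qed.

Lemma cis_neq1 x : 0 < x < 2 * pi -> cis x != 1.
Proof.
move=> /andP[x0 xpi]; apply/eqP => /(congr1 (@complex.Re R)) /= c1.
have xE : x = (x / 2) *+ 2 by rewrite mulr2n; lra.
have : 0 < sin (x / 2) by apply: sin_gt0_pi; apply/andP; split; lra.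
move=> s0; have s2 : 0 < sin (x / 2) ^+ 2 by rewrite exprn_gt0.
by move: c1; rewrite xE cos_mulr2n cos2sin2 mulr2n; lra.
Qed.

Definition root1 n : R[i] := cis (2 * pi / n%:R).

Lemma cmod_root1X n j : modc (root1 n ^+ j) = 1.
Proof. by rewrite cmodX /root1 cis_cmod expr1n. Qed.

Lemma root1_order n : (0 < n)%N -> root1 n ^+ n = 1.
Proof.
move=> n0; rewrite -cis_natM mulrC divfK ?pnatr_eq0 -?lt0n //.
by rewrite /cis mulrDl mul1r -mulr2n cos2pi sin2pi.
Qed.

Lemma root1_neq1 n k : (0 < k < n)%N -> root1 n ^+ k != 1.
Proof.
move=> /andP[k0 kn]; rewrite -cis_natM; apply: cis_neq1.
have n0 : 0 < n%:R :> R by rewrite ltr0n (leq_trans _ kn).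
have p0 : 0 < 2 * pi :> R by rewrite mulr_gt0 // pi_gt0.
apply/andP; split; first by rewrite mulr_gt0 ?ltr0n // divr_gt0.
by rewrite mulrA ltr_pdivrMr // mulrC ltr_pM2l // ltr_nat.
Qed.

Lemma root1_sum n k : (0 < n)%N ->
  \sum_(j < n) root1 n ^+ (j * k) = if (n %| k)%N then n%:R else 0.
Proof.
move=> n0.
have red : root1 n ^+ k = root1 n ^+ (k %% n).
  by rewrite {1}(divn_eq k n) exprD mulnC exprM root1_order // expr1n mul1r.
under eq_bigr do rewrite mulnC exprM.
case: ifPn => [/dvdnP[q ->]|nk].
  rewrite mulnC exprM root1_order // expr1n.
  by under eq_bigr do rewrite expr1n; rewrite sumr_const card_ord.
have := subrX1 (root1 n ^+ k) n.
rewrite -exprM mulnC exprM root1_order // expr1n subrr => /esym/eqP.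
rewrite mulf_eq0 subr_eq0 => /orP[|/eqP //].
rewrite red => /eqP E; exfalso; move/eqP: E; apply/negP.
by apply: root1_neq1; rewrite lt0n ltn_mod n0 andbT.
Qed.

(* Discrete Fourier inversion: the exponent (n - k) stands for -k modulo n. *)
Lemma coef_extract (p : {poly R[i]}) n k x : (size p <= n)%N -> (k < n)%N ->
  \sum_(j < n) p.[x%:C * root1 n ^+ j] * root1 n ^+ (j * (n - k)) =
  n%:R * (p`_k * x%:C ^+ k).
Proof.
move=> pn kn; have n0 : (0 < n)%N by exact: leq_ltn_trans kn.
under eq_bigr => j _.
  rewrite (horner_coef_wide _ pn) mulr_suml.
  under eq_bigr do rewrite exprMn -!mulrA -exprM -exprD -mulnDr mulrA.
  over.
rewrite exchange_big /=; under eq_bigr do rewrite -mulr_sumr root1_sum //.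
rewrite (bigD1 (Ordinal kn)) //= subnKC ?(ltnW kn) // dvdnn mulrC big1 ?addr0 //.
move=> i /eqP ik; case: ifPn; last by rewrite mulr0.
have i_n := ltn_ord i; move=> /dvdnP[q qE]; case: ik; apply: val_inj => /=.
have : (0 < q)%N by case: q qE => // ; rewrite mul0n; lia.
have : (q < 2)%N by rewrite ltnNge; apply/negP => q2; have := leq_mul q2 (leqnn n); lia.
by case: q qE => [|[|]] //; rewrite mul1n; lia.
Qed.

(** Cauchy's estimate: the coefficient is an average of values of p over equally spaced points of
    the circle of radius x. *)
Lemma coef_bound (p : {poly R[i]}) x M k : 0 < x ->
  (forall z, modc z <= x -> modc p.[z] <= M) -> modc p`_k * x ^+ k <= M.
Proof.
move=> x0 pM; pose n := (size p + k).+1.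
have n0 : 0 < n%:R :> R by rewrite ltr0n.
have := @coef_extract p n k x; rewrite /n.
move=> /(_ ltac:(lia) ltac:(lia)); rewrite -/n => /(congr1 (@modc R)).
rewrite !cmodM cmod_nat cmodX cmod_real (gtr0_norm x0) => E.
rewrite -(ler_pM2l n0) -E; apply: le_trans (cmod_sum _ _ _) _.
apply: (@le_trans _ _ (\sum_(j < n) M)); last first.
  by rewrite sumr_const card_ord mulr_natl.
apply: ler_sum => j _; rewrite cmodM cmod_root1X mulr1; apply: pM.
by rewrite cmodM cmod_root1X mulr1 cmod_real gtr0_norm.
Qed.

(** By Cauchy's estimate the term of degree i is at most M (|h| / d)^i, and the geometric sum of
    ratio at most 1/2 gives the factor 2. *)
Lemma poly_second_order (p : {poly R[i]}) d M h : 0 < d ->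
  (forall z, modc z <= d -> modc p.[z] <= M) -> modc h <= d / 2 ->
  modc (p.[h] - p`_0 - p`_1 * h) <= 2 * M * (modc h / d) ^+ 2.
Proof.
move=> d0 pM hd; have M0 : 0 <= M.
  by apply: le_trans (cmod_ge0 _) (pM 0 _); rewrite cmod0 ltW.
pose t := modc h / d.
have t0 : 0 <= t by rewrite divr_ge0 // ltW.
have t2 : t <= 2^-1 by rewrite ler_pdivrMr // mulrC.
pose n := (size p).+2.
have -> : p.[h] - p`_0 - p`_1 * h = \sum_(i < size p) p`_i.+2 * h ^+ i.+2.
  rewrite (@horner_coef_wide _ n) /n; last by rewrite (leq_trans (leqnSn _)).
  rewrite 2!big_ord_recl /= expr0 mulr1 expr1; ring.
apply: le_trans (cmod_sum _ _ _) _.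
apply: (@le_trans _ _ (\sum_(i < size p) M * t ^+ 2 * t ^+ i)).
  apply: ler_sum => i _; rewrite cmodM cmodX -mulrA -exprD add2n /t expr_div_n.
  rewrite [leRHS]mulrA ler_pdivlMr ?exprn_gt0 // mulrAC ler_wpM2r ?exprn_ge0 //.
  exact: coef_bound.
rewrite -mulr_sumr.
have : \sum_(i < size p) t ^+ i <= 2.
  have := subrX1 t (size p); set S := \sum_(i < _) _ => E.
  have S0 : 0 <= S by apply: sumr_ge0 => i _; exact: exprn_ge0.
  have : 0 <= t ^+ size p by exact: exprn_ge0.
  nra.
move=> S2; have Mt : 0 <= M * t ^+ 2 by rewrite mulr_ge0 // exprn_ge0.
by apply: le_trans (ler_wpM2l Mt S2) _; rewrite -/t; lra.
Qed.

End RootsOfUnity.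

Section Holomorphic.
Variable R : realType.
Implicit Types (z w v : R[i]) (x y e r d : R) (f g : R[i] -> R[i]).

(** Complex differentiability free of quotients and with real bounds; the next two lemmas compare it
    with [derivable]. *)
Definition hasD f z := exists L : R[i], forall e, 0 < e ->
  exists2 d, 0 < d & forall h, modc h < d ->
    modc (f (z + h) - f z - L * h) <= e * modc h.

Lemma hasD_derivable f z : hasD f z -> derivable f z 1.
Proof.
move=> [L HL]; apply/cvg_ex; exists L; apply/cvgrPdistC_le => e e0.
have [d d0 Hd] := HL (complex.Re e) ltac:(by move: e0; rewrite ltcE /= => /andP[]).
rewrite near_withinE; apply/nbhs_cmodP; exists d => // h.
rewrite subr0 => hd h0 /=; rewrite /GRing.scale /= mulr1.
have -> : h^-1 * (f (h + z) - f z) - L = h^-1 * (f (z + h) - f z - L * h).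
  by rewrite (addrC h) [RHS]mulrBr (mulrCA _ L) mulVf // mulr1.
rewrite normr_cmod cmodM cmodV lecE /=.
move: e0; rewrite ltcE /= => /andP[/eqP <- _]; rewrite eqxx /=.
by rewrite mulrC ler_pdivrMr ?cmod_gt0 //; exact: Hd.
Qed.

Lemma derivable_hasD f z : derivable f z 1 -> hasD f z.
Proof.
move=> /cvg_ex [L]; move/cvgrPdistC_le => HL; exists L => e e0.
have ec : 0 < e%:C by rewrite ltcR.
have := HL e%:C ec; rewrite near_withinE => /nbhs_cmodP[d d0 Hd].
exists d => // h hd; have [->|h0] := eqVneq h 0.
  by rewrite addr0 subrr mulr0 subr0 cmod0 mulr0.
have := Hd h; rewrite subr0 => /(_ hd h0) /=; rewrite /GRing.scale /= mulr1.
have -> : h^-1 * (f (h + z) - f z) - L = h^-1 * (f (z + h) - f z - L * h).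
  by rewrite (addrC h) [RHS]mulrBr (mulrCA _ L) mulVf // mulr1.
rewrite normr_cmod cmodM cmodV lecR.
by rewrite mulrC ler_pdivrMr ?cmod_gt0.
Qed.

Lemma hasD_lip f z : hasD f z -> exists C d, [/\ 0 < C, 0 < d &
  forall h, modc h < d -> modc (f (z + h) - f z) <= C * modc h].
Proof.
move=> [L HL]; have [d d0 Hd] := HL 1 ltr01.
exists (modc L + 1), d; split => //; first by rewrite ltr_wpDl.
move=> h /Hd; rewrite mul1r => H.
have := cmodD (f (z + h) - f z - L * h) (L * h).
by rewrite subrK cmodM; lra.
Qed.

Lemma hasD_econt (A : set R[i]) f : (forall z, A z -> hasD f z) -> econt A f.
Proof.
move=> fD z Az e e0; have [C [d [C0 d0 H]]] := hasD_lip (fD z Az).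
exists (Num.min d (e / C)); first by rewrite lt_min d0 divr_gt0.
move=> w _; rewrite lt_min => /andP[wd we].
have := H (w - z) wd; rewrite (addrC z) subrK => h; apply: le_lt_trans h _.
by rewrite mulrC -ltr_pdivlMr.
Qed.

Lemma hasD_local f g z r : 0 < r -> (forall h, modc h < r -> f (z + h) = g (z + h)) ->
  hasD f z -> hasD g z.
Proof.
move=> r0 fg [L HL]; exists L => e /HL[d d0 H].
exists (Num.min d r) => [|h]; first by rewrite lt_min d0.
rewrite lt_min => /andP[hd hr]; rewrite -fg // -[in g z](addr0 z) -fg ?cmod0 // addr0.
exact: H.
Qed.

Lemma hasD_cst c z : hasD (fun=> c) z.
Proof.
exists 0 => e e0; exists 1 => // h _.
by rewrite mul0r subr0 subrr cmod0 mulr_ge0 // ltW.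
Qed.

Lemma hasDD f g z : hasD f z -> hasD g z -> hasD (fun z => f z + g z) z.
Proof.
move=> [L HL] [L' HL']; exists (L + L') => e e0.
have [|d d0 H] := HL (e / 2); first lra.
have [|d' d'0 H'] := HL' (e / 2); first lra.
exists (Num.min d d') => [|h]; first by rewrite lt_min d0.
rewrite lt_min => /andP[/H h1 /H' h2].
have -> : f (z + h) + g (z + h) - (f z + g z) - (L + L') * h =
  (f (z + h) - f z - L * h) + (g (z + h) - g z - L' * h) by ring.
by apply: le_trans (cmodD _ _) _; lra.
Qed.

Lemma hasDM f g z : hasD f z -> hasD g z -> hasD (fun z => f z * g z) z.
Proof.
move=> fD gD; have [C [d1 [C0 d10 Hg]]] := hasD_lip gD.
move: fD gD => [L HL] [L' HL']; exists (L * g z + f z * L') => e e0.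
pose A := modc (f z) + modc (g z) + 1 + modc L * C.
have A1 : 1 <= A.
  by rewrite /A; have := cmod_ge0 (f z); have := cmod_ge0 (g z);
     have := mulr_ge0 (cmod_ge0 L) (ltW C0); lra.
pose e' := Num.min 1 (e / (3 * A)).
have e'0 : 0 < e' by rewrite lt_min ltr01 divr_gt0 // mulr_gt0 //; lra.
have e'e : e' * (3 * A) <= e by rewrite -ler_pdivlMr ?ge_min ?lexx ?orbT //; lra.
clearbody e'; have [d d0 H] := HL e' e'0; have [d' d'0 H'] := HL' e' e'0.
exists (Num.min (Num.min d d') (Num.min d1 (Num.min (C^-1) e'))).
  by rewrite !lt_min d0 d'0 d10 e'0 invr_gt0 C0.
move=> h; rewrite !lt_min => /and3P[/andP[hd hd'] hd1 /andP[hC he]].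
have -> : f (z + h) * g (z + h) - f z * g z - (L * g z + f z * L') * h =
   (f (z + h) - f z - L * h) * g (z + h) +
   f z * (g (z + h) - g z - L' * h) + (L * h) * (g (z + h) - g z) by ring.
have h0 := cmod_ge0 h.
have hg := Hg h hd1.
have Ch : C * modc h <= 1 by rewrite mulrC -ler_pdivlMr // div1r ltW.
have g1 : modc (g (z + h)) <= modc (g z) + 1.
  by have := cmod_subl (g (z + h)) (g z); lra.
apply: le_trans (cmodD _ _) _; apply: le_trans (lerD (cmodD _ _) (lexx _)) _.
rewrite !cmodM.
have t1 : modc (f (z + h) - f z - L * h) * modc (g (z + h)) <= e' * modc h * A.
  apply: ler_pM => //; first exact: H.
  rewrite /A; have := cmod_ge0 (f z); have := mulr_ge0 (cmod_ge0 L) (ltW C0); lra.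
have t2 : modc (f z) * modc (g (z + h) - g z - L' * h) <= A * (e' * modc h).
  apply: ler_pM => //; last exact: H'.
  rewrite /A; have := cmod_ge0 (g z); have := mulr_ge0 (cmod_ge0 L) (ltW C0); lra.
have t3 : modc L * modc h * modc (g (z + h) - g z) <= e' * A * modc h.
  apply: (@le_trans _ _ (modc L * e' * (C * modc h))).
    apply: ler_pM => //; rewrite ?mulr_ge0 //.
    by rewrite ler_wpM2l // ltW.
  have : modc L * C <= A by rewrite /A; have := cmod_ge0 (f z); have := cmod_ge0 (g z); lra.
  move=> LA; have : modc L * C * (e' * modc h) <= A * (e' * modc h).
    by rewrite ler_wpM2r // mulr_ge0 // ltW.
  by lra.
have : e' * (3 * A) * modc h <= e * modc h by rewrite ler_wpM2r.
lra.
Qed.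

Lemma hasD_dilate f z r : hasD f (r%:C * z) -> hasD (dilate r f) z.
Proof.
move=> [L HL]; exists (L * r%:C) => e e0.
pose c := `|r| + 1; have c0 : 0 < c by rewrite ltr_wpDl.
have [|d d0 H] := HL (e / c); first by rewrite divr_gt0.
have rc : `|r| <= c by rewrite /c; lra.
exists (d / c) => [|h hd]; first by rewrite divr_gt0.
have hm : modc (r%:C * h) <= c * modc h.
  by rewrite cmodM cmod_real ler_wpM2r.
rewrite /dilate mulrDr -mulrA; apply: le_trans (H _ _) _.
  by apply: le_lt_trans hm _; rewrite mulrC -ltr_pdivlMr.
apply: le_trans (_ : e / c * (c * modc h) <= _); last by rewrite mulrA divfK ?gt_eqF.
by rewrite ler_wpM2l // divr_ge0 // ltW.
Qed.

Lemma hasD_cexp f z : hasD f z -> hasD (fun z => cexp (f z)) z.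
Proof.
move=> fD; have [C [d1 [C0 d10 Hf]]] := hasD_lip fD.
move: fD => [L HL]; exists (cexp (f z) * L) => e e0.
pose E := expR (complex.Re (f z)); have E0 : 0 < E by exact: expR_gt0.
have [|d d0 H] := HL (e / (2 * E)); first by rewrite divr_gt0 // mulr_gt0.
pose d2 := Num.min ((2 * C)^-1) (e / (12 * E * C ^+ 2)).
have d20 : 0 < d2 by rewrite lt_min invr_gt0 divr_gt0 ?mulr_gt0 ?exprn_gt0.
exists (Num.min (Num.min d d1) d2); first by rewrite lt_min d20 andbT lt_min d0.
move=> h; rewrite !lt_min => /and3P[/andP[hd hd1] hC he].
pose k := f (z + h) - f z; have kC : modc k <= C * modc h by exact: Hf.
have -> : cexp (f (z + h)) - cexp (f z) - cexp (f z) * L * h =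
   cexp (f z) * (cexp k - 1 - k) + cexp (f z) * (k - L * h).
  have -> : cexp (f (z + h)) = cexp (f z) * cexp k.
    by rewrite -cexpD /k addrCA subrr addr0.
  by ring.
have h0 := cmod_ge0 h.
have k2 : modc k <= 2^-1.
  apply: le_trans kC _; rewrite mulrC -ler_pdivlMr // -invfM ltW //.
have K := cexp_second_order k2.
apply: le_trans (cmodD _ _) _; rewrite (cmodM (cexp _)) (cmodM (cexp _) (k - _)).
rewrite !cmod_cexp -/E.
have t1 : E * modc (k - L * h) <= E * (e / (2 * E) * modc h).
  by rewrite (ler_wpM2l (ltW E0)) //; exact: H.
have t2 : E * modc (cexp k - 1 - k) <= E * (6 * (C * modc h) ^+ 2).
  rewrite (ler_wpM2l (ltW E0)) //; apply: le_trans K _; rewrite ler_wpM2l //.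
  by rewrite lerXn2r ?nnegrE // mulr_ge0 // ltW.
have e1 : E * (e / (2 * E) * modc h) = e / 2 * modc h by field; rewrite gt_eqF.
have t3 : modc h * (12 * E * C ^+ 2) <= e.
  by rewrite -ler_pdivlMr ?ltW // !mulr_gt0 // exprn_gt0.
have t4 : modc h * (12 * E * C ^+ 2) * modc h <= e * modc h by rewrite ler_wpM2r.
have e2 : E * (6 * (C * modc h) ^+ 2) = modc h * (12 * E * C ^+ 2) * modc h / 2.
  by field.
lra.
Qed.

(* Cauchy's estimates for the approximating polynomials make their derivatives
   at z converge. *)
Lemma papprox_hasD f z r : modc z < r -> papprox r f -> hasD f z.
Proof.
move=> zr af; pose d := r - modc z.
have d0 : 0 < d by rewrite subr_gt0.
have [M M0 fM] := papprox_bounded af.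
have shift (h : R[i]) : modc h <= d -> modc (z + h) <= r.
  by move=> hd; apply: le_trans (cmodD _ _) _; rewrite /d in hd; lra.
have [V [V0 V1 small]] : exists V : nat -> R, [/\ forall n, 0 < V n,
    forall n, V n <= 1 &
    forall e, 0 < e -> exists N, forall n, (N <= n)%N -> V n < e].
  exists (fun n => n.+1%:R^-1); split=> [n|n|e e0] /=; first by rewrite invr_gt0 ltr0n.
    by rewrite invf_le1 ?ler1n ?ltr0n.
  exists (Num.truncn e^-1) => n Nn.
  rewrite -[ltRHS]invrK ltf_pV2 ?posrE ?invr_gt0 ?ltr0n //.
  by apply: lt_le_trans (truncnS_gt _) _; rewrite ler_nat.
have ch (n : nat) : exists p : {poly R[i]}, forall h, modc h <= d ->
    modc (f (z + h) - p.[h]) <= V n.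
  have [p pP] := af (V n) (V0 n).
  (* Recentred at z, the approximating polynomial has its derivative at z as coefficient of degree
     1. *)
  exists (p \Po ('X + z%:P)) => h hd; rewrite horner_comp hornerD hornerX hornerC.
  by rewrite [h + z]addrC; apply: pP; exact: shift.
have {}/choice [p pP] := ch.
have [L cL] : exists L : R[i], (fun n => (p n)`_1) @ \oo --> L.
  apply: cauchy_cmod => e e0; have [|N NP] := small (e * d / 3).
    by rewrite divr_gt0 // mulr_gt0.
  exists N => n Nn.
  have B h : modc h <= d -> modc (p n - p N).[h] <= e * d / 3 + e * d / 3.
    move=> hd; rewrite hornerD hornerN.
    apply: le_trans (cmod_dist (f (z + h)) _ _) _; rewrite cmodBC.
    have := pP n h hd; have := pP N h hd; have := NP n Nn; have := NP N (leqnn N).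
    lra.
  have := coef_bound 1 d0 B; rewrite coefB expr1 => h.
  by rewrite -(ltr_pM2r d0); have := mulr_gt0 e0 d0; lra.
exists L => e e0.
pose C := 2 * (M + 1) / d ^+ 2.
have C0 : 0 < C by rewrite divr_gt0 ?exprn_gt0 // mulr_gt0 //; lra.
exists (Num.min (d / 2) (e / C)); first by rewrite lt_min; apply/andP; split; apply: divr_gt0.
move=> h; rewrite lt_min => /andP[hd he].
apply: (@le_trans _ _ (C * modc h ^+ 2)); last first.
  by rewrite expr2 mulrA ler_wpM2r // mulrC -ler_pdivlMr // ltW.
(* For fixed h, n is taken so large that the approximation errors add up to at most e'; as e' is
   arbitrary, only the quadratic term remains. *)
apply/ler_addgt0Pr => e' e'0.
have [N1 H1] := small (e' / 3) ltac:(lra).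
move/cvg_cmodP : cL => /(_ (e' / 3 / (modc h + 1))) [|N2 H2].
  by rewrite divr_gt0 ?ltr_wpDl //; lra.
pose n := maxn N1 N2.
have pM h' : modc h' <= d -> modc (p n).[h'] <= M + 1.
  move=> h'd; have := pP n h' h'd; have := fM _ (shift _ h'd).
  have := cmod_subl (p n).[h'] (f (z + h')); rewrite (cmodBC (p n).[h']).
  have := V1 n; lra.
have := poly_second_order d0 pM (ltW hd).
have -> : 2 * (M + 1) * (modc h / d) ^+ 2 = C * modc h ^+ 2.
  by rewrite /C; field; rewrite gt_eqF.
move=> T.
have hd' : modc h <= d by lra.
have F1 := pP n h hd'.
have F0 := pP n 0 ltac:(by rewrite cmod0 ltW).
have c0 : (p n).[0] = (p n)`_0 by rewrite horner_coef0.
rewrite addr0 c0 in F0.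
have N1n := H1 n (leq_maxl _ _); have N2n := H2 n (leq_maxr _ _).
have -> : f (z + h) - f z - L * h =
  ((p n).[h] - (p n)`_0 - (p n)`_1 * h) + (f (z + h) - (p n).[h]) -
  (f z - (p n)`_0) + ((p n)`_1 - L) * h by ring.
apply: le_trans (cmodD _ _) _; apply: le_trans (lerD (cmodB _ _) (lexx _)) _.
apply: le_trans (lerD (lerD (cmodD _ _) (lexx _)) (lexx _)) _.
rewrite (cmodM (_ - L)).
have : modc ((p n)`_1 - L) * modc h <= e' / 3.
  apply: (@le_trans _ _ (e' / 3 / (modc h + 1) * (modc h + 1))).
    by apply: ler_pM => //; [exact: ltW|lra].
  by rewrite divfK // gt_eqF // ltr_wpDl.
lra.
Qed.

End Holomorphic.

(** * Singular factors *)

Section Discretization.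
Variable R : realType.
Implicit Types (z w v u : R[i]) (x y e r d m : R).

(** Since w^n = 1, the geometric sum of w^n - z^n = 1 - z^n clears the denominator w - z. The kernel
    becomes a polynomial in w, whose sums over roots of unity are computed exactly. *)
Lemma herglotz_root n w z : (0 < n)%N -> w ^+ n = 1 -> z ^+ n != 1 ->
  herglotz w z = 2 / (1 - z ^+ n) * \sum_(l < n) z ^+ l * w ^+ (n - l) - 1.
Proof.
move=> n0 wn zn; have zn' : 1 - z ^+ n != 0 by rewrite subr_eq0 eq_sym.
have wz : w - z != 0.
  by rewrite subr_eq0; apply: contraNneq zn => <-; rewrite wn.
have := subrXX w z n; rewrite wn => E.
have -> : \sum_(l < n) z ^+ l * w ^+ (n - l) =
    w * \sum_(l < n) w ^+ (n.-1 - l) * z ^+ l.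
  rewrite mulr_sumr; apply: eq_bigr => l _; rewrite mulrA -exprS mulrC.
  by congr (_ ^+ _ * _); have := ltn_ord l; lia.
set S := \sum_(l < n) w ^+ (n.-1 - l) * z ^+ l in E *.
have {}E : S = (1 - z ^+ n) / (w - z) by rewrite E mulrC mulKf.
by rewrite E /herglotz; field; rewrite zn' wz.
Qed.

Lemma sum_coef_le (p : {poly R[i]}) n :
  \sum_(k < n) modc p`_k <= \sum_(k < size p) modc p`_k.
Proof.
rewrite -!(big_mkord xpredT (fun k => modc p`_k)).
have [np|pn] := leqP n (size p).
  by rewrite (big_cat_nat (leq0n n) np) /= lerDl; apply: sumr_ge0.
rewrite (big_cat_nat (leq0n _) (ltnW pn)) /= [X in _ + X]big_nat [X in _ + X]big1 ?addr0 //.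
by move=> k /andP[pk _]; rewrite nth_default // cmod0.
Qed.

(** Riemann sums of the Herglotz formula, which recovers G minus i Im G(0) from Re G on the circle.
    On n-th roots of unity, n larger than the degree, the coefficients are recovered exactly up to
    aliasing, and every aliased term carries a high power of z. *)
Lemma discretize (G : {poly R[i]}) r e : 0 <= r < 1 -> 0 < e ->
  exists2 n, (0 < n)%N & forall z, modc z <= r ->
    modc (G.[z] - (0 +i* complex.Im G`_0) -
      \sum_(j < n) (complex.Re G.[root1 R n ^+ j] / n%:R)%:C *
         herglotz (root1 R n ^+ j) z) <= e.
Proof.
move=> /andP[r0 r1] e0; pose A := \sum_(k < size G) modc G`_k.
have A0 : 0 <= A by apply: sumr_ge0.
have [||q qP] := @exp_small R r (e * (1 - r) / (3 * (A + 1))).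
- by rewrite r0.
- by rewrite divr_gt0 ?mulr_gt0 ?subr_gt0 //; lra.
have [N NE] : exists N, N = (size G + q)%N by exists (size G + q)%N.
exists N.+1 => // z zr.
have sN : (size G <= N.+1)%N by rewrite NE leqW // leq_addr.
have nC : (N.+1%:R : R[i]) != 0 by rewrite pnatr_eq0.
have zq : modc z ^+ q <= r ^+ q by rewrite lerXn2r ?nnegrE.
have z1 : modc z <= 1 by lra.
have zn : modc (z ^+ N.+1) <= r ^+ q.
  rewrite cmodX; apply: le_trans zq; rewrite NE -addnS exprD.
  have -> : modc z ^+ (size G) * modc z ^+ q.+1 = modc z ^+ (size G) * modc z * modc z ^+ q.
    by rewrite exprS mulrA.
  by rewrite ler_piMl ?exprn_ge0 // -exprSr exprn_ile1.
have d_ge : 1 - r <= modc (1 - z ^+ N.+1).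
  have := cmod_subl 1 (z ^+ N.+1); rewrite cmod1 => h; apply: le_trans h.
  rewrite lerB // cmodX; apply: le_trans (_ : modc z ^+ 1 <= _); last by rewrite expr1.
  by rewrite ler_wiXn2l.
have zn1 : 1 - z ^+ N.+1 != 0 by rewrite -cmod_gt0; lra.
have zn2 : z ^+ N.+1 != 1 by rewrite eq_sym -subr_eq0.
pose w j := root1 R N.+1 ^+ j.
have wn j : w j ^+ N.+1 = 1 by rewrite /w -exprM mulnC exprM root1_order // expr1n.
have conjw j k : (k <= N.+1)%N -> conjc (w j ^+ (N.+1 - k)) = w j ^+ k.
  move=> kn; have x0 : w j ^+ (N.+1 - k) != 0.
    by rewrite -cmod_gt0 cmodX cmod_root1X expr1n.
  by apply: (mulfI x0); rewrite mulcJ cmodX cmod_root1X !expr1n -exprD subnK.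
have coefG k : (k < N.+1)%N ->
    \sum_(j < N.+1) G.[w j] * w j ^+ (N.+1 - k) = N.+1%:R * G`_k.
  move=> kn; have := @coef_extract R G N.+1 k 1 sN kn.
  rewrite rmorph1 expr1n mulr1 => <-.
  by apply: eq_bigr => j _; rewrite mul1r /w exprM.
(* Coefficients of the conjugate of G on the roots of unity: conjugation turns w^k into w^(n - k),
   so degree k is folded onto n - k, and degree 0 onto itself. *)
pose c k := if k is 0%N then conjc G`_0 else conjc G`_(N.+1 - k).
have coefJ k : (k < N.+1)%N ->
    \sum_(j < N.+1) conjc G.[w j] * w j ^+ (N.+1 - k) = N.+1%:R * c k.
  move=> kn; rewrite -[LHS]conjcK (rmorph_sum (@conjc R)).
  under eq_bigr => j _ do rewrite rmorphM /= conjcK conjw ?(ltnW kn) //.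
  case: k kn => [|k] kn /=.
    transitivity (conjc (\sum_(j < N.+1) G.[w j] * w j ^+ (N.+1 - 0))).
      by congr conjc; apply: eq_bigr => j _; rewrite expr0 subn0 wn.
    by rewrite coefG // rmorphM rmorph_nat.
  transitivity (conjc (\sum_(j < N.+1) G.[w j] * w j ^+ (N.+1 - (N.+1 - k.+1)))).
    by congr conjc; apply: eq_bigr => j _; rewrite subKn // ltnW.
  by rewrite coefG ?rmorphM ?rmorph_nat // subSS ltnS leq_subr.
have Re2 j : (complex.Re G.[w j])%:C = (G.[w j] + conjc G.[w j]) / 2.
  exact: ReJ_add.
have sumE k : (k < N.+1)%N ->
   \sum_(j < N.+1) (complex.Re G.[w j] / N.+1%:R)%:C * w j ^+ (N.+1 - k) = (G`_k + c k) / 2.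
  move=> kn; have -> : (G`_k + c k) / 2 = N.+1%:R^-1 * ((N.+1%:R * G`_k + N.+1%:R * c k) / 2).
    by rewrite -mulrDr -mulrA mulKf.
  rewrite -coefG // -coefJ // -big_split /=.
  rewrite mulr_suml mulr_sumr; apply: eq_bigr => j _.
  rewrite rmorphM fmorphV rmorph_nat /= Re2 -mulrDl.
  by move: (N.+1%:R^-1) (G.[w j]) (w j ^+ _) => *; ring.
have -> : \sum_(j < N.+1) (complex.Re G.[w j] / N.+1%:R)%:C * herglotz (w j) z =
   (\sum_(l < N.+1) z ^+ l * (G`_l + c l)) / (1 - z ^+ N.+1) - (G`_0 + c 0%N) / 2.
  rewrite -(sumE 0%N) // mulr_suml.
  under eq_bigr => j _ do rewrite (herglotz_root (ltn0Sn N) (wn j) zn2).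
  under eq_bigr => j _ do rewrite mulrBr mulr1 mulrCA mulr_sumr.
  rewrite sumrB; congr (_ - _); last first.
    by apply: eq_bigr => j _; rewrite subn0 wn mulr1.
  rewrite -mulr_sumr exchange_big /= mulr_sumr; apply: eq_bigr => l _.
  rewrite (eq_bigr (fun j : 'I_N.+1 => z ^+ l *
     ((complex.Re G.[w j] / N.+1%:R)%:C * w j ^+ (N.+1 - l)))); last first.
    by move=> j _; rewrite mulrCA.
  by rewrite -mulr_sumr sumE //; field.
have GE : \sum_(l < N.+1) z ^+ l * (G`_l + c l) =
   G.[z] + c 0%N + \sum_(l < N) z ^+ l.+1 * conjc G`_(N.+1 - l.+1).
  rewrite -addrA (@horner_coef_wide _ N.+1); last exact: sN.
  under eq_bigr do rewrite mulrDr.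
  rewrite big_split /=; congr (_ + _).
    by apply: eq_bigr => l _; rewrite mulrC.
  by rewrite big_ord_recl /= expr0 mul1r.
rewrite GE; set E := \sum_(l < N) _.
have Ele : modc E <= A * r ^+ q.
  apply: le_trans (cmod_sum _ _ _) _.
  apply: (@le_trans _ _ (\sum_(l < N) modc G`_(N.+1 - l.+1) * r ^+ q)).
    apply: ler_sum => l _; rewrite cmodM cmodX cmodJ mulrC.
    (* As N = [size G] + q, a coefficient that is not zero by degree comes with a power of z greater
       than q. *)
    have [Gl|Gl] := leqP (size G) (N.+1 - l.+1).
      by rewrite nth_default // cmod0 !mul0r.
    rewrite ler_wpM2l //; apply: le_trans zq; rewrite ler_wiXn2l //.
    by move: Gl NE (ltn_ord l); clear; move: (nat_of_ord l) (size G) => i j; lia.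
  rewrite -mulr_suml ler_wpM2r ?exprn_ge0 //.
  rewrite (reindex_inj rev_ord_inj) /=.
  rewrite (eq_bigr (fun l : 'I_N => modc G`_l.+1)); last first.
    by move=> l _; congr (modc _`_ _); move: (ltn_ord l); clear; move: (nat_of_ord l) => i /=; lia.
  apply: le_trans (sum_coef_le G N.+1); rewrite [leRHS]big_ord_recl /=.
  by rewrite lerDr.
have c0 : modc (c 0%N) <= A.
  rewrite /c cmodJ; apply: le_trans (sum_coef_le G 1).
  by rewrite big_ord1.
have GA : modc G.[z] <= A.
  rewrite horner_coef; apply: le_trans (cmod_sum _ _ _) _; apply: ler_sum => k _.
  by rewrite cmodM cmodX ler_piMr // exprn_ile1.
have -> : G.[z] - (0 +i* complex.Im G`_0) -
    ((G.[z] + c 0%N + E) / (1 - z ^+ N.+1) - (G`_0 + c 0%N) / 2) =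
    - (z ^+ N.+1 * (G.[z] + c 0%N) + E) / (1 - z ^+ N.+1).
  have -> : 0 +i* complex.Im G`_0 = (G`_0 - c 0%N) / 2.
    rewrite /c; case: (G`_0) => a b; rewrite -[2]/(2%:R) -[2%:R](rmorph_nat (real_complex R)).
    rewrite -fmorphV; apply/eqP; rewrite eq_complex /=.
    by apply/andP; split; apply/eqP; lra.
  by field.
rewrite cmodf cmodN ler_pdivrMr; last by lra.
apply: le_trans (cmodD _ _) _; rewrite cmodM.
have h1 : modc (z ^+ N.+1) * modc (G.[z] + c 0%N) <= r ^+ q * (2 * A).
  apply: ler_pM => //; apply: le_trans (cmodD _ _) _; lra.
have rq0 : 0 <= r ^+ q by exact: exprn_ge0.
have h2 : r ^+ q * (3 * (A + 1)) <= e * (1 - r).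
  by rewrite -ler_pdivlMr //; lra.
have h3 : e * (1 - r) <= e * modc (1 - z ^+ N.+1) by rewrite ler_wpM2l // ltW.
nra.
Qed.

Lemma circle_at_distance w t : modc w = 1 -> 0 <= t <= 1 ->
  exists2 v, modc v = 1 & modc (v - w) = t.
Proof.
move=> w1 /andP[t0 t1]; pose s := Num.sqrt (1 - t ^+ 2 / 4).
have t2 : t ^+ 2 <= 1 by rewrite expr_le1.
have s2 : s ^+ 2 = 1 - t ^+ 2 / 4 by rewrite sqr_sqrtr //; lra.
(* This is (s + i t / 2)^2, a point of the unit circle at distance t from 1. *)
pose c : R[i] := (1 - t ^+ 2 / 2) +i* (t * s).
exists (w * c).
  rewrite cmodM w1 mul1r; apply/eqP; rewrite -(@eqrXn2 _ 2) // expr1n sqr_cmod /=.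
  by apply/eqP; rewrite exprMn s2; field.
have -> : w * c - w = w * (c - 1) by rewrite mulrBr mulr1.
rewrite cmodM w1 mul1r; apply/eqP; rewrite -(@eqrXn2 _ 2) // sqr_cmod /=.
by apply/eqP; rewrite !subr0 exprMn s2; field.
Qed.

Lemma herglotz_lip w v z r : modc w = 1 -> modc v = 1 -> r < 1 -> modc z <= r ->
  modc (herglotz w z - herglotz v z) <= 2 / (1 - r) ^+ 2 * modc (v - w).
Proof.
move=> w1 v1 r1 zr.
have dist u : modc u = 1 -> 1 - r <= modc (u - z).
  by move=> u1; have := cmod_subl u z; lra.
have d1 := dist w w1; have d2 := dist v v1.
have wz : w - z != 0 by rewrite -cmod_gt0; lra.
have vz : v - z != 0 by rewrite -cmod_gt0; lra.
have -> : herglotz w z - herglotz v z = 2 * z * (v - w) / ((w - z) * (v - z)).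
  by rewrite /herglotz; field; rewrite wz vz.
rewrite cmodf !cmodM cmod_nat mulrAC ler_wpM2r //.
have r2 : 0 < (1 - r) ^+ 2 by rewrite exprn_gt0 // subr_gt0.
have p : (1 - r) ^+ 2 <= modc (w - z) * modc (v - z).
  by rewrite expr2; apply: ler_pM; lra.
have p0 := lt_le_trans r2 p.
have pV : (modc (w - z) * modc (v - z))^-1 <= ((1 - r) ^+ 2)^-1.
  by rewrite lef_pV2 ?posrE.
by apply: ler_pM; rewrite ?mulr_ge0 ?invr_ge0 ?(ltW p0) //; lra.
Qed.

Lemma avoid_null (K : set R[i]) w e : ncover K -> modc w = 1 -> 0 < e ->
  exists v, [/\ modc v = 1, ~ K v & modc (v - w) <= e].
Proof.
move=> nK w1 e0.
have [|t /andP[t0 te] [d d0 Hd]] := @ncover_gap R K w (Num.min 1 e) nK.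
  by rewrite lt_min ltr01.
move: te; rewrite lt_min => /andP[t1 te].
have [|v v1 vw] := @circle_at_distance w t w1; first by rewrite !ltW.
exists v; split => //; last by rewrite vw ltW.
by move=> /Hd; rewrite vw subrr normr0; lra.
Qed.

(** The singular inner function of a single point mass [q.1] at the point [q.2]. *)
Definition atom_val (q : R * R[i]) z : R[i] := cexp (- (q.1%:C * herglotz q.2 z)).
Definition atom_prod (s : seq (R * R[i])) z : R[i] := \prod_(q <- s) atom_val q z.

Lemma atom_prodE s z :
  atom_prod s z = cexp (- \sum_(q <- s) q.1%:C * herglotz q.2 z).
Proof. by rewrite /atom_prod /atom_val -cexp_sum sumrN. Qed.

(** The multiplicative correction of a constant m0 < 1 has modulus below 1 on the closed disc, so it
    is exp (- G) with Re G > 0; these real parts are the masses of the discretization. Discretizing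
    is accurate only inside the disc, hence the values on K are reached on r' K with r' < 1. *)
Lemma singular_block (K : set R[i]) (psi : R[i] -> R[i]) r e :
  compact K -> ncover K -> K `<=` @circle R -> eucont K psi ->
  (forall z, K z -> modc (psi z) <= 1) -> r < 1 -> 0 < e ->
  exists s r', [/\ s != [::],
    forall q, q \in s -> [/\ 0 < q.1, modc q.2 = 1 & ~ K q.2],
    r < r' < 1 /\ 0 < r',
    forall z, modc z <= r -> modc (atom_prod s z - 1) <= e &
    forall z, K z -> modc (atom_prod s (r'%:C * z) - psi z) <= e].
Proof.
move=> cK nK KT upsi psi1 r1 e0.
pose r0 := Num.max r 0.
have r01 : r0 < 1 by rewrite gt_max r1 ltr01.
have r00 : 0 <= r0 by rewrite le_max lexx orbT.
have rr0 : r <= r0 by rewrite le_max lexx.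
clearbody r0.
(* 17 = 12 + 5 collects the errors of [sG] and [near1]; 3 e1 <= 1/2 is the range of validity of
   [cexp_lip]. *)
pose e1 := Num.min (e / 17) (1 / 6).
have e10 : 0 < e1 by rewrite lt_min !divr_gt0.
have e1e : e1 <= e / 17 by rewrite ge_min lexx.
have e16 : e1 <= 1 / 6 by rewrite ge_min lexx orbT.
clearbody e1.
have [m0 m0E] : exists m0, m0 = 1 - e1 by exists (1 - e1).
have m00 : 0 < m0 by lra.
have m01 : m0 < 1 by lra.
have ug : eucont (@cdisc R) (fun=> m0%:C).
  by move=> x x0; exists 1 => // z w _ _ _; rewrite subrr cmod0.
have [|z _|H [H1 [m' m'1 H2] H3]] := @stage R _ _ K (fun=> m0%:C) psi m0 m0 e1 r0
    (correction_mul R) cK nK KT ug m01 m00 _ _ upsi psi1 e10 r01.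
- by move=> z _; rewrite cmod_real gtr0_norm.
- by rewrite cmod_real gtr0_norm.
(* The constant m0 is absorbed into the exponent: exp (- G) = m0 exp (- H). *)
pose G := H - (ln m0)%:C%:P.
have GE z : G.[z] = H.[z] - (ln m0)%:C by rewrite hornerD hornerN hornerC.
have expG z : cexp (- G.[z]) = m0%:C * cexp (- H.[z]).
  by rewrite GE opprB addrC cexpD cexp_real lnK ?posrE // mulrC.
have ReG z : modc z <= 1 -> 0 < complex.Re G.[z].
  move=> /H2; rewrite -expG cmod_cexp => h.
  have : expR (complex.Re (- G.[z])) < 1 by lra.
  by rewrite expR_lt1 ReN oppr_lt0.
have near1 z : modc z <= r -> modc (cexp (- G.[z]) - 1) <= 5 * e1.
  move=> zr; have Hz := H1 z (le_trans zr rr0).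
  have -> : cexp (- G.[z]) - 1 = m0%:C * (cexp (- H.[z]) - 1) + (m0 - 1)%:C.
    by rewrite expG real_complexB rmorph1; ring.
  apply: le_trans (cmodD _ _) _; rewrite (cmodM m0%:C) !cmod_real (gtr0_norm m00).
  rewrite ltr0_norm ?subr_lt0 //.
  have := @cexp_near0 R (- H.[z]); rewrite cmodN => /(_ ltac:(lra)) h.
  have : m0 * modc (cexp (- H.[z]) - 1) <= 1 * (4 * e1).
    by apply: ler_pM => //; try lra.
  by lra.
have uG : eucont (@cdisc R) (fun z => cexp (- G.[z])).
  apply: compact_eucont; first exact: cdisc_compact.
  apply: hasD_econt => z z1; apply: hasD_cexp.
  by apply: (@papprox_hasD _ _ _ 2); [rewrite /cdisc /= in z1; lra|apply/papproxN/papprox_poly].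
have [d d0 dP] := uG e1 e10.
pose r' := 1 - Num.min (d / 2) ((1 - r0) / 2).
have mn0 : 0 < Num.min (d / 2) ((1 - r0) / 2) by rewrite lt_min !divr_gt0 // subr_gt0.
have mnd : Num.min (d / 2) ((1 - r0) / 2) <= d / 2 by rewrite ge_min lexx.
have mnr : Num.min (d / 2) ((1 - r0) / 2) <= (1 - r0) / 2 by rewrite ge_min lexx orbT.
have r'1 : r' < 1 by rewrite /r'; lra.
have r'0 : r0 < r' by rewrite /r'; lra.
have r'd : 1 - r' < d by rewrite /r'; lra.
clearbody r'.
have [|n n0 nP] := @discretize G r' e1 _ e10; first by apply/andP; split; lra.
pose m j := complex.Re G.[root1 R n ^+ j] / n%:R.
have m_gt0 j : 0 < m j.
  by rewrite divr_gt0 ?ltr0n // ReG // cmod_root1X.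
pose B := \sum_(j < n) m j.
have B0 : 0 <= B by apply: sumr_ge0 => j _; exact: ltW.
(* Moving every node by at most eta changes the weighted sum of kernels, of total mass B, by at most
   e1 on |z| <= r'. *)
pose eta := e1 / (B + 1) / (2 / (1 - r') ^+ 2).
have k0 : 0 < 2 / (1 - r') ^+ 2 by rewrite divr_gt0 // exprn_gt0 // subr_gt0.
have eta0 : 0 < eta by rewrite divr_gt0 // divr_gt0 //; lra.
have ch (j : nat) := avoid_null nK (cmod_root1X R n j) eta0.
have {}/choice [v vP] := ch.
pose s := [seq (m j, v j) | j <- index_iota 0 n].
have sE z : modc z <= r' -> modc (\sum_(q <- s) q.1%:C * herglotz q.2 z - G.[z]) <= 3 * e1.
  move=> zr.
  have h1 : modc (\sum_(q <- s) q.1%:C * herglotz q.2 z -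
     \sum_(j < n) (m j)%:C * herglotz (root1 R n ^+ j) z) <= e1.
    rewrite /s big_map big_mkord -sumrB; apply: le_trans (cmod_sum _ _ _) _.
    apply: (@le_trans _ _ (\sum_(j < n) m j * (e1 / (B + 1)))).
      apply: ler_sum => j _; rewrite -mulrBr cmodM cmod_real /= (gtr0_norm (m_gt0 j)).
      rewrite (ler_wpM2l (ltW (m_gt0 j))) // cmodBC.
      have [v1 _ vw] := vP j.
      apply: le_trans (herglotz_lip (cmod_root1X R n j) v1 r'1 zr) _.
      by rewrite mulrC -ler_pdivlMr.
    rewrite -mulr_suml -/B mulrA ler_pdivrMr; last by lra.
    by nra.
  have h2 := nP z zr; rewrite -/(m _) in h2.
  (* G and H differ by a real constant, and H is small at 0 because r0 >= 0. *)
  have h3 : modc (0 +i* complex.Im G`_0) <= e1.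
    apply: le_trans (cmod_leReIm _) _; rewrite /= normr0 add0r.
    have -> : complex.Im G`_0 = complex.Im H.[0].
      by rewrite -horner_coef0 GE ImB /= subr0.
    by apply: le_trans (Im_le_cmod _) _; apply: H1; rewrite cmod0.
  set S := \sum_(q <- s) _ in h1 *; set T := \sum_(j < n) _ in h1 h2.
  have -> : S - G.[z] = (S - T) - (G.[z] - (0 +i* complex.Im G`_0) - T) -
     (0 +i* complex.Im G`_0) by ring.
  apply: le_trans (cmodB _ _) _; apply: le_trans (lerD (cmodB _ _) (lexx _)) _.
  lra.
have sG z : modc z <= r' -> modc (atom_prod s z - cexp (- G.[z])) <= 12 * e1.
  move=> zr; rewrite atom_prodE.
  have ReG0 : complex.Re (- G.[z]) <= 0.
    by rewrite ReN oppr_le0 ltW // ReG //; lra.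
  have := cexp_lip ReG0; rewrite expR0 mulr1.
  move=> /(_ (- \sum_(q <- s) q.1%:C * herglotz q.2 z)); rewrite -opprD cmodN.
  have := sE z zr => h /(_ ltac:(lra)); lra.
exists s, r'; split.
- by rewrite /s; case: (n) n0.
- move=> q /mapP[j _ ->] /=; have [v1 Kv _] := vP j; split => //.
- by split; [apply/andP; split; lra|lra].
- move=> z zr; apply: le_trans (cmod_dist (cexp (- G.[z])) _ _) _.
  have := sG z ltac:(lra); have := near1 z zr; lra.
- move=> z Kz; have z1 : modc z = 1 by exact: KT.
  have rz : modc (r'%:C * z) = r' by rewrite cmodM cmod_real z1 mulr1 gtr0_norm //; lra.
  apply: le_trans (cmod_dist (cexp (- G.[r'%:C * z])) _ _) _.
  have h1 := sG (r'%:C * z) ltac:(lra).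
  have h2 : modc (cexp (- G.[r'%:C * z]) - cexp (- G.[z])) < e1.
    apply: dP; rewrite /cdisc /= -?[cmod _]/(modc _) ?rz ?z1 //; first by lra.
    have -> : r'%:C * z - z = (r' - 1)%:C * z by rewrite real_complexB rmorph1; ring.
    by rewrite cmodM cmod_real z1 mulr1 ltr0_norm; lra.
  have h3 := H3 z Kz; rewrite -expG in h3.
  have := cmod_dist (cexp (- G.[z])) (cexp (- G.[r'%:C * z])) (psi z).
  lra.
Qed.

End Discretization.

(** * Universal functions *)

Section Criterion.
Variable R : realType.
Implicit Types (z w v u : R[i]) (x y e r d m : R).

Lemma econt_within (K : set R[i]) f : econt K f -> {within K, continuous f}.
Proof.
move=> H; apply/subspace_continuousP => z Kz A /nbhs_cmodP[e e0 HA].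
have [d d0 Hd] := H z Kz e e0.
by apply/nbhs_cmodP; exists d => // w wz Kw; apply: HA; exact: Hd.
Qed.

Lemma BC_eucont (K : set R[i]) f : compact K -> BC K f -> eucont K f.
Proof.
by move=> cK [fc _]; apply: compact_eucont => //; exact: within_continuous_econt.
Qed.

Lemma BC_le1 (K : set R[i]) f z : compact K -> BC K f -> K z -> modc (f z) <= 1.
Proof.
move=> cK [/within_continuous_econt fc f1] Kz; apply: le_trans f1.
have [M M0 fM] := compact_bounded_cmod cK fc.
exact: (@norm_on_ge _ _ _ M).
Qed.

Lemma BC_intro (K : set R[i]) f : econt K f ->
  (forall z, K z -> modc (f z) <= 1) -> BC K f.
Proof. by move=> fc f1; split; [exact: econt_within|exact: norm_on_le]. Qed.

Lemma econt_poly (K : set R[i]) (p : {poly R[i]}) : econt K (fun z => p.[z]).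
Proof.
apply: hasD_econt => z _; apply: (@papprox_hasD _ _ _ (modc z + 1)).
  by rewrite ltrDl.
exact: papprox_poly.
Qed.

Definition cpoly_of_rats (s : seq (rat * rat)) : {poly R[i]} :=
  Poly [seq (ratr q.1 : R) +i* ratr q.2 | q <- s].

Lemma rat_near x e : 0 < e -> exists q : rat, `|x - ratr q| <= e.
Proof.
move=> e0; have [q] := @rat_in_itvoo R (x - e) (x + e) ltac:(lra).
rewrite in_itv /= => /andP[q1 q2]; exists q.
by rewrite ler_norml; apply/andP; split; lra.
Qed.

Lemma poly_near_rats (p : {poly R[i]}) e : 0 < e ->
  exists s, forall z, modc z <= 1 -> modc (p.[z] - (cpoly_of_rats s).[z]) <= e.
Proof.
elim/poly_ind: p e => [|p c IH] e e0.
  by exists [::] => z _; rewrite /cpoly_of_rats /= horner0 subrr cmod0 ltW.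
have [|s sP] := IH (e / 2); first lra.
have [|a aP] := @rat_near (complex.Re c) (e / 4); first lra.
have [|b bP] := @rat_near (complex.Im c) (e / 4); first lra.
exists ((a, b) :: s) => z z1.
rewrite /cpoly_of_rats /= horner_cons -/(cpoly_of_rats s) hornerD hornerMX hornerC.
rewrite opprD addrACA -mulrBl; apply: le_trans (cmodD _ _) _; rewrite cmodM.
have h1 : modc (c - (ratr a +i* ratr b)) <= e / 2.
  by apply: le_trans (cmod_leReIm _) _; rewrite ReB ImB /=; lra.
have h2 : modc (p.[z] - (cpoly_of_rats s).[z]) * modc z <= e / 2.
  rewrite -[e / 2]mulr1; apply: ler_pM => //; exact: sP.
lra.
Qed.

(** Step interpolation makes polynomials dense in C(K) for null K, and polynomials with rational
    coefficients are countable. Those exceeding 1 on K are replaced by 0, so that every member is an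
    admissible target. *)
Lemma dense_family (K : set R[i]) : compact K -> ncover K -> K `<=` @circle R ->
  exists psi : nat -> R[i] -> R[i],
  [/\ forall i, BC K (psi i) &
      forall phi e, BC K phi -> 0 < e -> exists i, forall z, K z ->
        modc (psi i z - phi z) <= e].
Proof.
move=> cK nK KT; have K1 z : K z -> modc z = 1 by move=> /KT.
pose p (i : nat) := cpoly_of_rats (odflt [::] (unpickle i)).
pose small i := `[< forall z, K z -> modc (p i).[z] <= 1 >].
pose psi i z := if small i then (p i).[z] else 0.
exists psi; split.
- move=> i; rewrite /psi; case: (boolP (small i)) => [/asboolP h|_].
    by apply: BC_intro h; exact: econt_poly.
  apply: BC_intro => [z _ e e0|z _]; last by rewrite cmod0.
  by exists 1 => // w _ _; rewrite subrr cmod0.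
- move=> phi e bphi e0; have uphi := BC_eucont cK bphi.
  (* The target is shrunk by 1 - 3 e1 because the rational polynomial misses it by up to 3 e1: its
     norm stays at most 1, and the total error is 6 e1. *)
  pose e1 := Num.min (e / 6) (1 / 4).
  have e10 : 0 < e1 by rewrite lt_min !divr_gt0.
  have e1e : e1 <= e / 6 by rewrite ge_min lexx.
  have e14 : e1 <= 1 / 4 by rewrite ge_min lexx orbT.
  have [d d0 dP] := uphi e1 e10.
  have [||s sK /(_ phi e1 e10) [H [_ H2 _]]] := @step_poly R K (d / 2) 0 cK nK KT.
  - by lra.
  - by lra.
  have hphi z : K z -> modc (H.[z] - phi z) <= 2 * e1.
    move=> Kz; have [w [ws zw Hw]] := H2 z Kz.
    apply: le_trans (cmod_dist (phi w) _ _) _.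
    have := dP z w Kz (sK w ws); rewrite cmodBC => /(_ ltac:(lra)); lra.
  have [s' s'P] := @poly_near_rats ((1 - 3 * e1)%:C *: H) e1 e10.
  exists (pickle s').
  have pE : p (pickle s') = cpoly_of_rats s' by rewrite /p pickleK.
  have t0 : 0 <= 1 - 3 * e1 by lra.
  have close z : K z -> modc (phi z) <= 1 /\
      modc ((p (pickle s')).[z] - (1 - 3 * e1)%:C * phi z) <= 3 * e1.
    move=> Kz; split; first exact: (@BC_le1 K).
    apply: le_trans (cmod_dist ((1 - 3 * e1)%:C * H.[z]) _ _) _.
    have := s'P z; rewrite K1 // lexx hornerZ pE cmodBC => /(_ isT).
    rewrite -mulrBr cmodM cmod_real (ger0_norm t0).
    have := ler_wpM2l t0 (hphi z Kz); nra.
  have sm : small (pickle s').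
    apply/asboolP => z /close[h1 h2].
    have := cmod_subl (p (pickle s')).[z] ((1 - 3 * e1)%:C * phi z).
    have : modc ((1 - 3 * e1)%:C * phi z) <= 1 - 3 * e1.
      by rewrite cmodM cmod_real (ger0_norm t0); nra.
    lra.
  move=> z Kz; rewrite /psi sm; have [h1 h2] := close z Kz.
  apply: le_trans (cmod_dist ((1 - 3 * e1)%:C * phi z) _ _) _.
  have -> : (1 - 3 * e1)%:C * phi z - phi z = - ((3 * e1)%:C * phi z).
    by rewrite real_complexB rmorph1; ring.
  have : modc ((3 * e1)%:C * phi z) <= 3 * e1.
    by rewrite cmodM cmod_real gtr0_norm ?ler_piMr //; lra.
  by rewrite cmodN; lra.
Qed.

(** Each target is approached by some phi n with n beyond any given N, so a subsequence of the
    radii, still tending to 1, serves it. *)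
Lemma calU_intro (K : set R[i]) f (phi : nat -> R[i] -> R[i]) (r del : nat -> R) :
  compact K -> calB R f ->
  (forall n, 0 < r n < 1) -> r @ \oo --> (1 : R) -> del @ \oo --> (0 : R) ->
  (forall n z, K z -> modc (f ((r n)%:C * z) - phi n z) <= del n) ->
  (forall psi e N, BC K psi -> 0 < e -> exists2 n, (N <= n)%N &
     forall z, K z -> modc (phi n z - psi z) <= e) ->
  calU K f.
Proof.
move=> cK fB r01 r1 del0 close dense; split => // psi bpsi.
have ch (k : nat) : exists n, (k <= n)%N /\
    forall z, K z -> modc (phi n z - psi z) <= k.+1%:R^-1.
  by have [|n kn H] := dense psi k.+1%:R^-1 k bpsi; [rewrite invr_gt0 ltr0n|exists n].
have {}/choice [n nP] := ch.
exists (r \o n); split.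
- by move=> k; exact: r01.
- apply/cvg_realP => e e0; move/cvg_realP : r1 => /(_ e e0) [N NP].
  by exists N => k Nk; apply: NP; apply: leq_trans Nk _; case: (nP k).
- apply/cvg_realP => e e0.
  move/cvg_realP : del0 => /(_ (e / 3)) [|N1 H1]; first lra.
  have [N2 H2] : exists N, forall k, (N <= k)%N -> k.+1%:R^-1 <= e / 3.
    exists (Num.truncn (e / 3)^-1) => k Nk; rewrite -[leRHS]invrK.
    rewrite lef_pV2 ?posrE ?invr_gt0 ?divr_gt0 ?ltr0n //.
    by apply: ltW; apply: lt_le_trans (truncnS_gt _) _; rewrite ler_nat.
  exists (maxn N1 N2) => k; rewrite geq_max => /andP[k1 k2].
  rewrite subr0 ger0_norm ?norm_on_ge0 //.
  apply: (@le_lt_trans _ _ (e / 3 + e / 3)); last lra.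
  apply: norm_on_le => [|z Kz]; first lra.
  have [kn Hn] := nP k; rewrite /dilate /=.
  apply: le_trans (cmod_dist (phi (n k) z) _ _) _; apply: lerD.
    apply: le_trans (close _ _ Kz) _.
    have := H1 (n k) (leq_trans k1 kn); rewrite subr0 => /ltW.
    by apply: le_trans; exact: ler_norm.
  by apply: le_trans (Hn z Kz) _; exact: H2.
Qed.

Lemma half_expn_cvg0 (c : R) : (fun n => c * 2^-1 ^+ n) @ \oo --> (0 : R).
Proof.
rewrite -(mulr0 c); apply: cvgMl_tmp; apply: cvg_expr.
by rewrite ger0_norm // invf_lt1 // ltr1n.
Qed.

Lemma tele_limit (u : nat -> R[i] -> R[i]) (r : nat -> R) e0 : 0 < e0 ->
  (forall n, r n <= r n.+1) -> (forall n, 1 - 2^-1 ^+ n <= r n) ->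
  (forall n z, modc z <= r n -> modc (u n.+1 z - u n z) <= e0 * 2^-1 ^+ n.+1) ->
  exists f : R[i] -> R[i],
    (forall n z, modc z <= r n -> modc (f z - u n z) <= e0 * 2^-1 ^+ n).
Proof.
move=> e00 rS r1 du.
have em_ge0 n : 0 <= e0 * 2^-1 ^+ n by rewrite mulr_ge0 ?exprn_ge0 ?invr_ge0 ?(ltW e00).
have em2 n : e0 * 2^-1 ^+ n = e0 * 2^-1 ^+ n.+1 + e0 * 2^-1 ^+ n.+1.
  by rewrite exprS; lra.
have rmono n k : r n <= r (n + k)%N.
  elim: k => [|k IH]; first by rewrite addn0.
  by rewrite addnS; exact: le_trans IH (rS _).
have tele n k z : modc z <= r n ->
    modc (u (n + k)%N z - u n z) <= e0 * 2^-1 ^+ n - e0 * 2^-1 ^+ (n + k).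
  move=> zr; elim: k => [|k IH]; first by rewrite addn0 !subrr cmod0.
  rewrite addnS; apply: le_trans (cmod_dist (u (n + k)%N z) _ _) _.
  have := du (n + k)%N z (le_trans zr (rmono n k)).
  by move: IH; rewrite (em2 (n + k)%N); lra.
(* Outside all the controlled discs the value 0 is a placeholder. *)
have lim z : exists l : R[i], (exists n, modc z <= r n) ->
    (fun n => u n z) @ \oo --> l.
  have [[N zN]|?] := pselect (exists n, modc z <= r n); last by exists 0.
  have [|l Hl] := @cauchy_cmod R (fun n => u n z); last by exists l.
  move=> e e0'; have /cvg_realP/(_ e e0') [M HM] := half_expn_cvg0 e0.
  pose n := maxn N M; exists n => k nk.
  have zn : modc z <= r n.
    by rewrite /n -(subnKC (leq_maxl N M)); exact: le_trans zN (rmono _ _).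
  have := tele n (k - n)%N z zn; rewrite subnKC //.
  have := HM n (leq_maxr _ _); rewrite subr0 ger0_norm //.
  have := em_ge0 k; lra.
have {}/choice [f fP] := lim.
exists f => n z zr; apply/ler_addgt0Pr => e e0'.
have /cvg_cmodP/(_ e e0') [M HM] := fP z (ex_intro _ n zr).
pose k := maxn M n; have := HM k (leq_maxl _ _); rewrite (cmodBC (u k z)) => h.
have := tele n (k - n)%N z zr; rewrite subnKC ?leq_maxr //.
have := em_ge0 k; have := cmod_dist (u k z) (f z) (u n z); lra.
Qed.

(* Each step hits the next target on a circle of radius larger than all
   previous ones, changing little on the disc already controlled. *)
Lemma scheme (X : Type) (F : X -> R[i] -> R[i]) (P : X -> Prop) (K : set R[i])
    (phi : nat -> R[i] -> R[i]) (Q : R -> R -> X -> X -> Prop) :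
  (forall z, K z -> modc z <= 1) ->
  (forall (x : X) n r e, P x -> r < 1 -> 0 < e -> exists (x' : X) (t : R),
     [/\ P x', Q r e x x', r < t < 1,
       forall z, modc z <= r -> modc (F x' z - F x z) <= e &
       forall z, K z -> modc (F x' (t%:C * z) - phi n z) <= e]) ->
  forall (x0 : X) r0 e0, P x0 -> r0 < 1 -> 0 < e0 ->
  exists (x : nat -> X) (r t : nat -> R) (f : R[i] -> R[i]),
  [/\ x 0%N = x0 /\ r0 <= r 0%N,
      forall n, P (x n) /\ Q (r n) (e0 * 2^-1 ^+ n.+1) (x n) (x n.+1),
      forall n, [/\ 0 < r n < 1, 1 - 2^-1 ^+ n <= r n & r n < t n <= r n.+1],
      forall n z, modc z <= r n -> modc (f z - F (x n) z) <= e0 * 2^-1 ^+ n &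
      forall n z, K z -> modc (f ((t n)%:C * z) - phi n z) <= e0 * 2^-1 ^+ n].
Proof.
move=> K1 step x0 r0 e0 Px0 r01 e00.
(* One half of e0 2^-n pays for hitting the n-th target, the other for all later changes. *)
pose em n : R := e0 * 2^-1 ^+ n.+1.
have em0 n : 0 < em n by rewrite mulr_gt0 // exprn_gt0 // invr_gt0.
have em2 n : em n + em n = e0 * 2^-1 ^+ n by rewrite /em exprS; lra.
(* Raises a radius to at least 1/2, for positivity, and to at least 1 - 2^-n, for convergence to
   1. *)
pose lo n (r : R) := Num.max r (Num.max 2^-1 (1 - 2^-1 ^+ n)).
have lo1 n r : r < 1 -> lo n r < 1.
  move=> r1; rewrite /lo !gt_max r1 /= ltrBlDr ltrDl exprn_gt0 ?invr_gt0 // andbT.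
  by rewrite invf_lt1 // ltr1n.
have lor n r : r <= lo n r by rewrite /lo le_max lexx.
have lo2 n r : 2^-1 <= lo n r by rewrite /lo !le_max lexx orbT.
have lo3 n r : 1 - 2^-1 ^+ n <= lo n r by rewrite /lo !le_max lexx !orbT.
(* The state holds the index, the object and the radius; the invariants are premises inside the
   existential, so that the choice function is total. *)
have ch (s : nat * (X * R)) : exists s' : X * R, P s.2.1 -> s.2.2 < 1 ->
    [/\ P s'.1, Q s.2.2 (em s.1) s.2.1 s'.1, s.2.2 < s'.2 < 1,
      forall z, modc z <= s.2.2 -> modc (F s'.1 z - F s.2.1 z) <= em s.1 &
      forall z, K z -> modc (F s'.1 ((s'.2)%:C * z) - phi s.1 z) <= em s.1].
  have [Px|?] := pselect (P s.2.1); last by exists s.2.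
  have [r1|?] := boolP (s.2.2 < 1); last by exists s.2.
  by have [x' [t xt]] := step s.2.1 s.1 s.2.2 (em s.1) Px r1 (em0 _); exists (x', t).
have {}/choice [nx nxP] := ch.
pose st := fix st n : X * R := if n is n'.+1 then
  let s' := nx (n', st n') in (s'.1, lo n s'.2) else (x0, lo 0%N r0).
have stP n : P (st n).1 /\ (st n).2 < 1.
  elim: n => [|n [IH1 IH2]] /=; first by split => //; exact: lo1.
  have [? _ /andP[_ ?] _ _] := nxP (n, st n) IH1 IH2.
  by split => //; exact: lo1.
have nP n := nxP (n, st n) (stP n).1 (stP n).2.
pose x n := (st n).1; pose r n := (st n).2; pose t n := (nx (n, st n)).2.
have xS n : (nx (n, st n)).1 = x n.+1 by [].
have rt n : r n < t n <= r n.+1.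
  by have [_ _ /andP[h _] _ _] := nP n; rewrite {1}/r h /= /r /= lor.
have rS n : r n <= r n.+1 by have /andP[h1 h2] := rt n; exact: le_trans (ltW h1) h2.
have dF n z : modc z <= r n -> modc (F (x n.+1) z - F (x n) z) <= em n.
  by have [_ _ _ + _] := nP n; apply.
have r_lt1 n : r n < 1 by exact: (stP n).2.
have [|f fF] := @tele_limit (fun n => F (x n)) r e0 e00 rS _ dF.
- by move=> n; rewrite /r; case: (n) => [|k]; exact: lo3.
exists x, r, t, f; split => //.
- by split => //; rewrite /r /= lor.
- move=> n; split; first by have [] := stP n.
  by have [_ h _ _ _] := nP n.
- move=> n; have rn := rt n; split => //.
  + rewrite r_lt1 andbT; apply: lt_le_trans (_ : 2^-1 <= _); first by rewrite invr_gt0.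
    by rewrite /r; case: (n) => [|k] /=; exact: lo2.
  + by rewrite /r; case: (n) => [|k]; exact: lo3.
- move=> n z Kz; have [_ _ /andP[_ t1] _ /(_ z Kz)] := nP n.
  rewrite -/(t n) /= xS => h.
  have /andP[rtn tr] := rt n.
  have t0 : 0 <= t n.
    apply: le_trans (ltW rtn); apply: le_trans (_ : 2^-1 <= _); first by rewrite invr_ge0.
    by rewrite /r; case: (n) => [|k] /=; exact: lo2.
  have := fF n.+1 ((t n)%:C * z); rewrite cmodM cmod_real ger0_norm // => H.
  have {}H : modc (f ((t n)%:C * z) - F (x n.+1) ((t n)%:C * z)) <= em n.
    apply: H; apply: le_trans tr; rewrite ler_piMr //; exact: K1.
  by rewrite -em2; apply: le_trans (cmod_dist (F (x n.+1) ((t n)%:C * z)) _ _) _; lra.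
Qed.

End Criterion.

(** * Density of U_K by iterated corrections *)

Section Density.
Variable R : realType.
Implicit Types (z w v u : R[i]) (x y e r d m : R).

Lemma tele_papprox (u : nat -> {poly R[i]}) (r : nat -> R) (f : R[i] -> R[i]) e0 :
  0 < e0 -> (forall n, r n <= r n.+1) -> (forall n, 1 - 2^-1 ^+ n <= r n) ->
  (forall n z, modc z <= r n -> modc (f z - (u n).[z]) <= e0 * 2^-1 ^+ n) ->
  forall z, modc z < 1 -> hasD f z.
Proof.
move=> e00 rS r1 fu z z1; pose s := (modc z + 1) / 2.
have rmono n k : r n <= r (n + k)%N.
  elim: k => [|k IH]; first by rewrite addn0.
  by rewrite addnS; exact: le_trans IH (rS _).
apply: (@papprox_hasD _ _ _ s); first by rewrite /s; lra.
move=> e e1; have /cvg_realP/(_ e e1) [M HM] := @half_expn_cvg0 R e0.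
have [||N HN] := @exp_small R 2^-1 (1 - s).
- by apply/andP; split; lra.
- by rewrite /s; lra.
pose n := maxn M N; exists (u n) => w ws.
apply: le_trans (fu n w _) _.
  apply: le_trans ws _; rewrite /n -(subnKC (leq_maxr M N)).
  by apply: le_trans (rmono _ _); have := r1 N; lra.
have := HM n (leq_maxl _ _); rewrite subr0 => h.
by apply: le_trans (ler_norm _) (ltW h).
Qed.

Lemma econt_hasD_dilate (f : R[i] -> R[i]) r : 0 <= r < 1 ->
  (forall z, modc z < 1 -> hasD f z) -> eucont (@cdisc R) (dilate r f).
Proof.
move=> /andP[r0 r1] fD; apply: compact_eucont; first exact: cdisc_compact.
apply: hasD_econt => z z1; apply: hasD_dilate; apply: fD.
rewrite cmodM cmod_real ger0_norm //; apply: le_lt_trans r1.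
by rewrite ler_piMr.
Qed.

Lemma dilate_close (f : R[i] -> R[i]) r0 e : r0 < 1 -> 0 < e ->
  (forall z, modc z < 1 -> hasD f z) ->
  exists2 r, 0 < r < 1 & forall z, modc z <= r0 -> modc (f (r%:C * z) - f z) <= e.
Proof.
(* With s strictly between r0 and 1, z = s u turns the claim into uniform continuity of u -> f (s u)
   on the closed disc. *)
move=> r01 e0 fD; pose s := (Num.max r0 0 + 1) / 2.
have [m0 m1] : 0 <= Num.max r0 0 /\ Num.max r0 0 < 1.
  by rewrite le_max lexx orbT gt_max r01 ltr01.
have mr : r0 <= Num.max r0 0 by rewrite le_max lexx.
have s0 : 0 < s by rewrite /s; lra.
have s1 : s < 1 by rewrite /s; lra.
have rs : r0 <= s by rewrite /s; lra.
have uf : eucont (@cdisc R) (dilate s f).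
  by apply: econt_hasD_dilate => //; apply/andP; split; lra.
have [d d0 dP] := uf e e0.
pose r := 1 - Num.min (d / 2) (1 / 2).
have h1 : 0 < Num.min (d / 2) (1 / 2) by rewrite lt_min !divr_gt0.
have h2 : Num.min (d / 2) (1 / 2) <= d / 2 by rewrite ge_min lexx.
have h3 : Num.min (d / 2) (1 / 2) <= 1 / 2 by rewrite ge_min lexx orbT.
have rr : 0 < r < 1 by rewrite /r; apply/andP; split; lra.
have rd : 1 - r < d by rewrite /r; lra.
clearbody r; have /andP[r00 r11] := rr; exists r => // z zr.
pose u := (s^-1)%:C * z.
have sC : s%:C != 0 by rewrite -cmod_gt0 cmod_real gtr0_norm.
have zE : z = s%:C * u by rewrite /u real_complexV mulrA divff // mul1r.
have u1 : modc u <= 1.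
  rewrite /u cmodM cmod_real gtr0_norm ?invr_gt0 // mulrC ler_pdivrMr // mul1r.
  exact: le_trans rs.
have := dP u (r%:C * u); rewrite /dilate /cdisc /= => H; apply: ltW.
rewrite zE mulrCA; apply: H => //.
  apply: le_trans (_ : modc (r%:C * u) <= 1); first by [].
  by rewrite cmodM cmod_real gtr0_norm // mulr_ile1 // ltW.
have -> : r%:C * u - u = (r - 1)%:C * u by rewrite real_complexB rmorph1; ring.
rewrite cmodM cmod_real ltr0_norm; last by lra.
apply: le_lt_trans (_ : - (r - 1) * 1 < _); last by lra.
by rewrite ler_wpM2l //; lra.
Qed.

Lemma radial_close (g : R[i] -> R[i]) e : eucont (@cdisc R) g -> 0 < e ->
  exists2 r, r < 1 & forall t z, r < t < 1 -> modc z = 1 ->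
    modc (g (t%:C * z) - g z) <= e.
Proof.
move=> ug e0; have [d d0 dP] := ug e e0.
exists (Num.max 0 (1 - d)); first by rewrite gt_max; apply/andP; split; lra.
move=> t z; rewrite gt_max => /andP[/andP[t0 td] t1] z1.
have tz : modc (t%:C * z) = t by rewrite cmodM cmod_real z1 mulr1 gtr0_norm.
apply: ltW; apply: dP.
- by rewrite /cdisc /= z1.
- by rewrite /cdisc /= tz; lra.
- have -> : t%:C * z - z = (t - 1)%:C * z by rewrite real_complexB rmorph1; ring.
  by rewrite cmodM cmod_real z1 mulr1 ltr0_norm; lra.
Qed.

Lemma papprox_eucont f : papprox 1 f -> eucont (@cdisc R) f.
Proof.
move=> af; apply: compact_eucont; first exact: cdisc_compact.
move=> z z1 e e0; have [|p pP] := af (e / 4); first lra.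
have [|d d0 dP] := @econt_poly R (@cdisc R) p z z1 (e / 4); first lra.
exists d => // w w1 wz; have h := dP w w1 wz.
have := pP z z1; have := pP w w1; rewrite (cmodBC (f z)).
have := cmod_dist p.[z] p.[w] (f z).
have := cmod_dist p.[w] (f w) (f z); lra.
Qed.

(** By [correctionD] successive corrections add up to one polynomial V n, so the limit has the form
    op g W with W a limit of polynomials. This is what makes f differentiable and, in the
    multiplicative case, zero-free. *)
Lemma correction_scheme (op : R[i] -> R[i] -> R[i]) low (K : set R[i])
    (g : R[i] -> R[i]) (phi : nat -> R[i] -> R[i]) m k r0 e0 :
  correction op low -> compact K -> ncover K -> K `<=` @circle R ->
  eucont (@cdisc R) g -> m < 1 -> 0 < k ->
  (forall z, modc z <= 1 -> modc (g z) <= m) ->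
  (forall z, modc z <= 1 -> k <= low (g z)) ->
  (forall n, BC K (phi n)) -> r0 < 1 -> 0 < e0 ->
  exists (W f : R[i] -> R[i]) (t : nat -> R),
  [/\ forall z, modc z < 1 -> hasD W z /\ f z = op (g z) (W z),
      forall z, modc z < 1 -> modc (f z) <= 1,
      forall z, modc z <= r0 -> modc (f z - g z) <= e0,
      forall n, 0 < t n < 1 /\ 1 - 2^-1 ^+ n <= t n &
      forall n z, K z -> modc (f ((t n)%:C * z) - phi n z) <= e0 * 2^-1 ^+ n].
Proof.
move=> cop cK nK KT ug m1 k0 gm gk bphi r01 e00.
have K1 z : K z -> modc z = 1 by move=> /KT.
have [op0 opD opU _ opL] := cop.
pose F (V : {poly R[i]}) z := op (g z) V.[z].
pose P V := exists2 m', m' < 1 & forall z, modc z <= 1 -> modc (F V z) <= m'.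
pose Q r e (V V' : {poly R[i]}) := forall z, modc z <= r -> modc (V'.[z] - V.[z]) <= e.
have P0 : P 0 by exists m => // z z1; rewrite /F horner0 op0 gm.
have uF V : eucont (@cdisc R) (F V).
  have [M M0 VM] := horner_bound V 1.
  have uV : eucont (@cdisc R) (fun z => V.[z]).
    by apply: compact_eucont (@econt_poly R _ V); exact: cdisc_compact.
  move=> e e1; have [|d d0 dP] := opU M (e / 2); first lra.
  have [d1 d10 d1P] := ug d d0; have [d2 d20 d2P] := uV d d0.
  exists (Num.min d1 d2) => [|z w z1 w1]; first by rewrite lt_min d10.
  rewrite lt_min => /andP[zw1 zw2].
  apply: le_lt_trans (_ : e / 2 < e); last lra.
  have z1' : modc z <= 1 := z1; have w1' : modc w <= 1 := w1.
  apply: dP; rewrite ?VM //; try (by apply: le_trans (gm _ _) (ltW m1)).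
  - by apply/ltW/d1P.
  - by apply/ltW/d2P.
have step (V : {poly R[i]}) n r e : P V -> r < 1 -> 0 < e ->
  exists (V' : {poly R[i]}) (t : R), [/\ P V', Q r e V V', r < t < 1,
     forall z, modc z <= r -> modc (F V' z - F V z) <= e &
     forall z, K z -> modc (F V' (t%:C * z) - phi n z) <= e].
  move=> [m' m'1 Fm'] r1 e1.
  have [M M0 VM] := horner_bound V 1.
  (* The lower bound may deteriorate from stage to stage, but a finite stage only has a bounded V,
     so it remains positive. *)
  have [k' k'0 k'P] := opL k M k0.
  have [d d0 dP] := opU 1 e e1.
  pose e' := Num.min (Num.min 1 d) (e / 2).
  have e'0 : 0 < e' by rewrite !lt_min ltr01 d0 divr_gt0.
  have e'1 : e' <= 1 by rewrite !ge_min lexx.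
  have e'd : e' <= d by rewrite !ge_min lexx orbT.
  have e'e : e' <= e / 2 by rewrite !ge_min lexx orbT.
  clearbody e'.
  have [||H [H1 H2 H3]] := @stage R op low K (F V) (phi n) m' k' e' r cop cK nK KT
     (uF V) m'1 k'0 Fm' _ (BC_eucont cK (bphi n)) _ e'0 r1.
  - by move=> z z1; apply: k'P; [exact: gk|exact: VM].
  - by move=> z; apply: BC_le1 => //; exact: bphi.
  have FE z : F (V + H) z = op (F V z) H.[z] by rewrite /F opD hornerD.
  (* The target is met on K itself; uniform continuity carries this to t K for t close to 1. *)
  have [|r' r'1 tP'] := @radial_close (F (V + H)) (e / 2) (uF _); first lra.
  have [t rt tP] : exists2 t, r < t < 1 & forall z, modc z = 1 ->
      modc (F (V + H) (t%:C * z) - F (V + H) z) <= e / 2.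
    have mr : r <= Num.max r r' by rewrite le_max lexx.
    have mr' : r' <= Num.max r r' by rewrite le_max lexx orbT.
    have mx1 : Num.max r r' < 1 by rewrite gt_max r1.
    exists ((Num.max r r' + 1) / 2); first by apply/andP; split; lra.
    by move=> z; apply: tP'; apply/andP; split; lra.
  exists (V + H), t; split => //.
  - by case: H2 => m2 m21 H2; exists m2 => // z z1; rewrite FE H2.
  - move=> z zr; rewrite hornerD addrAC subrr add0r.
    by have := H1 z zr; lra.
  - move=> z zr; have Hz := H1 z zr; rewrite FE -[X in _ - X]op0.
    have FV : modc (F V z) <= 1 by have := Fm' z; lra.
    apply: dP; rewrite ?subrr ?subr0 ?cmod0 //.
    + exact: le_trans e'1.
    + exact: ltW.
    + exact: le_trans e'd.
  - move=> z Kz; have z1 := K1 z Kz.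
    apply: le_trans (cmod_dist (F (V + H) z) _ _) _.
    have := tP z z1; have := H3 z Kz; rewrite -FE; lra.
have [|V [r [t [f [[V0 r0r] PQ rt fF ft]]]]] :=
  @scheme R _ F P K phi Q _ step 0 r0 e0 P0 r01 e00.
  by move=> z /K1 ->.
have rS n : r n <= r n.+1.
  by have [_ _ /andP[h1 h2]] := rt n; exact: le_trans (ltW h1) h2.
have r1 n : 1 - 2^-1 ^+ n <= r n by have [] := rt n.
have [|W WV] := @tele_limit R (fun n z => (V n).[z]) r e0 e00 rS r1.
  by move=> n z; have [_] := PQ n; apply.
have f_le1 z : modc z < 1 -> modc (f z) <= 1 /\ f z = op (g z) (W z).
  move=> z1; have z1' := ltW z1.
  have [||N HN] := @exp_small R 2^-1 (1 - modc z).
  - by apply/andP; split; lra.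
  - by lra.
  have zr n : (N <= n)%N -> modc z <= r n.
    move=> Nn; have := r1 n; have : 2^-1 ^+ n <= 2^-1 ^+ N :> R.
      by rewrite ler_wiXn2l // invf_le1 ?ler1n.
    lra.
  have near e : 0 < e -> exists2 n, (N <= n)%N & e0 * 2^-1 ^+ n <= e.
    move=> e1; have /cvg_realP/(_ e e1) [M HM] := @half_expn_cvg0 R e0.
    exists (maxn M N); first exact: leq_maxr.
    have := HM (maxn M N) (leq_maxl _ _); rewrite subr0 => h.
    exact: le_trans (ler_norm _) (ltW h).
  split.
  - apply/ler_addgt0Pr => e e1; have [n Nn ne] := near e e1.
    have := fF n z (zr n Nn); have [[m' m'1 /(_ z z1') Fz] _] := PQ n.
    by have := cmod_subl (f z) (F (V n) z); lra.
  - apply/eqP; rewrite -subr_eq0 -cmod_eq0; apply/eqP; apply: le_anti.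
    rewrite cmod_ge0 andbT; apply/ler_addgt0Pr => e e1; rewrite add0r.
    have [|d d0 dP] := opU (modc (W z) + 1) (e / 2); first lra.
    pose d' := Num.min (Num.min d 1) (e / 2).
    have d'0 : 0 < d' by rewrite !lt_min d0 ltr01 divr_gt0.
    have d'1 : d' <= 1 by rewrite !ge_min lexx orbT.
    have d'd : d' <= d by rewrite !ge_min lexx.
    have d'e : d' <= e / 2 by rewrite !ge_min lexx orbT.
    clearbody d'.
    have [n Nn ne] := near d' d'0.
    have h1 := fF n z (zr n Nn); have h2 := WV n z (zr n Nn).
    have g1 : modc (g z) <= 1 by have := gm z z1'; lra.
    have h3 : modc (F (V n) z - op (g z) (W z)) <= e / 2.
      apply: dP; rewrite ?subrr ?cmod0 //.
      + by have := cmod_subl (V n).[z] (W z); rewrite cmodBC; lra.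
      + by rewrite lerDl.
      + exact: ltW.
      + by rewrite cmodBC; lra.
    apply: le_trans (cmod_dist (F (V n) z) _ _) _; lra.
exists W, f, t; split.
- move=> z z1; split; last by have [] := f_le1 z z1.
  exact: (@tele_papprox V r W e0).
- by move=> z /f_le1[].
- move=> z zr; have := fF 0%N z (le_trans zr r0r).
  by rewrite expr0 mulr1 V0 /F horner0 op0.
- move=> n; have [/andP[a b] c /andP[p q]] := rt n; have [/andP[_ r1'] _ _] := rt n.+1.
  by split; [apply/andP; split|]; lra.
- exact: ft.
Qed.

(** The exponent of 2 in n takes every value infinitely often, so each target recurs beyond every
    index. *)
Definition nrec (psi : nat -> R[i] -> R[i]) (n : nat) := psi (logn 2 n).

Lemma nrec_inf i N : exists2 n, (N <= n)%N & logn 2 n = i.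
Proof.
exists (2 ^ i * (2 * N).+1)%N.
  apply: leq_trans (leq_pmull _ _); last by rewrite expn_gt0.
  by lia.
rewrite lognM ?expn_gt0 // pfactorK // lognE; case: ifP => [/and3P[_ _]|]; last by rewrite addn0.
by rewrite dvdn2 /= oddM.
Qed.

Lemma calU_correction (K : set R[i]) (psi : nat -> R[i] -> R[i]) (t : nat -> R) f e0 :
  compact K -> calB R f ->
  (forall phi e, BC K phi -> 0 < e -> exists i, forall z, K z ->
     modc (psi i z - phi z) <= e) ->
  (forall n, 0 < t n < 1 /\ 1 - 2^-1 ^+ n <= t n) ->
  (forall n z, K z -> modc (f ((t n)%:C * z) - nrec psi n z) <= e0 * 2^-1 ^+ n) ->
  calU K f.
Proof.
move=> cK fB dpsi tP ft.
apply: (@calU_intro R K f (nrec psi) t (fun n => e0 * 2^-1 ^+ n) cK fB) => //.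
- by move=> n; have [] := tP n.
- apply/cvg_realP => e e1; have /cvg_realP/(_ e e1) [M HM] := @half_expn_cvg0 R 1.
  exists M => n Mn; have [/andP[_ t1] t2] := tP n.
  have := HM n Mn; rewrite subr0 mul1r ltr_norml => /andP[_ h].
  by rewrite ltr0_norm ?subr_lt0 //; lra.
- exact: half_expn_cvg0.
- move=> phi e N bphi e1; have [i iP] := dpsi phi e bphi e1.
  by have [n Nn nE] := nrec_inf i N; exists n => //; rewrite /nrec nE.
Qed.

(** The representative of f in [calB], where functions vanish off the disc. *)
Definition cutoff (f : R[i] -> R[i]) z := if modc z < 1 then f z else 0.

Lemma cutoff_calB f : (forall z, modc z < 1 -> hasD f z) ->
  (forall z, modc z < 1 -> modc (f z) <= 1) -> calB R (cutoff f).
Proof.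
move=> fD f1; split; last split.
- move=> z z1; have {}z1 : modc z < 1 := z1; apply: hasD_derivable.
  apply: (@hasD_local _ f _ z (1 - modc z)) (fD z z1); first lra.
  move=> h hz; rewrite /cutoff ifT //.
  by apply: le_lt_trans (cmodD _ _) _; lra.
- by move=> z z1; rewrite /cutoff ifT //; exact: f1.
- by move=> z z1; rewrite /cutoff ifF //; apply/negbTE/negP.
Qed.

Lemma calB_hasD f z : calB R f -> modc z < 1 -> hasD f z.
Proof. by move=> [fD _] z1; apply/derivable_hasD/fD. Qed.

Lemma calB_le1 f z : calB R f -> modc z < 1 -> modc (f z) <= 1.
Proof. by move=> [_ [f1 _]] z1; apply: f1. Qed.

(** Dilating gives uniform continuity on the closed disc, and the factor m < 1 gives the strict
    bound required to start the corrections. *)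
Lemma shrink_dilate f r0 e : calB R f -> r0 < 1 -> 0 < e ->
  exists m r, [/\ 0 < m < 1, 0 < r < 1 &
    forall z, modc z <= r0 -> modc (m%:C * f (r%:C * z) - f z) <= e].
Proof.
move=> fB r01 e0.
have [||r rr rP] := @dilate_close f r0 (e / 2) r01; first lra.
  by move=> z; exact: calB_hasD.
pose m := 1 - Num.min (e / 2) (1 / 2).
have h1 : 0 < Num.min (e / 2) (1 / 2) by rewrite lt_min !divr_gt0.
have h2 : Num.min (e / 2) (1 / 2) <= e / 2 by rewrite ge_min lexx.
have h3 : Num.min (e / 2) (1 / 2) <= 1 / 2 by rewrite ge_min lexx orbT.
exists m, r; split => //; first by rewrite /m; apply/andP; split; lra.
move=> z zr; apply: le_trans (cmod_dist (f (r%:C * z)) _ _) _.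
have -> : m%:C * f (r%:C * z) - f (r%:C * z) = (m - 1)%:C * f (r%:C * z).
  by rewrite (real_complexB m) rmorph1; ring.
have f1 : modc (f (r%:C * z)) <= 1.
  apply: calB_le1 => //; rewrite cmodM cmod_real; case/andP: rr => ra rb.
  rewrite gtr0_norm //; apply: le_lt_trans (_ : modc z < 1); last by lra.
  by rewrite ler_piMl // ltW.
rewrite cmodM cmod_real ltr0_norm; last by rewrite /m; lra.
have : - (m - 1) * modc (f (r%:C * z)) <= e / 2 * 1.
  by apply: ler_pM => //; rewrite /m; lra.
have := rP z zr; lra.
Qed.

Lemma dilate_scaled_le f m r z : calB R f -> 0 < m < 1 -> 0 < r < 1 -> modc z <= 1 ->
  modc (r%:C * z) < 1 /\ modc (m%:C * f (r%:C * z)) <= m.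
Proof.
move=> fB /andP[m0 m1] /andP[ra rb] z1.
have rz : modc (r%:C * z) < 1.
  by rewrite cmodM cmod_real gtr0_norm //; apply: le_lt_trans rb; rewrite ler_piMr // ltW.
split=> //; rewrite cmodM cmod_real gtr0_norm //.
by rewrite ler_piMr ?(ltW m0) // calB_le1.
Qed.

Lemma eucont_dilate_scaled f m r : calB R f -> 0 < m < 1 -> 0 < r < 1 ->
  eucont (@cdisc R) (fun z => m%:C * f (r%:C * z)).
Proof.
move=> fB mm rr; apply: compact_eucont; first exact: cdisc_compact.
apply: hasD_econt => z z1; apply: hasDM; first exact: hasD_cst.
apply: hasD_dilate; apply: calB_hasD => //.
by have [] := dilate_scaled_le fB mm rr z1.
Qed.

Lemma calU_dense_of_correction op low (K : set R[i]) f m r k r0 e0 :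
  correction op low -> compact K -> ncover K -> K `<=` @circle R -> calB R f ->
  0 < m < 1 -> 0 < r < 1 -> 0 < k ->
  (forall z, modc z <= 1 -> k <= low (m%:C * f (r%:C * z))) ->
  (forall (g W : R[i] -> R[i]) z, hasD g z -> hasD W z -> hasD (fun z => op (g z) (W z)) z) ->
  (forall z, modc z <= r0 -> modc (m%:C * f (r%:C * z) - f z) <= e0) ->
  r0 < 1 -> 0 < e0 ->
  exists W h, [/\ calU K h,
    forall z, modc z < 1 -> h z = op (m%:C * f (r%:C * z)) (W z) &
    forall z, modc z <= r0 -> modc (h z - f z) <= 2 * e0].
Proof.
move=> cop cK nK KT fB mm rr k0 kl opH fm r01 e00.
have [psi [bpsi dpsi]] := dense_family cK nK KT.
pose g z := m%:C * f (r%:C * z).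
have gle z : modc z <= 1 -> modc (g z) <= m.
  by move=> z1; have [] := dilate_scaled_le fB mm rr z1.
have [||W [h [t [Wh h1 hg tP ht]]]] := @correction_scheme op low K g (nrec psi) m k r0 e0
  cop cK nK KT (eucont_dilate_scaled fB mm rr) _ k0 gle kl _ r01 e00.
- by case/andP: mm.
- by move=> n; exact: bpsi.
have gD z : modc z < 1 -> hasD g z.
  move=> z1; apply: hasDM; first exact: hasD_cst.
  apply: hasD_dilate; apply: calB_hasD => //.
  by have [] := dilate_scaled_le fB mm rr (ltW z1).
have hD z : modc z < 1 -> hasD h z.
  move=> z1; apply: (@hasD_local _ (fun z => op (g z) (W z)) _ z (1 - modc z)).
  - by lra.
  - move=> v vz; have [|_ <-//] := Wh (z + v).
    by apply: le_lt_trans (cmodD _ _) _; lra.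
  - by apply: opH; [exact: gD|have [] := Wh z z1].
have cut z : modc z < 1 -> cutoff h z = h z by move=> z1; rewrite /cutoff z1.
exists W, (cutoff h); split.
- apply: (@calU_correction K psi t _ e0 cK) => //; first exact: cutoff_calB.
  move=> n z Kz; have zT : modc z = 1 by exact: KT.
  rewrite cut ?ht // cmodM cmod_real zT mulr1; have [/andP[t0 t1] _] := tP n.
  by rewrite gtr0_norm.
- by move=> z z1; rewrite cut //; have [_ ->] := Wh z z1.
- move=> z zr; rewrite cut; last by lra.
  apply: le_trans (cmod_dist (g z) _ _) _.
  by have := hg z zr; have := fm z zr; rewrite /g; lra.
Qed.

Lemma calU_dense_calB (K : set R[i]) f r0 e0 :
  compact K -> ncover K -> K `<=` @circle R -> calB R f -> r0 < 1 -> 0 < e0 ->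
  exists2 h, calU K h & forall z, modc z <= r0 -> modc (h z - f z) <= e0.
Proof.
move=> cK nK KT fB r01 e00.
have e2 : 0 < e0 / 2 by lra.
have [m [r [mm rr mr]]] := shrink_dilate fB r01 e2.
have [||W [h [Uh _ hf]]] := calU_dense_of_correction (correction_add R) cK nK KT fB
  mm rr ltr01 _ _ mr r01 e2.
- by [].
- by move=> g W z; exact: hasDD.
by exists h => // z zr; apply: le_trans (hf z zr) _; lra.
Qed.

Lemma econt_inv (A : set R[i]) f : econt A f -> (forall z, A z -> f z != 0) ->
  econt A (fun z => (f z)^-1).
Proof.
move=> fc f0 z Az e e0; have fz := f0 z Az; have m0 : 0 < modc (f z) by rewrite cmod_gt0.
have [|d d0 dP] := fc z Az (Num.min (modc (f z) / 2) (e * modc (f z) ^+ 2 / 2)).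
  by rewrite lt_min !divr_gt0 // mulr_gt0 // exprn_gt0.
exists d => // w Aw wz; have := dP w Aw wz; rewrite lt_min => /andP[h1 h2].
have fw := f0 w Aw.
have fwm : modc (f z) / 2 <= modc (f w).
  by have := cmod_subl (f z) (f w); rewrite cmodBC; lra.
have -> : (f w)^-1 - (f z)^-1 = - (f w - f z) / (f w * f z).
  by field; rewrite fw fz.
rewrite cmodf cmodN cmodM ltr_pdivrMr ?mulr_gt0 ?cmod_gt0 //.
apply: lt_le_trans h2 _.
have -> : e * modc (f z) ^+ 2 / 2 = e * (modc (f z) / 2 * modc (f z)) by field.
by rewrite ler_wpM2l ?(ltW e0) // ler_wpM2r.
Qed.

Lemma calU_dense_calS (K : set R[i]) f r0 e0 :
  compact K -> ncover K -> K `<=` @circle R -> calS R f -> r0 < 1 -> 0 < e0 ->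
  exists2 h, calU K h /\ calS R h &
    forall z, modc z <= r0 -> modc (h z - f z) <= e0.
Proof.
move=> cK nK KT [fB f0] r01 e00.
have e2 : 0 < e0 / 2 by lra.
have [m [r [mm rr mr]]] := shrink_dilate fB r01 e2.
have m0 : m%:C != 0.
  by rewrite -cmod_gt0 cmod_real normr_gt0 gt_eqF //; case/andP: mm.
pose g z := m%:C * f (r%:C * z).
have g0 z : modc z <= 1 -> g z != 0.
  move=> z1; rewrite mulf_neq0 //; apply: f0.
  by have [] := dilate_scaled_le fB mm rr z1.
have gc : econt (@cdisc R) g.
  apply: hasD_econt => z z1; apply: hasDM; first exact: hasD_cst.
  apply: hasD_dilate; apply: calB_hasD => //.
  by have [] := dilate_scaled_le fB mm rr z1.
(* A bound for 1 / g on the closed disc yields the lower bound 1 / M for |g|. *)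
have [M M0 gM] : exists2 M, 0 < M & forall z, (@cdisc R) z -> modc (g z)^-1 <= M.
  by apply: compact_bounded_cmod (econt_inv gc g0); exact: cdisc_compact.
have k0 : 0 < M^-1 by rewrite invr_gt0.
have [||W [h [Uh hE hf]]] := calU_dense_of_correction (correction_mul R) cK nK KT fB
  mm rr k0 _ _ mr r01 e2.
- move=> z z1; have := gM z z1; rewrite cmodV => h.
  rewrite -[leRHS]invrK lef_pV2 ?posrE // invr_gt0 cmod_gt0; exact: g0.
- move=> u W z uD WD; apply: hasDM => //; apply: hasD_cexp.
  apply: (@hasD_local _ (fun z => -1 * W z) _ z 1 ltr01) => [v _|].
    by rewrite mulN1r.
  by apply: hasDM WD; exact: hasD_cst.
exists h; last by move=> z zr; apply: le_trans (hf z zr) _; lra.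
split=> //; split; first by case: Uh.
move=> z z1; rewrite hE // mulf_neq0 ?cexp_neq0 //; apply: g0; exact: ltW.
Qed.

End Density.

(** * Density and the G-delta property *)

Section Topology.
Variable R : realType.
Implicit Types (z w v : R[i]) (x y e r d : R).

Lemma compact_in_disc (A : set R[i]) : disc_compacts R A ->
  exists2 r, r < 1 & forall z, A z -> modc z <= r.
Proof.
move=> [cA Ad]; have A1 z : A z -> modc z < 1 by move=> /Ad.
have [|s [sA cov]] := @compact_fin_cover R A (fun z => (1 - modc z) / 2) cA.
  by move=> z /A1; lra.
have [|m m0 mP] := @seq_min_gt0 R _ s (fun z => (1 - modc z) / 2).
  by move=> z /sA/A1; lra.
exists (1 - m) => [|z Az]; first lra.
have [w ws zw] := cov z Az; have := mP w ws; have := cmod_subl z w; lra.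
Qed.

Lemma locunif_nbhs (A : set R[i]) e (f : locunif R) : disc_compacts R A -> 0 < e ->
  nbhs f [set g : locunif R | forall z, A z -> modc (g z - f z) < e].
Proof.
move=> cA e0; have ec : 0 < e%:C by rewrite ltcR.
have := @fam_nbhs _ _ (disc_compacts R) A _ f (entourage_ball R[i] (PosNum ec)) cA.
apply: filterS => g /= H z Az; have := H z Az.
by rewrite -ball_normE /ball_ /= distrC normr_cmod ltcR.
Qed.

Lemma locunif_cvg (f : locunif R) (h : nat -> locunif R) :
  (forall n z, modc z <= 1 - n.+1%:R^-1 -> modc (h n z - f z) <= n.+1%:R^-1) ->
  h @ \oo --> f.
Proof.
move=> hf; apply/(fam_cvgP (disc_compacts R)) => A cA Q /uniform_nbhs [E [entE EQ]].
have [r r1 Ar] := compact_in_disc cA.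
move: entE; rewrite -entourage_ballE => -[e /= e0 eE].
have er0 : 0 < complex.Re e by move: e0; rewrite ltcE /= => /andP[].
have eE' : e = (complex.Re e)%:C.
  by move: e0; rewrite ltcE /=; case: (e) => a b /= /andP[/eqP -> _].
pose d := Num.min (1 - r) (complex.Re e / 2).
have d0 : 0 < d by rewrite lt_min subr_gt0 r1 divr_gt0.
exists (Num.truncn d^-1) => // n /= Nn; apply: EQ => z Az; apply: eE => /=.
have nd : n.+1%:R^-1 < d.
  rewrite -[ltRHS]invrK ltf_pV2 ?posrE ?invr_gt0 ?ltr0n //.
  by apply: lt_le_trans (truncnS_gt _) _; rewrite ler_nat.
rewrite -ball_normE /ball_ /= distrC normr_cmod eE' ltcR.
move: nd; rewrite lt_min; move: (hf n z); move: (n.+1%:R^-1) => t hfz /andP[t1 t2].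
apply: le_lt_trans (hfz _) _; last by lra.
by apply: le_trans (Ar z Az) _; lra.
Qed.

Lemma calU_dense (K : set R[i]) (A : set (R[i] -> R[i])) :
  (forall f r e, A f -> r < 1 -> 0 < e ->
     exists2 h, calU K h /\ A h & forall z, modc z <= r -> modc (h z - f z) <= e) ->
  dense [set f : set_type (A : set (locunif R)) | calU K (set_val f)].
Proof.
move=> H V [f Vf] [V' oV' VE].
have Af : A (set_val f) by exact: set_valP.
have ch (n : nat) : exists h, (calU K h /\ A h) /\
    forall z, modc z <= 1 - n.+1%:R^-1 -> modc (h z - set_val f z) <= n.+1%:R^-1.
  have [||h hA hf] := H (set_val f) (1 - n.+1%:R^-1) n.+1%:R^-1 Af.
  - by rewrite ltrBlDr ltrDl invr_gt0 ltr0n.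
  - by rewrite invr_gt0 ltr0n.
  by exists h.
have {}/choice [h hP] := ch.
have hc : (h : nat -> locunif R) @ \oo --> (set_val f : locunif R).
  by apply: locunif_cvg => n z; have [_] := hP n; apply.
have V'f : V' (set_val f) by rewrite -VE in Vf.
have /hc [N _ HN] : nbhs (set_val f : locunif R) V' by apply: open_nbhs_nbhs.
have [[Uh Ah] _] := hP N.
have hA : h N \in (A : set (locunif R)) by apply/mem_set.
exists (exist _ (h N) hA); split; last exact: Uh.
by rewrite -VE; apply: HN => /=.
Qed.

Lemma dilated_compact (K : set R[i]) r : compact K -> K `<=` @circle R -> 0 < r < 1 ->
  disc_compacts R [set r%:C * z | z in K].
Proof.
move=> cK KT /andP[r0 r1]; split.
  apply: continuous_compact cK; apply: econt_within => z _ e e0.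
  exists e => // w _ wz; rewrite -mulrBr cmodM cmod_real gtr0_norm //.
  by apply: le_lt_trans wz; rewrite ler_piMl // ltW.
move=> _ [z Kz <-]; have z1 : modc z = 1 by exact: KT.
by rewrite /disc /= -[cmod _]/(modc _) cmodM cmod_real z1 mulr1 gtr0_norm.
Qed.

Lemma calU_Gdelta (K : set R[i]) (A : set (R[i] -> R[i])) :
  compact K -> ncover K -> K `<=` @circle R -> A `<=` calB R ->
  Gdelta [set f : set_type (A : set (locunif R)) | calU K (set_val f)].
Proof.
move=> cK nK KT AB; have [psi [bpsi dpsi]] := dense_family cK nK KT.
have K1 z : K z -> modc z = 1 by move=> /KT.
(* The radius is required to exceed 1 - e, so that small e produces radii tending to 1. The
   intermediate bound c < e leaves the margin that makes the condition open. *)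
pose W (i : nat) (e : R) : set (locunif R) := [set f | exists r c, [/\ 0 < r < 1, 1 - e < r,
   c < e & forall z, K z -> modc (f (r%:C * z) - psi i z) <= c]].
have Wopen i e : open (W i e).
  rewrite openE => f [r [c [rr re ce fc]]].
  have d0 : 0 < (e - c) / 2 by lra.
  have := locunif_nbhs f (dilated_compact cK KT rr) d0; apply: filterS => g /= gf.
  exists r, (c + (e - c) / 2); split => //; first lra.
  move=> z Kz; apply: le_trans (cmod_dist (f (r%:C * z)) _ _) _.
  rewrite addrC lerD //; first exact: fc.
  by apply/ltW/gf; exists z.
pose dec n := odflt (0%N, 0%N) (unpickle n) : nat * nat.
exists (fun n => set_val @^-1` W (dec n).1 (dec n).2.+1%:R^-1).
  by move=> n; exists (W (dec n).1 (dec n).2.+1%:R^-1).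
apply/seteqP; split.
- move=> f /= [fB fU] n _ /=; set i := (dec n).1; set k := (dec n).2.
  have k0 : 0 < k.+1%:R^-1 :> R by rewrite invr_gt0 ltr0n.
  move: (k.+1%:R^-1) k0 => e e0.
  have [r [r01 r1 rn]] := fU _ (bpsi i).
  move/cvg_realP : r1 => /(_ e e0) [N1 H1].
  move/cvg_realP : rn => /(_ (e / 2)) [|N2 H2]; first lra.
  pose m := maxn N1 N2; exists (r m), (e / 2); split.
  + exact: r01.
  + have := H1 m (leq_maxl _ _); have /andP[_ rm] := r01 m.
    by rewrite ltr0_norm ?subr_lt0 //; lra.
  + by lra.
  + move=> z Kz; have := H2 m (leq_maxr _ _); rewrite subr0 ger0_norm ?norm_on_ge0 //.
    move=> h; apply: le_trans (ltW h).
    (* The supremum dominates the values only for a bounded function; here 2 is a bound. *)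
    apply: (@norm_on_ge _ K (dilate (r m) (set_val f) \- psi i) 2) Kz => w Kw.
    rewrite /dilate /=; apply: le_trans (cmodB _ _) _.
    have h1 : modc (psi i w) <= 1 by apply: BC_le1 (bpsi i) Kw.
    have /andP[r0 r1] := r01 m.
    have : modc (set_val f ((r m)%:C * w)) <= 1.
      apply: calB_le1 => //.
      by rewrite cmodM cmod_real K1 // mulr1 gtr0_norm.
    lra.
- move=> f /= fW.
  have fB : calB R (set_val f) by apply: AB; exact: set_valP.
  have fWik i k : W i k.+1%:R^-1 (set_val f).
    by have := fW (pickle (i, k)) I; rewrite /= /dec pickleK.
  split => // phi bphi.
  have e0 (k : nat) : 0 < k.+1%:R^-1 :> R by rewrite invr_gt0 ltr0n.
  have ch (k : nat) : exists r, [/\ 0 < r < 1, 1 - k.+1%:R^-1 < r &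
      forall z, K z -> modc (set_val f (r%:C * z) - phi z) <= 2 * k.+1%:R^-1].
    have [i iP] := dpsi phi _ bphi (e0 k).
    have [r [c [rr re ce fc]]] := fWik i k; exists r; split => // z Kz.
    apply: le_trans (cmod_dist (psi i z) _ _) _.
    move: (k.+1%:R^-1) (iP z Kz) ce => e h ce.
    by have := fc z Kz; lra.
  have {}/choice [r rP] := ch.
  have small e : 0 < e -> exists N, forall k, (N <= k)%N -> k.+1%:R^-1 < e.
    move=> e1; exists (Num.truncn e^-1) => k Nk; rewrite -[ltRHS]invrK.
    rewrite ltf_pV2 ?posrE ?invr_gt0 ?ltr0n //.
    by apply: lt_le_trans (truncnS_gt _) _; rewrite ler_nat.
  exists r; split.
  + by move=> k; have [] := rP k.
  + apply/cvg_realP => e /small[N HN]; exists N => k Nk.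
    have [/andP[_ r1] r2 _] := rP k; rewrite ltr0_norm ?subr_lt0 //.
    by have := HN k Nk; move: (k.+1%:R^-1) r2 => t; lra.
  + apply/cvg_realP => e e1; have [|N HN] := small (e / 2); first lra.
    exists N => k Nk; rewrite subr0 ger0_norm ?norm_on_ge0 //.
    have [_ _ H] := rP k.
    apply: (@le_lt_trans _ _ (2 * k.+1%:R^-1)); last first.
      by have := HN k Nk; move: (k.+1%:R^-1) => t; lra.
    by apply: norm_on_le; [rewrite mulr_ge0 ?(ltW (e0 k))|exact: H].
Qed.

End Topology.

(** * Infinite products *)

Section ProductScheme.
Variables (R : realType) (T : eqType) (val : T -> R[i] -> R[i]) (ok : T -> Prop).
Variable K : set R[i].
Implicit Types (z w : R[i]) (x y e r d : R) (s : seq T).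

Definition fprod s z := \prod_(a <- s) val a z.

Hypothesis K_compact : compact K.
Hypothesis K_ncover : ncover K.
Hypothesis K_circle : K `<=` @circle R.
Hypothesis val_le1 : forall a z, ok a -> modc z < 1 -> modc (val a z) <= 1.
Hypothesis val_unim : forall a z, ok a -> K z -> modc (val a z) = 1.
Hypothesis val_econt : forall a, ok a -> econt K (val a).
Hypothesis val_radial : forall a e, ok a -> 0 < e -> exists2 r, r < 1 &
  forall t z, r < t < 1 -> K z -> modc (val a (t%:C * z) - val a z) <= e.
Hypothesis val_papprox : forall a r, ok a -> r < 1 -> papprox r (val a).
Hypothesis val_block : forall psi r e, eucont K psi ->
  (forall z, K z -> modc (psi z) <= 1) -> r < 1 -> 0 < e ->
  exists s t, [/\ s != [::], forall a, a \in s -> ok a,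
    r < t < 1 /\ 0 < t,
    forall z, modc z <= r -> modc (fprod s z - 1) <= e &
    forall z, K z -> modc (fprod s (t%:C * z) - psi z) <= e].

Let K1 z : K z -> modc z = 1. Proof. by move=> /K_circle. Qed.
Let allok s := forall a, a \in s -> ok a.

Let allok_cons a s : allok (a :: s) -> ok a /\ allok s.
Proof.
by move=> H; split=> [|b bs]; apply: H; rewrite inE ?eqxx // bs orbT.
Qed.

Lemma fprod_cat s1 s2 z : fprod (s1 ++ s2) z = fprod s1 z * fprod s2 z.
Proof. by rewrite /fprod big_cat. Qed.

Lemma fprod_cons a s z : fprod (a :: s) z = val a z * fprod s z.
Proof. by rewrite /fprod big_cons. Qed.

Lemma fprod_nil z : fprod [::] z = 1.
Proof. by rewrite /fprod big_nil. Qed.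

Let fprod_le1 s z : allok s -> modc z < 1 -> modc (fprod s z) <= 1.
Proof.
move=> + z1; elim: s => [|a s IH]; first by rewrite fprod_nil cmod1.
move=> /allok_cons[oka /IH h]; rewrite fprod_cons cmodM.
by apply: mulr_ile1 => //; exact: val_le1.
Qed.

Let fprod_unim s z : allok s -> K z -> modc (fprod s z) = 1.
Proof.
move=> + Kz; elim: s => [|a s IH]; first by rewrite fprod_nil cmod1.
by move=> /allok_cons[oka /IH h]; rewrite fprod_cons cmodM val_unim // h mulr1.
Qed.

Let fprod_econt s : allok s -> econt K (fprod s).
Proof.
elim: s => [_ z _ e e0|a s IH].
  by exists 1 => // w _ _; rewrite !fprod_nil subrr cmod0.
move=> /allok_cons[oka oks] z Kz e e0.
have [|d1 d10 H1] := val_econt oka Kz (e := e / 2); first lra.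
have [|d2 d20 H2] := IH oks z Kz (e / 2); first lra.
exists (Num.min d1 d2) => [|w Kw]; first by rewrite lt_min d10.
rewrite lt_min => /andP[/(H1 w Kw) h1 /(H2 w Kw) h2].
have -> : fprod (a :: s) w - fprod (a :: s) z =
  val a w * (fprod s w - fprod s z) + (val a w - val a z) * fprod s z.
  by rewrite !fprod_cons; ring.
apply: le_lt_trans (cmodD _ _) _.
rewrite !cmodM val_unim // (fprod_unim oks Kz); lra.
Qed.

Let fprod_radial s e : allok s -> 0 < e -> exists2 r, r < 1 &
  forall t z, r < t < 1 -> K z -> modc (fprod s (t%:C * z) - fprod s z) <= e.
Proof.
elim: s e => [|a s IH] e; first by move=> _ e0; exists 0 => // t z _ _; rewrite !fprod_nil subrr cmod0 ltW.
move=> /allok_cons[oka oks] e0.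
have [|r1 r11 H1] := val_radial oka (e := e / 2); first lra.
have [|r2 r21 H2] := IH (e / 2) oks; first lra.
exists (Num.max 0 (Num.max r1 r2)); first by rewrite !gt_max ltr01 r11.
move=> t z; rewrite !gt_max => /andP[/and3P[t0 t1 t2] tt] Kz.
have h1 := H1 t z ltac:(by rewrite t1 tt) Kz.
have h2 := H2 t z ltac:(by rewrite t2 tt) Kz.
have -> : fprod (a :: s) (t%:C * z) - fprod (a :: s) z =
  val a (t%:C * z) * (fprod s (t%:C * z) - fprod s z) +
  (val a (t%:C * z) - val a z) * fprod s z by rewrite !fprod_cons; ring.
apply: le_trans (cmodD _ _) _; rewrite !cmodM (fprod_unim oks Kz) mulr1.
have v1 : modc (val a (t%:C * z)) <= 1.
  by apply: val_le1 => //; rewrite cmodM cmod_real K1 // mulr1 gtr0_norm.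
have : modc (val a (t%:C * z)) * modc (fprod s (t%:C * z) - fprod s z) <= 1 * (e / 2).
  exact: ler_pM.
lra.
Qed.

Let fprod_papprox s r : allok s -> r < 1 -> papprox r (fprod s).
Proof.
move=> + r1; elim: s => [|a s IH].
  by move=> _; apply: papprox_ext (papprox_cst r 1) => z _; rewrite fprod_nil.
move=> /allok_cons[oka oks].
by apply: papprox_ext (papproxM (val_papprox oka r1) (IH oks)) => z _; rewrite fprod_cons.
Qed.

(** The atoms and the Blaschke factors share this construction. Convergence is obtained along the
    lengths N n, where blocks end; passing to all partial products is left to the summability that
    the bound at 0 provides. *)
Lemma product_scheme : exists (a : nat -> T) (N : nat -> nat) (f : R[i] -> R[i]),
  [/\ calU K f, forall n, ok (a n),
      forall n, (n <= N n)%N /\ modc (\prod_(k < N n) val (a k) 0 - 1) <= 2^-1 &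
      forall z, modc z < 1 ->
        (fun n => \prod_(k < N n) val (a k) z) @ \oo --> f z].
Proof.
have [psi [bpsi dpsi]] := dense_family K_compact K_ncover K_circle.
(* Successive lists extend one another by non-empty blocks, so they define one infinite sequence. *)
pose Q (r e : R) (s s' : seq T) := exists2 s1, s1 != [::] & s' = s ++ s1.
have step s n r e : allok s -> r < 1 -> 0 < e -> exists s' (t : R),
   [/\ allok s', Q r e s s', r < t < 1,
     forall z, modc z <= r -> modc (fprod s' z - fprod s z) <= e &
     forall z, K z -> modc (fprod s' (t%:C * z) - nrec psi n z) <= e].
  move=> oks r1 e0.
  have [|r0 r01 H0] := fprod_radial (e := e / 2) oks; first lra.
  (* On K the finite product is unimodular, so the quotient of phi by it is phi times its conjugate;
     this is the target of the new block. *)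
  pose phi := nrec psi n; pose g z := phi z * conjc (fprod s z).
  have phi1 z : K z -> modc (phi z) <= 1.
    by move=> Kz; apply: BC_le1 (bpsi (logn 2 n)) Kz.
  have cphi : econt K phi by apply: within_continuous_econt; case: (bpsi (logn 2 n)).
  have ug : eucont K g.
    apply: compact_eucont => // z Kz d d0.
    have [|d1 d10 H1] := cphi z Kz (d / 2); first lra.
    have [|d2 d20 H2] := fprod_econt oks Kz (e := d / 2); first lra.
    exists (Num.min d1 d2) => [|w Kw]; first by rewrite lt_min d10.
    rewrite lt_min => /andP[/(H1 w Kw) h1 /(H2 w Kw) h2].
    have -> : g w - g z = phi w * conjc (fprod s w - fprod s z) +
       (phi w - phi z) * conjc (fprod s z) by rewrite /g rmorphB /=; ring.
    apply: le_lt_trans (cmodD _ _) _; rewrite !cmodM !cmodJ (fprod_unim oks Kz) mulr1.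
    have : modc (phi w) * modc (fprod s w - fprod s z) <= 1 * modc (fprod s w - fprod s z).
      by rewrite ler_wpM2r // phi1.
    lra.
  have g1 z : K z -> modc (g z) <= 1.
    by move=> Kz; rewrite /g cmodM cmodJ fprod_unim // mulr1 phi1.
  have [||s1 [t [s1n s1ok [/andP[rt t1] t0] s1r s1t]]] :=
    @val_block g (Num.max r r0) (e / 2) ug g1; try lra.
    by rewrite gt_max r1.
  move: rt; rewrite gt_max => /andP[rt r0t].
  exists (s ++ s1), t; split.
  - by move=> a; rewrite mem_cat => /orP[/oks|/s1ok].
  - by exists s1.
  - by rewrite rt t1.
  - move=> z zr; rewrite fprod_cat.
    have -> : fprod s z * fprod s1 z - fprod s z = fprod s z * (fprod s1 z - 1) by ring.
    rewrite cmodM; have h1 : modc (fprod s z) <= 1 by apply: fprod_le1 => //; lra.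
    have h2 : modc (fprod s1 z - 1) <= e / 2 by apply: s1r; rewrite le_max zr.
    have : modc (fprod s z) * modc (fprod s1 z - 1) <= 1 * (e / 2) by apply: ler_pM.
    lra.
  - move=> z Kz; rewrite fprod_cat.
    have gz : fprod s z * g z = phi z.
      by rewrite /g mulrCA mulcJ fprod_unim // expr1n rmorph1 mulr1.
    have -> : fprod s (t%:C * z) * fprod s1 (t%:C * z) - nrec psi n z =
       (fprod s (t%:C * z) - fprod s z) * fprod s1 (t%:C * z) +
       fprod s z * (fprod s1 (t%:C * z) - g z).
      by rewrite -/phi -gz; ring.
    apply: le_trans (cmodD _ _) _; rewrite !cmodM (fprod_unim oks Kz) mul1r.
    have h1 := H0 t z ltac:(by rewrite r0t t1) Kz; have h2 := s1t z Kz.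
    have h3 : modc (fprod s1 (t%:C * z)) <= 1.
      by apply: fprod_le1 => //; rewrite cmodM cmod_real K1 // mulr1 gtr0_norm.
    have : modc (fprod s (t%:C * z) - fprod s z) * modc (fprod s1 (t%:C * z)) <= e / 2 * 1.
      exact: ler_pM.
    lra.
have ok0 : allok [::] by [].
(* With e0 = 1/4, both the initial product 1 and any later one are within 1/4 of f at 0, hence
   within 1/2 of each other. *)
have [||x [r [t [f [[x0 r0] xPQ rt fx ft]]]]] :=
  @scheme R _ fprod allok K (nrec psi) Q _ step [::] 0 (1 / 4) ok0 ltr01.
- by move=> z /K1 ->.
- by lra.
have xS n : exists2 s1, s1 != [::] & x n.+1 = x n ++ s1 by have [] := xPQ n.
have sz n : (n <= size (x n))%N.
  elim: n => [//|n IH]; have [s1 s1n ->] := xS n; rewrite size_cat.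
  by case: s1 s1n => [//|b s1] _ /=; rewrite addnS ltnS; exact: leq_trans IH (leq_addr _ _).
have [a0 _] : exists a0 : T, True.
  by have := sz 1%N; case: (x 1%N) => [//|a0 s] _; exists a0.
have pre n k : exists s, x (n + k)%N = x n ++ s.
  elim: k => [|k [s IH]]; first by exists [::]; rewrite addn0 cats0.
  by rewrite addnS; have [s1 _ ->] := xS (n + k)%N; exists (s ++ s1); rewrite IH catA.
(* The list [x k.+1] has at least k + 1 entries, so its entry of rank k exists. *)
pose a k := nth a0 (x k.+1) k.
have xa n k : (k < size (x n))%N -> nth a0 (x n) k = a k.
  move=> kn; rewrite /a; have [nk|kn'] := leqP n k.+1.
    have [s] := pre n (k.+1 - n)%N; rewrite subnKC // => ->.
    by rewrite nth_cat kn.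
  have [s] := pre k.+1 (n - k.+1)%N; rewrite subnKC ?(ltnW kn') // => ->.
  by rewrite nth_cat sz.
have prodE n z : \prod_(k < size (x n)) val (a k) z = fprod (x n) z.
  rewrite /fprod (big_nth a0) big_mkord; apply: eq_bigr => k _.
  by rewrite xa.
have r1 n : r n < 1 by have [/andP[]] := rt n.
have rin n z : 1 - 2^-1 ^+ n >= modc z -> modc z <= r n.
  by move=> h; apply: le_trans h _; have [] := rt n.
have rlim z : modc z < 1 -> exists M, forall n, (M <= n)%N -> modc z <= r n.
  move=> z1; have [||M HM] := @exp_small R 2^-1 (1 - modc z).
  - by apply/andP; split; lra.
  - by lra.
  exists M => n Mn; apply: rin; have : 2^-1 ^+ n <= 2^-1 ^+ M :> R.
    by rewrite ler_wiXn2l // invf_le1 ?ler1n.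
  lra.
have cvf z : modc z < 1 -> (fun n => fprod (x n) z) @ \oo --> f z.
  move=> z1; have [M HM] := rlim z z1; apply/cvg_cmodP => e e0.
  have /cvg_realP/(_ e e0) [M' HM'] := @half_expn_cvg0 R (1 / 4).
  exists (maxn M M') => n; rewrite geq_max => /andP[h1 h2].
  rewrite cmodBC; apply: le_lt_trans (fx n z (HM n h1)) _.
  by have := HM' n h2; rewrite subr0; apply: le_lt_trans; exact: ler_norm.
have f_le1 z : modc z < 1 -> modc (f z) <= 1.
  move=> z1; apply/ler_addgt0Pr => e e0.
  have /cvg_cmodP/(_ e e0) [M HM] := cvf z z1.
  have := HM M (leqnn M); have [oks _] := xPQ M; have := fprod_le1 oks z1.
  by rewrite cmodBC; have := cmod_subl (f z) (fprod (x M) z); lra.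
have fD z : modc z < 1 -> hasD f z.
  move=> z1; pose s := (modc z + 1) / 2.
  apply: (@papprox_hasD _ _ _ s); first by rewrite /s; lra.
  apply: papprox_lim => e e0.
  have /cvg_realP/(_ e e0) [M HM] := @half_expn_cvg0 R (1 / 4).
  have [||M' HM'] := @exp_small R 2^-1 (1 - s).
  - by apply/andP; split; lra.
  - by rewrite /s; lra.
  pose n := maxn M M'; exists (fprod (x n)).
    by apply: fprod_papprox; [have [] := xPQ n|rewrite /s; lra].
  move=> w ws; apply: le_trans (fx n w _) _.
    apply: rin; have : 2^-1 ^+ n <= 2^-1 ^+ M' :> R.
      by rewrite ler_wiXn2l ?leq_maxr // invf_le1 ?ler1n.
    lra.
  have := HM n (leq_maxl _ _); rewrite subr0 => h.
  by apply: le_trans (ler_norm _) (ltW h).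
have cut z : modc z < 1 -> cutoff f z = f z by move=> z1; rewrite /cutoff z1.
exists a, (fun n => size (x n)), (cutoff f); split.
- apply: (@calU_correction R K psi t (cutoff f) (1 / 4) K_compact (cutoff_calB fD f_le1) dpsi).
  + move=> n; have [/andP[h1 h2] h3 /andP[h4 h5]] := rt n.
    by have := r1 n.+1; split; [apply/andP; split|]; lra.
  + move=> n z Kz; rewrite cut ?ft // cmodM cmod_real K1 // mulr1.
    have [/andP[h1 h2] h3 /andP[h4 h5]] := rt n.
    by have := r1 n.+1; rewrite gtr0_norm; lra.
- move=> n; rewrite /a; have [ok1 _] := xPQ n.+1; apply: ok1.
  by apply: mem_nth; exact: sz.
- move=> n; split; first exact: sz.
  have r00 k : modc 0 <= r k by rewrite cmod0; have [/andP[/ltW]] := rt k.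
  have h1 := fx 0%N 0 (r00 0%N); rewrite x0 fprod_nil expr0 mulr1 in h1.
  have h2 := fx n 0 (r00 n); rewrite prodE.
  have h3 : 2^-1 ^+ n <= 1 :> R by rewrite exprn_ile1 // invf_le1 ?ler1n.
  have := cmod_dist (f 0) (fprod (x n) 0) 1; rewrite (cmodBC (fprod (x n) 0) (f 0)).
  lra.
- by move=> z z1; rewrite cut //; under eq_fun do rewrite prodE; exact: cvf.
Qed.

End ProductScheme.

Section BoundedSeries.
Variable R : realType.

Lemma nonneg_series_cvg (u : nat -> R) C : (forall n, 0 <= u n) ->
  (forall n, exists2 N, (n <= N)%N & \sum_(k < N) u k <= C) ->
  cvgn (series u).
Proof.
move=> u0 uC; apply: nondecreasing_is_cvgn.
  by apply: nondecreasing_series => n _ _; exact: u0.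
exists C => _ [n _ <-]; have [N nN] := uC n; apply: le_trans.
rewrite /series /= -(big_mkord xpredT u) [leRHS](big_cat_nat (leq0n n) nN) /=.
by rewrite lerDl; apply: sumr_ge0.
Qed.

Lemma nonneg_series_tail (u : nat -> R) e : (forall n, 0 <= u n) ->
  cvgn (series u) -> 0 < e ->
  exists M, forall N n, (M <= N)%N -> (N <= n)%N -> \sum_(N <= k < n) u k <= e.
Proof.
move=> u0 /cvg_ex[l] cu e0; move: cu.
move=> /cvg_realP /(_ (e / 2)) [|M HM]; first lra.
exists M => N n MN Nn; have h1 := HM N MN; have h2 := HM n (leq_trans MN Nn).
have E : series u n = series u N + \sum_(N <= k < n) u k.
  by rewrite /series /= (big_cat_nat (leq0n N) Nn).
move: h1 h2; rewrite E !ltr_norml => /andP[? ?] /andP[? ?]; lra.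
Qed.

(** Here u k is the value at 0 of the k-th factor, |a k| or exp (- m k): a product at least 1/2
    bounds the sum of the logarithms, and with it the Blaschke sum or the total mass. *)
Lemma prod_half_ln (u : nat -> R) N : (forall k, 0 < u k) ->
  modc (\prod_(k < N) (u k)%:C - 1) <= 2^-1 ->
  \sum_(k < N) - ln (u k) <= ln 2.
Proof.
move=> u0 h; have E : \prod_(k < N) (u k)%:C = (\prod_(k < N) u k)%:C.
  by rewrite rmorph_prod.
have h2 : 2^-1 <= \prod_(k < N) u k.
  move: h; rewrite E -(rmorph1 (real_complex R)) -real_complexB cmod_real.
  by rewrite ler_norml => /andP[? ?]; lra.
have : ln 2^-1 <= ln (\prod_(k < N) u k).
  by rewrite ler_ln ?posrE ?invr_gt0 //; apply: lt_le_trans h2; rewrite invr_gt0.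
rewrite lnV ?posrE // => h3.
suff -> : \sum_(k < N) - ln (u k) = - ln (\prod_(k < N) u k) by lra.
clear - u0; elim: N => [|N IH]; first by rewrite !big_ord0 ln1 oppr0.
rewrite !big_ord_recr /= IH lnM ?posrE //; first by rewrite opprD.
by apply: prodr_gt0 => k _.
Qed.

End BoundedSeries.

(** * Blaschke factors and the universal Blaschke product *)

Section Blaschke.
Variable R : realType.
Implicit Types (z w a : R[i]) (x y e r d m : R).

Lemma cmod_prod_diff (I : Type) (s : seq I) (F G : I -> R[i]) :
  (forall i, modc (F i) <= 1) -> (forall i, modc (G i) <= 1) ->
  modc (\prod_(i <- s) F i - \prod_(i <- s) G i) <= \sum_(i <- s) modc (F i - G i).
Proof.
move=> F1 G1; elim: s => [|i s IH]; first by rewrite !big_nil subrr cmod0.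
rewrite !big_cons.
have -> : F i * \prod_(j <- s) F j - G i * \prod_(j <- s) G j =
   (F i - G i) * \prod_(j <- s) F j + G i * (\prod_(j <- s) F j - \prod_(j <- s) G j).
  by ring.
apply: le_trans (cmodD _ _) _; rewrite !cmodM.
have P1 : modc (\prod_(j <- s) F j) <= 1.
  by elim/big_rec : _ => [|j x _ hx]; rewrite ?cmod1 // cmodM mulr_ile1.
apply: lerD; first by rewrite ler_piMr.
by apply: le_trans IH; rewrite ler_piMl.
Qed.

Lemma cmod_expn_diff z w n : modc z <= 1 -> modc w <= 1 ->
  modc (z ^+ n - w ^+ n) <= n%:R * modc (z - w).
Proof.
move=> z1 w1; have := @cmod_prod_diff _ (index_iota 0 n) (fun=> z) (fun=> w).
by rewrite !big_const_nat !iter_mulr_1 iter_addr_0 subn0 mulr_natl; apply.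
Qed.

Definition bok a := 0 < modc a < 1.

Lemma bfactorE a z : bok a -> 1 - conjc a * z != 0 ->
  1 - blaschke_factor a z =
  (1 - modc a)%:C * (a + (modc a)%:C * z) / (a * (1 - conjc a * z)).
Proof.
move=> /andP[a0 a1] d0; have a_neq0 : a != 0 by rewrite -cmod_gt0.
rewrite /blaschke_factor -[cmod a]/(modc a) real_complexB rmorph1.
have aa : (modc a)%:C * (modc a)%:C = a * conjc a.
  by rewrite mulcJ expr2 real_complexM.
have -> : (1 - (modc a)%:C) * (a + (modc a)%:C * z) =
   a - (modc a)%:C * a + (modc a)%:C * z - a * conjc a * z.
  by rewrite -aa; ring.
by field; rewrite a_neq0 d0.
Qed.

Lemma bden_ge a z r : bok a -> modc z <= r -> r <= 1 ->
  1 - r <= modc (1 - conjc a * z) /\ 1 - modc a <= modc (1 - conjc a * z).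
Proof.
move=> /andP[a0 a1] zr r1.
have := cmod_subl 1 (conjc a * z); rewrite cmod1 cmodM cmodJ => h.
have z0 := cmod_ge0 z.
have : modc a * modc z <= 1 * modc z by rewrite ler_wpM2r // ltW.
have : modc a * modc z <= modc a * 1 by rewrite ler_wpM2l ?(ltW a0) //; lra.
by move=> h1 h2; split; lra.
Qed.

Lemma bden_neq0 a z : bok a -> modc z <= 1 -> 1 - conjc a * z != 0.
Proof.
move=> oka z1; have [_ h] := bden_ge oka z1 (lexx 1).
by rewrite -cmod_gt0; case/andP: oka; lra.
Qed.

Lemma bfactor_dist1 a z r : bok a -> modc z <= r -> r < 1 ->
  modc (1 - blaschke_factor a z) <= 2 / (1 - r) * (1 - modc a).
Proof.
move=> oka zr r1; have [h1 _] := bden_ge oka zr (ltW r1).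
have [a0 a1] := andP oka.
rewrite bfactorE //; last by rewrite -cmod_gt0; lra.
rewrite cmodf !cmodM cmod_real ger0_norm; last by lra.
have h2 : modc (a + (modc a)%:C * z) <= 2 * modc a.
  apply: le_trans (cmodD _ _) _; rewrite cmodM cmod_real (gtr0_norm a0).
  have : modc a * modc z <= modc a * 1 by rewrite ler_wpM2l ?(ltW a0) //; lra.
  by lra.
rewrite ler_pdivrMr; last by rewrite mulr_gt0 //; lra.
apply: (@le_trans _ _ ((1 - modc a) * (2 * modc a))).
  by rewrite ler_wpM2l //; lra.
have -> : 2 / (1 - r) * (1 - modc a) * (modc a * modc (1 - conjc a * z)) =
   (1 - modc a) * (2 * modc a) * (modc (1 - conjc a * z) / (1 - r)).
  by field; rewrite subr_eq0 gt_eqF.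
rewrite ler_peMr //; first by rewrite !mulr_ge0 //; lra.
by rewrite ler_pdivlMr ?mul1r //; lra.
Qed.

(** Its sign gives modulus at most 1 on the disc, its vanishing for |z| = 1 gives modulus 1 on the
    circle. *)
Lemma bfactor_sq a z :
  modc (1 - conjc a * z) ^+ 2 - modc (a - z) ^+ 2 =
  (1 - modc a ^+ 2) * (1 - modc z ^+ 2).
Proof.
rewrite !sqr_cmod; case: a => a1 a2; case: z => z1 z2 /=; ring.
Qed.

Lemma cmod_bfactor a z : bok a ->
  modc (blaschke_factor a z) = modc (a - z) / modc (1 - conjc a * z).
Proof.
move=> /andP[a0 a1]; rewrite /blaschke_factor -[cmod a]/(modc a) cmodM !cmodf.
by rewrite cmod_real gtr0_norm // divff ?mul1r // gt_eqF.
Qed.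

Lemma bfactor_le1 a z : bok a -> modc z <= 1 -> modc (blaschke_factor a z) <= 1.
Proof.
move=> oka z1; rewrite cmod_bfactor //.
have d0 := bden_neq0 oka z1; rewrite ler_pdivrMr ?cmod_gt0 // mul1r.
rewrite -(@ler_pXn2r R 2) ?nnegrE // -subr_ge0 bfactor_sq //.
have [a0 a1] := andP oka.
by rewrite mulr_ge0 // subr_ge0 expr_le1 // ltW.
Qed.

Lemma bfactor_unim a z : bok a -> modc z = 1 -> modc (blaschke_factor a z) = 1.
Proof.
move=> oka z1; rewrite cmod_bfactor //; have zle : modc z <= 1 by rewrite z1.
have d0 := bden_neq0 oka zle; have := bfactor_sq a z.
rewrite z1 expr1n subrr mulr0 => /eqP; rewrite subr_eq0 eqrXn2 // => /eqP <-.
by rewrite divff // cmod_eq0.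
Qed.

Lemma bfactor_papprox a : bok a -> papprox 1 (blaschke_factor a).
Proof.
move=> oka; have [a0 a1] := andP oka.
rewrite /blaschke_factor; apply: papproxZ; apply: papproxM.
  by apply: papproxD; [exact: papprox_cst|apply/papproxN/papprox_id].
apply: (@papproxV _ _ _ (1 - modc a)); last 2 first.
- by lra.
- move=> z z1; rewrite ReB /= lerB //.
  apply: le_trans (ler_norm _) _; apply: le_trans (Re_le_cmod _) _.
  by rewrite cmodM cmodJ ler_piMr // ltW.
- by apply: papproxD; [exact: papprox_cst|apply/papproxN/papproxZ/papprox_id].
Qed.

Lemma bfactor0 a : bok a -> blaschke_factor a 0 = (modc a)%:C.
Proof.
move=> /andP[a0 a1]; have a_neq0 : a != 0 by rewrite -cmod_gt0.
by rewrite /blaschke_factor mulr0 !subr0 divr1 divfK.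
Qed.

(* With a = (1 - d) w one has b_a = 1 - d h' where h' tends to the Herglotz
   kernel h of w as d tends to 0, so that b_a^n is close to exp (- n d h). *)
Lemma bfactor_near_exp w z r d : modc w = 1 -> modc z <= r -> r < 1 -> 0 < d -> d < 1 ->
  d * (2 / (1 - r)) <= 2^-1 ->
  modc (blaschke_factor ((1 - d)%:C * w) z - cexp (- (d%:C * herglotz w z))) <=
  d ^+ 2 * (26 / (1 - r) ^+ 2).
Proof.
move=> w1 zr r1 d0 d1 dr; pose a := (1 - d)%:C * w.
have r0 : 0 <= r by apply: le_trans (cmod_ge0 z) zr.
have ma : modc a = 1 - d by rewrite cmodM cmod_real w1 mulr1 gtr0_norm // subr_gt0.
have oka : bok a by rewrite /bok ma; apply/andP; split; lra.
have [Dge _] := bden_ge oka zr (ltW r1).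
have D0 : 1 - conjc a * z != 0 by rewrite -cmod_gt0; lra.
have w0 : w != 0 by rewrite -cmod_gt0 w1.
have wz : w - z != 0 by rewrite -cmod_gt0; have := cmod_subl w z; lra.
have wz_ge : 1 - r <= modc (w - z) by have := cmod_subl w z; lra.
have wJ : conjc w = w^-1.
  by apply: (mulfI w0); rewrite mulcJ w1 expr1n rmorph1 divff.
have dC : (1 - d)%:C != 0 by rewrite -cmod_gt0 cmod_real normr_gt0 gt_eqF // subr_gt0.
have aJ : conjc a = (1 - d)%:C / w by rewrite -wJ -[in RHS](@conjc_real R (1 - d)) -rmorphM.
have DE : 1 - conjc a * z = (w - (1 - d)%:C * z) / w.
  by rewrite aJ; field.
have wdz : w - (1 - d)%:C * z != 0.
  by apply: contraNneq D0; rewrite DE => ->; rewrite mul0r.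
have bE : blaschke_factor a z = 1 - d%:C * ((w + z) / (w - (1 - d)%:C * z)).
  rewrite -(subKr 1 (blaschke_factor a z)) bfactorE // ma DE.
  have -> : 1 - (1 - d) = d by ring.
  rewrite /a; congr (_ - _); move: ((1 - d)%:C) (d%:C) dC wdz => c c' dC wdz.
  by field; rewrite wdz w0 dC.
have hm : modc (herglotz w z) <= 2 / (1 - r).
  rewrite /herglotz cmodf; apply: ler_pM; rewrite ?invr_ge0 //.
    by apply: le_trans (cmodD _ _) _; lra.
  by rewrite lef_pV2 ?posrE //; lra.
have wdz_ge : 1 - r <= modc (w - (1 - d)%:C * z).
  by move: Dge; rewrite DE cmodf w1 divr1.
set h := herglotz w z in hm *.
set h' := (w + z) / (w - (1 - d)%:C * z) in bE.
have hh : modc (h' - h) <= 2 * d / (1 - r) ^+ 2.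
  have -> : h' - h = - (d%:C * z * (w + z)) / ((w - (1 - d)%:C * z) * (w - z)).
    rewrite /h' /h /herglotz; have -> : (1 - d)%:C = 1 - d%:C by rewrite real_complexB rmorph1.
    field; rewrite wz /=; move: wdz.
    by have -> : (1 - d)%:C = 1 - d%:C by rewrite real_complexB rmorph1.
  rewrite cmodf cmodN !cmodM cmod_real gtr0_norm //.
  have p0 : 0 < (1 - r) ^+ 2 by rewrite exprn_gt0 // subr_gt0.
  have p : (1 - r) ^+ 2 <= modc (w - (1 - d)%:C * z) * modc (w - z).
    by rewrite expr2; apply: ler_pM; lra.
  apply: ler_pM; rewrite ?invr_ge0 ?mulr_ge0 ?(ltW d0) //.
    apply: (@le_trans _ _ (d * 1 * 2)); last by lra.
    apply: ler_pM; rewrite ?mulr_ge0 ?(ltW d0) //.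
      by rewrite ler_wpM2l ?(ltW d0) //; lra.
    by apply: le_trans (cmodD _ _) _; lra.
  by rewrite lef_pV2 ?posrE //; lra.
have dh : modc (d%:C * h) <= d * (2 / (1 - r)).
  by rewrite cmodM cmod_real gtr0_norm // ler_wpM2l // ltW.
have := @cexp_second_order R (- (d%:C * h)); rewrite cmodN => /(_ (le_trans dh dr)).
rewrite opprK => T.
rewrite bE.
have -> : 1 - d%:C * h' - cexp (- (d%:C * h)) =
   - (cexp (- (d%:C * h)) - 1 + d%:C * h) - d%:C * (h' - h) by ring.
apply: le_trans (cmodB _ _) _; rewrite cmodN.
have t1 : modc (d%:C * (h' - h)) <= d * (2 * d / (1 - r) ^+ 2).
  by rewrite cmodM cmod_real gtr0_norm // ler_wpM2l // ltW.
have t2 : modc (d%:C * h) ^+ 2 <= (d * (2 / (1 - r))) ^+ 2.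
  by rewrite lerXn2r ?nnegrE // mulr_ge0 ?(ltW d0) // divr_ge0 // subr_ge0 ltW.
have e1 : (d * (2 / (1 - r))) ^+ 2 = d ^+ 2 * (4 / (1 - r) ^+ 2).
  by field; rewrite subr_eq0 gt_eqF.
have e2 : d * (2 * d / (1 - r) ^+ 2) = d ^+ 2 * (2 / (1 - r) ^+ 2).
  by field; rewrite subr_eq0 gt_eqF.
(* 26 = 6 * 4 + 2: the second-order error of the exponential and the distance between h' and h. *)
have e3 : d ^+ 2 * (26 / (1 - r) ^+ 2) = 6 * (d ^+ 2 * (4 / (1 - r) ^+ 2)) +
   d ^+ 2 * (2 / (1 - r) ^+ 2) by ring.
rewrite e3 -e1 -e2; lra.
Qed.

Lemma atom_le1 (q : R * R[i]) z : 0 < q.1 -> modc q.2 = 1 -> modc z <= 1 ->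
  modc (atom_val q z) <= 1.
Proof.
move=> q0 q1 z1; rewrite /atom_val cmod_cexp expR_le1 ReN ReZ Re_herglotz q1 oppr_le0.
rewrite mulr_ge0 ?(ltW q0) // divr_ge0 ?exprn_ge0 // expr1n subr_ge0.
by rewrite expr_le1.
Qed.

(** The atom of mass m is the n-th power of the atom of mass d = m / n. Each Blaschke factor is
    within C d^2 of it, so the n-th powers differ by at most n C d^2 = C m^2 / n. *)
Lemma bfactor_approx_atom (q : R * R[i]) r e : 0 < q.1 -> modc q.2 = 1 ->
  0 <= r < 1 -> 0 < e -> exists s : seq R[i],
  [/\ s != [::], forall a, a \in s -> bok a &
    forall z, modc z <= r ->
      modc (fprod (@blaschke_factor R) s z - atom_val q z) <= e].
Proof.
case: q => m w /= m0 w1 /andP[r0 r1] e0.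
pose C := 26 / (1 - r) ^+ 2.
have C0 : 0 < C by rewrite divr_gt0 // exprn_gt0 // subr_gt0.
(* The three lower bounds on n give, in order, d < 1, the smallness of d that [bfactor_near_exp]
   asks for, and a total error at most e. *)
pose B := Num.max (m + 1) (Num.max (m * (4 / (1 - r))) (m ^+ 2 * C / e)).
pose n := (Num.truncn B).+1.
have nB : B < n%:R by exact: truncnS_gt.
have n0 : 0 < n%:R :> R by rewrite ltr0n.
move: nB; rewrite !gt_max => /and3P[n1 n2 n3].
pose d := m / n%:R.
have d0 : 0 < d by rewrite divr_gt0.
have d1 : d < 1 by rewrite ltr_pdivrMr // mul1r; lra.
have dn : d * n%:R = m by rewrite divfK // gt_eqF.
have dr : d * (2 / (1 - r)) <= 2^-1.
  rewrite /d mulrAC ler_pdivrMr //.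
  have -> : m * (2 / (1 - r)) = m * (4 / (1 - r)) / 2 by field; rewrite subr_eq0 gt_eqF.
  by rewrite mulrC; lra.
have oka : bok ((1 - d)%:C * w).
  rewrite /bok cmodM cmod_real w1 mulr1 gtr0_norm ?subr_gt0 //.
  by apply/andP; split; lra.
exists (nseq n ((1 - d)%:C * w)); split => //.
- by move=> a; rewrite mem_nseq => /andP[_ /eqP ->].
- move=> z zr; rewrite /fprod big_nseq.
  have z1 : modc z <= 1 by lra.
  have -> : atom_val (m, w) z = cexp (- (d%:C * herglotz w z)) ^+ n.
    rewrite /atom_val /= -dn real_complexM; elim: (n) => [|k IH].
      by rewrite mulr0 mul0r oppr0 cexp0 expr0.
    rewrite exprSr -IH -cexpD -natr1 real_complexD rmorph1; congr cexp; ring.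
  rewrite iter_mulr_1.
  have v1 : modc (cexp (- (d%:C * herglotz w z))) <= 1.
    exact: (@atom_le1 (d, w) z d0 w1 z1).
  apply: le_trans (cmod_expn_diff n (bfactor_le1 oka z1) v1) _.
  apply: le_trans (ler_wpM2l (ltW n0) (bfactor_near_exp w1 zr r1 d0 d1 dr)) _.
  rewrite -/C; have -> : n%:R * (d ^+ 2 * C) = m ^+ 2 * C / n%:R.
    rewrite -dn; move: {-}(n%:R : R) n0 => x x0.
    by field; rewrite gt_eqF.
  by rewrite ler_pdivrMr // [e * _]mulrC -ler_pdivrMr // ltW.
Qed.

Lemma bfactor_approx_atoms (s : seq (R * R[i])) r e :
  (forall q, q \in s -> 0 < q.1 /\ modc q.2 = 1) -> 0 <= r < 1 -> 0 < e -> s != [::] ->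
  exists s' : seq R[i],
  [/\ s' != [::], forall a, a \in s' -> bok a &
    forall z, modc z <= r ->
      modc (fprod (@blaschke_factor R) s' z - atom_prod s z) <= e].
Proof.
move=> + rr; elim: s e => [//|q s IH] e sP e0 _.
have [q0 q1] := sP q (mem_head _ _).
have [|t [t0 tok tP]] := bfactor_approx_atom q0 q1 rr (e := e / 2); first lra.
have [s0|s0] := eqVneq s [::].
  exists t; split => // z zr; rewrite s0 /atom_prod big_seq1.
  by apply: le_trans (tP z zr) _; lra.
have [||t' [t'0 t'ok t'P]] := IH (e / 2) _ _ s0.
- by move=> p ps; apply: sP; rewrite inE ps orbT.
- by lra.
exists (t ++ t'); split.
- by case: t {tok tP} t0.
- by move=> a; rewrite mem_cat => /orP[/tok|/t'ok].
- move=> z zr; rewrite fprod_cat /atom_prod big_cons -/(atom_prod s z).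
  have z1 : modc z <= 1 by case/andP: rr => ? ?; lra.
  set b := fprod _ t z; set b' := fprod _ t' z; set v := atom_val q z.
  have -> : b * b' - v * atom_prod s z =
    (b - v) * b' + v * (b' - atom_prod s z) by ring.
  have v1 : modc v <= 1 by exact: atom_le1.
  have b1 : modc b' <= 1.
    rewrite /b' /fprod big_seq; elim/big_rec : _ => [|a x /t'ok oka hx].
      by rewrite cmod1.
    by rewrite cmodM mulr_ile1 // bfactor_le1.
  apply: le_trans (cmodD _ _) _; rewrite (cmodM (b - v)) (cmodM v).
  have h1 : modc (b - v) * modc b' <= e / 2 * 1 by apply: ler_pM => //; exact: tP.
  have h2 : modc v * modc (b' - atom_prod s z) <= 1 * (e / 2).
    by apply: ler_pM => //; exact: t'P.
  lra.
Qed.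

Lemma blaschke_in_calU (K : set R[i]) : compact K -> ncover K -> K `<=` @circle R ->
  exists f, infinite_blaschke f /\ calU K f.
Proof.
move=> cK nK KT; have K1 z : K z -> modc z = 1 by move=> /KT.
have Kc : K `<=` @cdisc R by move=> z /K1 z1; rewrite /cdisc /= z1.
have uB a : bok a -> eucont (@cdisc R) (blaschke_factor a).
  by move=> oka; apply/papprox_eucont/bfactor_papprox.
have [||||||a [N [f [Uf oka NP cvf]]]] :=
  @product_scheme R _ (@blaschke_factor R) bok K cK nK KT.
- by move=> a z oka z1; apply: bfactor_le1 => //; exact: ltW.
- by move=> a z oka /K1; exact: bfactor_unim.
- move=> a oka z Kz e e0; have [d d0 dP] := uB a oka e e0.
  by exists d => // w Kw wz; apply: dP => //; exact: Kc.
- move=> a e oka e0; have [r r1 rP] := radial_close (uB a oka) e0.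
  by exists r => // t z rt /K1; exact: rP.
- by move=> a r oka r1; apply: papproxW (bfactor_papprox oka); exact: ltW.
(* A singular block is replaced by Blaschke factors on |z| <= t only: this disc contains both t K
   and |z| <= r. *)
- move=> psi r e upsi psi1 r1 e0.
  have [|s [t [s0 sP [/andP[rt t1] t0] sr st]]] :=
    singular_block cK nK KT upsi psi1 r1 (e := e / 2); first lra.
  have [|||s' [s'0 s'ok s'P]] := @bfactor_approx_atoms s t (e / 2) _ _ _ s0.
  + by move=> q /sP[].
  + by rewrite t1 ltW.
  + by lra.
  exists s', t; split => //; first by rewrite rt t1.
  + move=> z zr; apply: le_trans (cmod_dist (atom_prod s z) _ _) _.
    have := s'P z ltac:(lra); have := sr z zr; lra.
  + move=> z Kz; apply: le_trans (cmod_dist (atom_prod s (t%:C * z)) _ _) _.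
    have zt : modc (t%:C * z) <= t by rewrite cmodM cmod_real K1 // mulr1 gtr0_norm.
    have := s'P _ zt; have := st z Kz; lra.
have a0 n : 0 < modc (a n) by case/andP: (oka n).
have a1 n : 0 <= 1 - modc (a n) by have /andP[_ ?] := oka n; lra.
have sa : cvgn (series (fun n => 1 - modc (a n))).
  apply: (@nonneg_series_cvg _ _ (ln 2)) => // n; have [nN h] := NP n.
  exists (N n) => //; apply: (@le_trans _ _ (\sum_(k < N n) - ln (modc (a k)))).
    (* 1 - x <= - ln x turns the bound on logarithms into the Blaschke condition. *)
    apply: ler_sum => k _; have := expR_ge1Dx (ln (modc (a k))).
    by rewrite lnK ?posrE //; lra.
  apply: (@prod_half_ln R (fun k => modc (a k)) (N n)) => //; rewrite (eq_bigr (fun k : 'I_(N n) => blaschke_factor (a k) 0)) //.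
  by move=> k _; rewrite bfactor0.
exists f; split => //; exists 1, 0%N, a; split => //; first exact: cmod1.
move=> z z1; have {}z1 : modc z < 1 := z1; apply/cvg_cmodP => e e0.
(* From the subsequence N n to all partial products: the factors beyond N n0 differ from 1 by at
   most c (1 - |a k|), whose tail sums are small. *)
pose c := 2 / (1 - modc z); have c0 : 0 < c by rewrite divr_gt0 // subr_gt0.
have [|M HM] := @nonneg_series_tail _ _ (e / 3 / c) a1 sa; first by apply: divr_gt0 => //; lra.
have /cvg_cmodP/(_ (e / 2)) [|M' HM'] := cvf z z1; first lra.
pose n0 := maxn M M'; exists (N n0) => n nn.
rewrite expr0 mulr1 mul1r.
have Mn : (M <= N n0)%N by have [h _] := NP n0; exact: leq_trans (leq_maxl _ _) h.
apply: le_lt_trans (cmod_dist (\prod_(k < N n0) blaschke_factor (a k) z) _ _) _.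
have h1 := HM' n0 (leq_maxr _ _).
have z1' := ltW z1.
have h2 : modc (\prod_(k < n) blaschke_factor (a k) z -
     \prod_(k < N n0) blaschke_factor (a k) z) <= e / 3.
  rewrite -!(big_mkord xpredT (fun k => blaschke_factor (a k) z)).
  rewrite (big_cat_nat (leq0n _) nn) /= -[X in _ - X]mulr1 -mulrBr cmodM.
  apply: (@le_trans _ _ (1 * (c * (\sum_(N n0 <= k < n) (1 - modc (a k)))))).
    apply: ler_pM => //.
      elim/big_rec : _ => [|k x _ hx]; first by rewrite cmod1.
      by rewrite cmodM mulr_ile1 // bfactor_le1.
    have := @cmod_prod_diff nat (index_iota (N n0) n)
      (fun k => blaschke_factor (a k) z) (fun=> 1).
    rewrite [X in _ - X]big1 // => H; apply: le_trans (H _ _) _.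
    - by move=> k; exact: bfactor_le1.
    - by move=> k; rewrite cmod1.
    rewrite mulr_sumr; apply: ler_sum => k _; rewrite cmodBC.
    exact: bfactor_dist1.
  rewrite mul1r mulrC -ler_pdivlMr //; exact: HM.
lra.
Qed.

End Blaschke.

(** * Atomic measures *)

Section AtomicMeasure.
Variable R : realType.
Variables (m : nat -> {nonneg R}) (w : nat -> R[i]).
Hypothesis m_sum : cvgn (series (fun k => (m k)%:num)).
Hypothesis w1 : forall k, @circle R (w k).
Implicit Types (z v : R[i]) (x y e B : R).

Lemma open_measurableC (U : set R[i]) : open U -> measurable (U : set (borelC R)).
Proof. by move=> oU; exact: sub_sigma_algebra. Qed.

Lemma open_cmod_neq (A : set R[i]) (p : R[i] -> R) c :
  (forall z, A z <-> p z != c) -> (forall z v, `|p z - p v| <= modc (z - v)) -> open A.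
Proof.
move=> AE pl; rewrite openE => z /AE pz; apply/nbhs_cmodP.
exists `|p z - c|; first by rewrite normr_gt0 subr_eq0.
move=> v vz; apply/AE; apply/eqP => pv.
by have := pl z v; rewrite pv (cmodBC z); lra.
Qed.

Lemma circle_measurable : measurable (@circle R : set (borelC R)).
Proof.
rewrite -[@circle R]setCK; apply: measurableC; apply: open_measurableC.
apply: (@open_cmod_neq _ (@modc R) 1).
  by move=> z; split=> [h|/eqP h]; [apply/eqP|].
move=> z v; have := cmod_subl z v; have := cmod_subl v z.
by rewrite (cmodBC v) ler_norml => ? ?; apply/andP; split; lra.
Qed.

Lemma singleton_measurable z : measurable ([set z] : set (borelC R)).
Proof.
rewrite -[[set z]]setCK; apply: measurableC; apply: open_measurableC.
apply: (@open_cmod_neq _ (fun v => modc (v - z)) 0).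
  by move=> v; rewrite cmod_eq0 subr_eq0; split=> [h|/eqP h]; [apply/eqP|].
move=> u v; have E : (u - z) - (v - z) = u - v by rewrite opprB addrA subrK.
have := cmod_subl (u - z) (v - z); have := cmod_subl (v - z) (u - z).
by rewrite (cmodBC (v - z)) E ler_norml => ? ?; apply/andP; split; lra.
Qed.

Let nu k : {measure set (borelC R) -> \bar R} := mscale (m k) (\d_(w k : borelC R)).

Let tot : set (borelC R) -> \bar R := mseries nu 0.

Let totE (A : set (borelC R)) : tot A = (\sum_(0 <= k <oo) ((m k)%:num * (w k \in A)%:R)%:E)%E.
Proof.
by apply: eq_eseriesr => k _; rewrite /nu /= /mscale /= diracE -EFinM.
Qed.

Let eseries_lim (u : nat -> R) (L : R) : series u @ \oo --> L ->
  (\sum_(0 <= k <oo) (u k)%:E)%E = L%:E.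
Proof.
move=> uL; apply/cvg_lim => //.
have -> : (fun n => \sum_(0 <= k < n) (u k)%:E)%E = (EFin \o series u).
  by apply/funext => n /=; rewrite sumEFin.
by apply/fine_cvgP; split; [exact: nearW|exact: uL].
Qed.

Let tot_fin : fin_num_fun tot.
Proof.
apply: lty_fin_num_fun; change (tot setT < +oo)%E; rewrite totE.
have /cvg_ex[L hL] := m_sum; rewrite (@eseries_lim _ L) ?ltry //.
by under eq_fun do rewrite in_setT mulr1.
Qed.

Let totm : {measure set (borelC R) -> \bar R} := mseries nu 0.

Definition atomic_measure : {finite_measure set (borelC R) -> \bar R} :=
  HB.pack_for (FiniteMeasure.type (borelC R) R) (Measure.sort totm)
    (Measure_isFinite.Build _ _ _ totm tot_fin).

Lemma atomic_measure0 (A : set (borelC R)) : (forall k, ~ A (w k)) ->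
  atomic_measure A = 0%E.
Proof.
move=> Aw; change (tot A = 0%E); rewrite totE; apply: eseries0 => k _ _.
by rewrite memNset // mulr0.
Qed.

Let atomic_integral_ge0 (g : R[i] -> R) B :
  measurable_fun (@circle R : set (borelC R)) (g : borelC R -> R) ->
  (forall v, circle v -> 0 <= g v <= B) ->
  exists2 L, series (fun k => (m k)%:num * g (w k)) @ \oo --> L &
    (\int[atomic_measure]_(v in (@circle R : set (borelC R))) (g v)%:E = L%:E)%E.
Proof.
move=> mg gB; have g0 v : circle v -> 0 <= g v by move=> /gB/andP[].
have /cvg_ex[S hS] := m_sum.
have cv : cvgn (series (fun k => (m k)%:num * g (w k))).
  have mgE k : (m k)%:num * g (w k) <= (m k)%:num * B.
    by rewrite ler_wpM2l //; case/andP: (gB _ (w1 k)).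
  apply: (@series_le_cvg _ _ (fun k => (m k)%:num * B)) => //.
  - by move=> k; rewrite mulr_ge0 // g0.
  - by move=> k; apply: le_trans (mgE k); rewrite mulr_ge0 // g0.
  - have -> : (fun k => (m k)%:num * B) = B *: (fun k => (m k)%:num).
      by apply/funext => k; rewrite mulrC.
    exact: is_cvg_seriesZ.
have /cvg_ex[L hL] := cv; exists L => //.
have mE := (measurable_EFinP (@circle R : set (borelC R)) (g : borelC R -> R)).2 mg.
rewrite -(eseries_lim hL).
transitivity (\sum_(0 <= k <oo) \int[nu k]_(v in (@circle R : set (borelC R))) (g v)%:E)%E.
  by apply: ge0_integral_measure_series => //; exact: circle_measurable.
apply: eq_eseriesr => k _.
have mT := circle_measurable.
rewrite /nu ge0_integral_mscale //.
rewrite integral_dirac //.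
by rewrite diracE mem_set //= mul1e.
Qed.

(** Integration against a series of measures is available for nonnegative functions; boundedness and
    finite mass make the integrals of the positive and negative parts finite, so they can be
    subtracted. *)
Lemma atomic_Rintegral (g : R[i] -> R) B :
  measurable_fun (@circle R : set (borelC R)) (g : borelC R -> R) ->
  (forall v, circle v -> `|g v| <= B) ->
  series (fun k => (m k)%:num * g (w k)) @ \oo -->
    Rintegral atomic_measure (@circle R : set (borelC R)) g.
Proof.
move=> mg gB; pose gp (v : R[i]) := Num.max (g v) 0; pose gn (v : R[i]) := Num.max (- g v) 0.
have [|v /gB|L1 h1 i1] := @atomic_integral_ge0 gp B.
- by apply: measurable_maxr => //; exact: measurable_cst.
- by rewrite ler_norml le_max lexx orbT ge_max /= => /andP[? ?]; apply/andP; split; lra.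
have [|v /gB|L2 h2 i2] := @atomic_integral_ge0 gn B.
- apply: measurable_maxr; last exact: measurable_cst.
  exact: measurableT_comp.
- by rewrite ler_norml le_max lexx orbT ge_max /= => /andP[? ?]; apply/andP; split; lra.
rewrite /Rintegral integralE.
have -> : (fun v : borelC R => (g v)%:E)^\+%E = (fun v => (gp v)%:E).
  by apply/funext => v; rewrite funeposE -EFin_max.
have -> : (fun v : borelC R => (g v)%:E)^\-%E = (fun v => (gn v)%:E).
  by apply/funext => v; rewrite funenegE -EFinN -EFin_max.
rewrite i1 i2 -EFinB /=.
have -> : series (fun k => (m k)%:num * g (w k)) =
   series (fun k => (m k)%:num * gp (w k)) \- series (fun k => (m k)%:num * gn (w k)).
  apply/funext => n; rewrite /series /= -sumrB; apply: eq_bigr => k _.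
  by rewrite -mulrBr /gp /gn; congr (_ * _); case: (leP (g (w k)) 0); case: (leP (- g (w k)) 0); lra.
exact: cvgB.
Qed.

End AtomicMeasure.

(** Continuity is known on the circle only, so a superlevel set is written as the trace of a union
    of plane balls. *)
Lemma circle_measurable_fun (R : realType) (g : R[i] -> R) :
  (forall z, circle z -> forall e, 0 < e -> exists2 d, 0 < d &
     forall v, circle v -> modc (v - z) < d -> `|g v - g z| < e) ->
  measurable_fun (@circle R : set (borelC R)) (g : borelC R -> R).
Proof.
move=> cg; apply: (measurability _ (RGenOInfty.measurableE R)) => _ [_ [x ->] <-].
pose U : set R[i] := [set v | exists u d, [/\ 0 < d, modc (v - u) < d &
  forall v', circle v' -> modc (v' - u) < d -> x < g v']].
have oU : open U.
  rewrite openE => v [u [d [d0 vu H]]]; apply/nbhs_cmodP.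
  exists (d - modc (v - u)); first by rewrite subr_gt0.
  move=> v' v'v; exists u, d; split => //.
  by apply: le_lt_trans (cmod_dist v _ _) _; lra.
have -> : @circle R `&` g @^-1` `]x, +oo[ = @circle R `&` U.
  apply/seteqP; split=> v [v1]; rewrite /= ?in_itv /= ?andbT.
    move=> gx; split => //; have [|d d0 dP] := cg v v1 (g v - x); first by rewrite subr_gt0.
    exists v, d; split => //; first by rewrite subrr cmod0.
    by move=> v' v'1 /(dP v' v'1); rewrite ltr_norml => /andP[? ?]; lra.
  by move=> [u [d [d0 vu H]]]; split => //; rewrite ?in_itv /= ?andbT; exact: H.
by apply: measurableI; [exact: circle_measurable|exact: open_measurableC].
Qed.

(** * Atomic measures as singular measures, and their Herglotz integrals *)

Section SingularInner.
Variable R : realType.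
Implicit Types (z w v : R[i]) (x y e r d : R).

Lemma cis_inj x y : 0 <= x < 2 * pi -> 0 <= y < 2 * pi -> cis x = cis y -> x = y.
Proof.
wlog xy : x y / x < y => [H|] /andP[x0 xp] /andP[y0 yp] E.
  have [xy|yx|//] := ltgtP x y; first by apply: H => //; apply/andP.
  by apply/esym/H => //; apply/andP.
have h : 0 < y - x < 2 * pi by apply/andP; split; lra.
have := cis_neq1 h; suff -> : cis (y - x) = 1 by rewrite eqxx.
have c0 : cis x != 0 by rewrite -cmod_gt0 cis_cmod.
by apply: (mulfI c0); rewrite -cisD addrC subrK mulr1.
Qed.

Lemma arclength_countable (w : nat -> R[i]) : (forall k, circle (w k)) ->
  arclength (range w) = 0%E.
Proof.
move=> w1; have /choice[t tP] : forall k, exists t, 0 <= t < 2 * pi /\ w k = cis t.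
  by move=> k; have [t ? ?] := circle_cis (w1 k); exists t.
apply: countable_lebesgue_measure0.
apply: (card_le_trans _ (card_image_le t setT)); apply: subset_card_le.
move=> s [/=]; rewrite in_itv /= => s0 [k _ wk]; exists k => //.
by have [tk wt] := tP k; apply: cis_inj => //; rewrite -wk.
Qed.

Lemma herglotz_measurable z : modc z < 1 ->
  measurable_fun (@circle R : set (borelC R)) (fun w : borelC R => complex.Re (herglotz w z)) /\
  measurable_fun (@circle R : set (borelC R)) (fun w : borelC R => complex.Im (herglotz w z)).
Proof.
move=> z1; pose C := 2 / (1 - modc z) ^+ 2.
have C0 : 0 < C by rewrite divr_gt0 // exprn_gt0 // subr_gt0.
have cP v e : circle v -> 0 < e -> exists2 d, 0 < d &
    forall u, circle u -> modc (u - v) < d -> modc (herglotz u z - herglotz v z) < e.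
  move=> v1 e0; exists (e / C); first by rewrite divr_gt0.
  move=> u u1 uv; apply: le_lt_trans (herglotz_lip u1 v1 z1 (lexx _)) _.
  by rewrite -/C cmodBC mulrC -ltr_pdivlMr.
split; apply: circle_measurable_fun => v v1 e e0; have [d d0 dP] := cP v e v1 e0;
  exists d => // u u1 uv; have := dP u u1 uv; apply: le_lt_trans.
- by rewrite -ReB; exact: Re_le_cmod.
- by rewrite -ImB; exact: Im_le_cmod.
Qed.

Lemma herglotz_le w z : modc w = 1 -> modc z < 1 -> modc (herglotz w z) <= 2 / (1 - modc z).
Proof.
move=> w1 z1; rewrite /herglotz cmodf; apply: ler_pM; rewrite ?invr_ge0 //.
  by apply: le_trans (cmodD _ _) _; lra.
have wz : 1 - modc z <= modc (w - z) by have := cmod_subl w z; lra.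
by rewrite lef_pV2 ?posrE //; lra.
Qed.

Lemma atomic_singular (m : nat -> {nonneg R}) (w : nat -> R[i])
    (m_sum : cvgn (series (fun k => (m k)%:num))) (w1 : forall k, circle (w k)) :
  on_circle (atomic_measure w m_sum) /\ singular_to_arclength (atomic_measure w m_sum).
Proof.
split; first by apply: atomic_measure0 => k; apply; exact: w1.
exists (range w); split.
- rewrite [range w](_ : _ = \bigcup_k [set w k]); last first.
    by apply/seteqP; split=> [_ [k _ <-]|v [k _ ->]]; exists k.
  by apply: bigcup_measurable => k _; exact: singleton_measurable.
- by move=> _ [k _ <-]; exact: w1.
- exact: arclength_countable.
- by apply: atomic_measure0 => k [_]; apply; exists k.
Qed.

Lemma atomic_Cintegral (m : nat -> {nonneg R}) (w : nat -> R[i])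
    (m_sum : cvgn (series (fun k => (m k)%:num))) (w1 : forall k, circle (w k)) z :
  modc z < 1 -> (fun n => \sum_(k < n) (m k)%:num%:C * herglotz (w k) z) @ \oo -->
    Cintegral (atomic_measure w m_sum) (@circle R) (fun v => herglotz v z).
Proof.
move=> z1; have [mRe mIm] := herglotz_measurable z1.
have := @atomic_Rintegral R m w m_sum w1 _ (2 / (1 - modc z)) mRe.
have := @atomic_Rintegral R m w m_sum w1 _ (2 / (1 - modc z)) mIm.
move=> /(_ _)/cvg_realP HI /(_ _)/cvg_realP HR; apply/cvg_cmodP => e e0.
have [||M HM] := HI _ (e / 2).
- by move=> v v1; apply: le_trans (Im_le_cmod _) _; exact: herglotz_le.
- by lra.
have [||N HN] := HR _ (e / 2).
- by move=> v v1; apply: le_trans (Re_le_cmod _) _; exact: herglotz_le.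
- by lra.
exists (maxn M N) => n; rewrite geq_max => /andP[/HM + /HN].
rewrite /series /= !big_mkord => h1 h2; apply: le_lt_trans (cmod_leReIm _) _.
rewrite ReB ImB Re_sum Im_sum /Cintegral /=.
under eq_bigr do rewrite ReZ; under [X in _ + `|X - _|]eq_bigr do rewrite ImZ.
lra.
Qed.

End SingularInner.

(** * The universal singular inner function *)

Section SingularUniversal.
Variable R : realType.
Implicit Types (z w v : R[i]) (x y e r d : R).

Lemma cmod_atom_circle (q : R * R[i]) z : modc q.2 = 1 -> modc z = 1 ->
  modc (atom_val q z) = 1.
Proof.
move=> q1 z1; rewrite /atom_val cmod_cexp ReN ReZ Re_herglotz q1 z1.
by rewrite subrr mul0r mulr0 oppr0 expR0.
Qed.

(** Atoms are limits of finite Blaschke products, whose poles lie outside the closed disc and which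
    are thus limits of polynomials. *)
Lemma atom_papprox (q : R * R[i]) r : 0 < q.1 -> modc q.2 = 1 -> r < 1 ->
  papprox r (atom_val q).
Proof.
move=> q0 q1 r1; apply: (@papproxW _ (Num.max r 0)); first by rewrite le_max lexx.
have r01 : 0 <= Num.max r 0 < 1 by rewrite le_max lexx orbT gt_max r1 ltr01.
apply: papprox_lim => e e0; have [s [_ sok sP]] := bfactor_approx_atom q0 q1 r01 e0.
exists (fprod (@blaschke_factor R) s); last by move=> z /sP; rewrite cmodBC.
elim: s sok {sP} => [|a s IH] sok.
  by apply: papprox_ext (papprox_cst _ 1) => z _; rewrite fprod_nil.
have aok : bok a by apply: sok; rewrite mem_head.
apply: papprox_ext (papproxM (papproxW _ (bfactor_papprox aok)) (IH _)).
- by move=> z _; rewrite fprod_cons.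
- by case/andP: r01 => _ /ltW.
- by move=> b bs; apply: sok; rewrite inE bs orbT.
Qed.

(** Away from its mass point an atom extends continuously to the circle; for this reason the mass
    points are kept off K. *)
Lemma atom_close (q : R * R[i]) d e : 0 < q.1 -> modc q.2 = 1 -> 0 < d -> 0 < e ->
  exists2 t, 0 < t & forall z v, d <= modc (z - q.2) -> modc z <= 1 -> modc v <= 1 ->
    modc (v - z) < t -> modc (atom_val q v - atom_val q z) < e.
Proof.
case: q => m w /= m0 w1 d0 e0.
have [C CE] : exists C, C = 2 * m / (d / 2 * d) by exists (2 * m / (d / 2 * d)).
have C0 : 0 < C by rewrite CE divr_gt0 // !mulr_gt0 ?divr_gt0.
exists (Num.min (d / 2) (Num.min (2^-1 / C) (e / (4 * C)))).
  by rewrite !lt_min !divr_gt0 // mulr_gt0.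
move=> z v dz z1 v1; rewrite !lt_min => /and3P[vd vC ve].
have wz : d <= modc (w - z) by rewrite cmodBC.
have wv : d / 2 <= modc (w - v).
  have E : w - z = (w - v) + (v - z) by rewrite addrA subrK.
  by have := cmodD (w - v) (v - z); rewrite -E; lra.
have wz0 : w - z != 0 by rewrite -cmod_gt0; lra.
have wv0 : w - v != 0 by rewrite -cmod_gt0; lra.
have L : modc (- (m%:C * herglotz w v) - - (m%:C * herglotz w z)) <= C * modc (v - z).
  have -> : - (m%:C * herglotz w v) - - (m%:C * herglotz w z) =
     - (2%:R * m%:C * w * (v - z)) / ((w - v) * (w - z)).
    by rewrite /herglotz; field; rewrite wz0 wv0.
  rewrite cmodf cmodN !cmodM w1 mulr1 cmod_real (gtr0_norm m0) -(rmorph_nat (real_complex R)).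
  rewrite cmod_real normr_nat CE mulrAC; apply: ler_wpM2r => //.
  apply: ler_wpM2l; first by lra.
  have d20 : 0 < d / 2 by lra.
  rewrite lef_pV2 ?posrE; last 2 first.
  - by rewrite mulr_gt0 ?cmod_gt0.
  - exact: mulr_gt0.
  by apply: ler_pM wv wz; exact: ltW.
have R0 : complex.Re (- (m%:C * herglotz w z)) <= 0.
  rewrite ReN oppr_le0 ReZ Re_herglotz w1 mulr_ge0 ?(ltW m0) // divr_ge0 ?exprn_ge0 //.
  by rewrite expr1n subr_ge0 expr_le1.
have hC : C * modc (v - z) < 2^-1 by rewrite mulrC -ltr_pdivlMr.
have := @cexp_lip R 0 (- (m%:C * herglotz w v)) _ R0 ltac:(lra).
rewrite expR0 mulr1 => h; apply: le_lt_trans h _.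
have : C * modc (v - z) < e / 4.
  by rewrite mulrC -ltr_pdivlMr //; apply: lt_le_trans ve _; rewrite invfM mulrA.
lra.
Qed.

Lemma compact_dist (K : set R[i]) w : compact K -> ~ K w ->
  exists2 d, 0 < d & forall z, K z -> d <= modc (z - w).
Proof.
move=> cK Kw; have oK : open (~` K) by apply: closed_openC; exact: compact_closed.
have /nbhs_cmodP[d d0 dP] : nbhs w (~` K) by exact: open_nbhs_nbhs.
exists d => // z Kz; rewrite leNgt; apply/negP => zd; exact: dP zd Kz.
Qed.

Lemma singular_in_calU (K : set R[i]) : compact K -> ncover K -> K `<=` @circle R ->
  exists f, singular_inner f /\ calU K f.
Proof.
move=> cK nK KT; have K1 z : K z -> modc z = 1 by move=> /KT.
pose ok (q : R * R[i]) := [/\ 0 < q.1, modc q.2 = 1 & ~ K q.2].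
have [||||||q [N [f [Uf okq NP cvf]]]] :=
  @product_scheme R _ (@atom_val R) ok K cK nK KT.
- by move=> p z [p0 p1 _] z1; apply: atom_le1 => //; exact: ltW.
- by move=> p z [p0 p1 _] /K1; exact: cmod_atom_circle.
- move=> p [p0 p1 Kp] z Kz e e0; have [d d0 dP] := compact_dist cK Kp.
  have [t t0 tP] := atom_close p0 p1 d0 e0.
  by exists t => // v Kv vz; apply: tP => //; [exact: dP|rewrite (K1 z Kz)|rewrite (K1 v Kv)].
- move=> p e [p0 p1 Kp] e0; have [d d0 dP] := compact_dist cK Kp.
  have [t t0 tP] := atom_close p0 p1 d0 e0.
  exists (1 - Num.min t 1); first by rewrite ltrBlDr ltrDl lt_min t0 ltr01.
  move=> s z /andP[ts s1] Kz; have m1 : Num.min t 1 <= 1 by rewrite ge_min lexx orbT.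
  have mt : Num.min t 1 <= t by rewrite ge_min lexx.
  apply/ltW/tP; first exact: dP.
  - by rewrite (K1 z Kz).
  - by rewrite cmodM cmod_real K1 // mulr1 gtr0_norm; lra.
  have -> : s%:C * z - z = (s - 1)%:C * z by rewrite real_complexB rmorph1; ring.
  by rewrite cmodM cmod_real K1 // mulr1 ltr0_norm; lra.
- by move=> p r [p0 p1 _]; exact: atom_papprox.
- by move=> psi r e upsi psi1 r1 e0; exact: singular_block.
have q0 k : 0 < (q k).1 by case: (okq k).
have q1 k : circle (q k).2 by case: (okq k).
pose m k : {nonneg R} := NngNum (ltW (q0 k)).
(* The Herglotz kernel equals 1 at z = 0, so the k-th factor is exp (- m k) there and its logarithm
   is exactly the mass. *)
have m_sum : cvgn (series (fun k => (m k)%:num)).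
  apply: (@nonneg_series_cvg _ _ (ln 2)) => // n; have [nN h] := NP n.
  exists (N n) => //; rewrite (eq_bigr (fun k : 'I__ => - ln (expR (- (q k).1)))); last first.
    by move=> k _; rewrite expRK opprK.
  apply: (@prod_half_ln R (fun k => expR (- (q k).1))) => [k|]; first exact: expR_gt0.
  apply: le_trans h; rewrite le_eqVlt; apply/orP; left; apply/eqP.
  congr (modc (_ - 1)); apply: eq_bigr => k _.
  rewrite /atom_val /herglotz addr0 subr0 divff ?mulr1; last by rewrite -cmod_gt0 [modc _]q1.
  by rewrite -cexp_real rmorphN.
pose w k := (q k).2.
have [muT muS] := @atomic_singular R m w m_sum q1.
(* The product of the first N n atoms is the exponential of minus a partial sum of the integral I;
   [cexp] is Lipschitz near - I, so both sides are limits of the same sequence. *)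
have fE z : modc z < 1 ->
    f z = cexp (- Cintegral (atomic_measure w m_sum) (@circle R) (fun v => herglotz v z)).
  move=> z1; set I := Cintegral _ _ _.
  have /cvg_cmodP HI := @atomic_Cintegral R m w m_sum q1 z z1.
  have /cvg_cmodP Hf := cvf z z1.
  apply/eqP; rewrite -subr_eq0 -cmod_eq0; apply/eqP/le_anti; rewrite cmod_ge0 andbT.
  apply/ler_addgt0Pr => e e0; rewrite add0r.
  pose M := complex.Re (- I); have M0 := expR_gt0 M.
  pose t := Num.min 2^-1 (e / 2 / (4 * expR M)).
  have t0 : 0 < t by rewrite lt_min invr_gt0 ltr0n !divr_gt0 // mulr_gt0.
  have [n1 H1] := HI t t0; have [|n2 H2] := Hf (e / 2); first lra.
  pose n := maxn n1 n2; have h2 := H2 n (leq_maxr _ _).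
  have n1N : (n1 <= N n)%N by have [h _] := NP n; exact: leq_trans (leq_maxl _ _) h.
  have := H1 _ n1N; rewrite lt_min => /andP[h3 h4].
  set S := \sum_(k < N n) _ in h3 h4.
  have E : \prod_(k < N n) atom_val (q k) z = cexp (- S) by rewrite /S -sumrN cexp_sum.
  have D : modc (- S - - I) = modc (S - I) by rewrite -opprD cmodN.
  have h5 : modc (cexp (- S) - cexp (- I)) <= 4 * expR M * modc (S - I).
    by rewrite -D; apply: cexp_lip; [exact: lexx|rewrite D; exact: ltW].
  have h6 : 4 * expR M * modc (S - I) <= e / 2.
    by rewrite mulrC -ler_pdivlMr ?mulr_gt0 // ltW.
  rewrite E cmodBC in h2; apply: le_trans (cmod_dist (cexp (- S)) _ _) _.
  by rewrite [leRHS](splitr e) lerD // ?(ltW h2) // (le_trans h5).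
exists f; split; last exact: Uf.
split; first by split; [case: Uf|move=> z z1; rewrite (fE z z1); exact: cexp_neq0].
exists (atomic_measure w m_sum); split; [exact: muT|exact: muS|].
by move=> z z1; exact: fE.
Qed.

End SingularUniversal.

Theorem theorem3p3 (R : realType) (K : set R[i])
    (K_compact : compact K) (K_circle : K `<=` @circle R)
    (K_null : arclength K = 0%E) :
  [/\ Gdelta [set f : Bspace R | calU K (Bval f)] /\
        dense [set f : Bspace R | calU K (Bval f)],
      exists f : R[i] -> R[i], infinite_blaschke f /\ calU K f,
      Gdelta [set f : Sspace R | calU K (Sval f)] /\
        dense [set f : Sspace R | calU K (Sval f)] &
      exists f : R[i] -> R[i], singular_inner f /\ calU K f].
Proof.
have nK := null_ncover K_compact K_circle K_null.
split.
- split; first exact: calU_Gdelta.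
  apply: calU_dense => f r e fB r1 e0.
  have [h Uh hf] := calU_dense_calB K_compact nK K_circle fB r1 e0.
  by exists h => //; split => //; case: Uh.
- exact: blaschke_in_calU.
- split; first by apply: calU_Gdelta => // f [].
  by apply: calU_dense => f r e fS r1 e0; exact: calU_dense_calS.
- exact: singular_in_calU.
Qed.
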